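(* Let $\mathcal R=(\Omega,\mathbb P,\sigma,X,\mathcal L)$ be a random linear dynamical system and let $X'$ be a dense subspace of $X$ equipped with a finer norm such that $\mathcal L_\omega(X')\subset X'$ for a.e. $\omega$. Let $\mathcal R'=(\Omega,\mathbb P,\sigma,X',\mathcal L|_{X'})$ be the restriction of $\mathcal R$ to $X'$. Suppose that $\mathcal R$ and $\mathcal R'$ both satisfy the hypotheses of the Multiplicative Ergodic Theorem listed in the context. Then the exceptional Lyapunov exponents of $\mathcal R$ and $\mathcal R'$ that exceed $\max(\kappa(\mathcal R),\kappa(\mathcal R'))$ coincide, as do the corresponding Oseledets spaces (for $\mathbb P$-a.e. $\omega$).
   Context: A random linear dynamical system $\mathcal R=(\Omega,\mathbb P,\sigma,X,\mathcal L)$ consists of an ergodic measure-preserving transformation $\sigma$ of a probability space $(\Omega,\mathbb P)$, a Banach space $X$, and a strongly measurable family $(\mathcal L_\omega)_{\omega\in\Omega}$ of bounded linear operators on $X$ (i.e. $\omega\mapsto\mathcal L_\omega x$ is measurable for each $x\in X$). $\mathcal L^{(n)}_\omega=\mathcal L_{\sigma^{n-1}\omega}\circ\cdots\circ\mathcal L_\omega$. Let $\lambda_1=\lim\frac1n\log\|\mathcal L^{(n)}_\omega\|$ and $\kappa(\mathcal R)=\lim\frac1n\log\alpha(\mathcal L^{(n)}_\omega)$ (both a.e. constant), where $\alpha(L)$ is the infimum of real $t$ such that the image of the unit ball under $L$ can be covered by finitely many balls of radius $t$. Hypotheses of the Multiplicative Ergodic Theorem: $\sigma$ is invertible and ergodic,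 $X$ is a Banach space with separable dual, the cocycle is strongly measurable and quasi-compact ($\kappa<\lambda_1$), and $\int\log\|\mathcal L_\omega\|\,d\mathbb P<\infty$. Its conclusion: there are exceptional Lyapunov exponents $\lambda_1>\lambda_2>\cdots>\kappa$ (finitely or infinitely many), and for a.e. $\omega$ finite-dimensional Oseledets spaces $V_i(\omega)$ of a.e. constant dimension with $\mathcal L_\omega V_i(\omega)=V_i(\sigma\omega)$, $\frac1n\log\|\mathcal L^{(n)}_\omega x\|\to\lambda_i$ for $x\in V_i(\omega)\setminus\{0\}$, and for each $j$ a closed equivariant complement $F_j(\omega)$ of $V_1(\omega)\oplus\cdots\oplus V_j(\omega)$ on which $\limsup\frac1n\log\|\mathcal L^{(n)}_\omega x\|\le\lambda_{j+1}$ (or $\kappa$ if $\lambda_j$ is the last exceptional exponent). ''Finer norm'' means $\|x\|_{X'}\ge\|x\|_X$ for all $x\in X'$; $X'$ is a Banach space under $\|\cdot\|_{X'}$. If $(\lambda_j),(V_j)$ and $(\lambda_j'),(V_j')$ are the exceptional exponents and Oseledets spaces of $\mathcal R$ and $\mathcal R'$, the conclusion means: whenever $\max(\lambda_j,\lambda'_j)>\max(\kappa(\mathcal R),\kappa(\mathcal R'))$, one has $\lambda_j=\lambda_j'$ and $V_j(\omega)=V_j'(\omega)$ for a.e. $\omega$.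
   Formalization: The Oseledets spaces are assumed to depend measurably on ω (a.e. spanned by a measurable frame), as in the usual theorem; without this they are not unique, e.g. for the constant cocycle diag(2,1). Scalars are real; complex spaces are covered as real ones. *)

(* Defs.v *)
From HB Require Import structures.
From mathcomp Require Import all_boot all_order all_algebra.
From mathcomp Require Import all_classical all_reals all_analysis.

Set Implicit Arguments.
Unset Strict Implicit.
Unset Printing Implicit Defensive.

Import Order.TTheory GRing.Theory Num.Theory.
Import numFieldNormedType.Exports.

Local Open Scope classical_set_scope.
Local Open Scope ring_scope.

Definition invertible_mod d (T : measurableType d) (sigma : T -> T) : Prop :=
  exists tau : T -> T,
    [/\ measurable_fun setT tau, cancel sigma tau & cancel tau sigma].

Definition measure_preserving (R : realType) d (T : measurableType d)
    (P : probability T R) (sigma : T -> T) : Prop :=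
  measurable_fun setT sigma /\
  forall A, measurable A -> P (sigma @^-1` A) = P A.

Definition ergodic (R : realType) d (T : measurableType d)
    (P : probability T R) (sigma : T -> T) : Prop :=
  forall A, measurable A -> sigma @^-1` A = A ->
    (P A = 0 \/ P A = 1)%E.

(* Measurability with respect to the Borel sigma-algebra of the norm. *)
Definition borel_measurable (R : realType) d (T : measurableType d)
    (X : normedModType R) (f : T -> X) : Prop :=
  measurable_fun setT (f : T -> g_sigma_algebraType (@open X)).

Definition opnorm (R : realType) (X Y : normedModType R) (f : X -> Y) : R :=
  sup [set `|f x| | x in [set x : X | `|x| <= 1]].

Definition separable_dual (R : realType) (X : normedModType R) : Prop :=
  exists D : set {linear X -> R^o},
    [/\ countable D, forall psi, D psi -> continuous psi &
     forall phi : {linear X -> R^o}, continuous phi -> forall e : R, 0 < e ->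
       exists2 psi, D psi & opnorm (fun x => phi x - psi x) < e].

(* The index of compactness alpha. *)
Definition ball_noncompactness (R : realType) (X Y : normedModType R)
    (f : X -> Y) : R :=
  inf [set t : R | exists2 C : set Y, finite_set C &
    f @` [set x | `|x| <= 1] `<=` \bigcup_(c in C) ball c t].

Fixpoint cocycle (R : realType) d (T : measurableType d) (X : normedModType R)
    (sigma : T -> T) (L : T -> {linear X -> X}) (n : nat) (w : T) (x : X) : X :=
  if n is m.+1 then L (iter m sigma w) (cocycle sigma L m w x) else x.

(* (1/n) log r in the extended reals, with log 0 = -oo. *)
Definition log_rate (R : realType) (n : nat) (r : R) : \bar R :=
  ((n%:R^-1)%:E * lne r%:E)%E.

(* The scalars are real; a complex Banach space is covered through its
   underlying real Banach space. *)
Record random_linear_system (R : realType) d (T : measurableType d)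
    (P : probability T R) (sigma : T -> T) (X : completeNormedModType R)
    (L : T -> {linear X -> X}) : Prop := RandomLinearSystem {
  rls_preserving : measure_preserving P sigma ;
  rls_ergodic : ergodic P sigma ;
  rls_bounded : forall w, continuous (L w) ;
  rls_measurable : forall x, borel_measurable (fun w => L w x) }.

Definition is_top_exponent (R : realType) d (T : measurableType d)
    (P : probability T R) (sigma : T -> T) (X : normedModType R)
    (L : T -> {linear X -> X}) (lambda1 : \bar R) : Prop :=
  {ae P, forall w,
    (fun n => log_rate n (opnorm (cocycle sigma L n w))) @ \oo --> lambda1}.

Definition is_kappa (R : realType) d (T : measurableType d)
    (P : probability T R) (sigma : T -> T) (X : normedModType R)
    (L : T -> {linear X -> X}) (kappa : \bar R) : Prop :=
  {ae P, forall w,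
    (fun n => log_rate n (ball_noncompactness (cocycle sigma L n w)))
      @ \oo --> kappa}.

(* The integral of log ||L|| may be -oo, so its being defined and < +oo amounts
   to the finiteness of the integral of the positive part; the library integral
   of the signed function would also be -oo when both parts are infinite. *)
Record met_hypotheses (R : realType) d (T : measurableType d)
    (P : probability T R) (sigma : T -> T) (X : completeNormedModType R)
    (L : T -> {linear X -> X}) (lambda1 kappa : \bar R) : Prop :=
  MetHypotheses {
  met_system : random_linear_system P sigma L ;
  met_invertible : invertible_mod sigma ;
  met_separable_dual : separable_dual X ;
  met_top_exponent : is_top_exponent P sigma L lambda1 ;
  met_kappa : is_kappa P sigma L kappa ;
  met_quasi_compact : (kappa < lambda1)%E ;
  met_integrable :
    (\int[P]_w ((fun u => lne (opnorm (L u))%:E)^\+ w) < +oo)%E }.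

(* V is a measurable family of subspaces of a.e. constant, positive, finite
   dimension k: it admits a measurable frame of k vectors.  Measurability is
   essential: non-measurable equivariant families with the right growth are not
   unique. *)
Definition measurable_bundle (R : realType) d (T : measurableType d)
    (P : probability T R) (X : normedModType R) (V : T -> set X) : Prop :=
  exists (k : nat) (e : 'I_k -> T -> X),
    [/\ (0 < k)%N, forall i, borel_measurable (e i) &
     {ae P, forall w,
       V w = [set x | exists c : 'I_k -> R, x = \sum_i c i *: e i w] /\
       forall c : 'I_k -> R, \sum_i c i *: e i w = 0 -> forall i, c i = 0}].

Definition closed_subspace (R : realType) (X : normedModType R)
    (F : set X) : Prop :=
  [/\ closed F, F 0 & forall (a : R) x y, F x -> F y -> F (a *: x + y)].

(* X is the direct sum of V 0, ..., V j and F, all assumed to be subspaces. *)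
Definition direct_decomposition (R : realType) (X : normedModType R)
    (j : nat) (V : nat -> set X) (F : set X) : Prop :=
  (forall x, exists (v : 'I_j.+1 -> X) (f : X),
     [/\ forall i : 'I_j.+1, V i (v i), F f & x = \sum_i v i + f]) /\
  (forall (v : 'I_j.+1 -> X) (f : X), (forall i : 'I_j.+1, V i (v i)) -> F f ->
     \sum_i v i + f = 0 -> (forall i, v i = 0) /\ f = 0).

(* Exceptional exponents, indexed from 0.  There may be finitely or infinitely
   many: the sequence is padded with kappa after the last one, so j is the index
   of an exceptional exponent iff kappa < lam j. *)
Definition exceptional_exponents (R : realType) (lambda1 kappa : \bar R)
    (lam : nat -> \bar R) : Prop :=
  [/\ lam 0%N = lambda1, forall j, (lam j < +oo)%E,
   forall j, (kappa < lam j)%E -> (kappa <= lam j.+1 < lam j)%E &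
   forall j, lam j = kappa -> lam j.+1 = kappa].

(* lam and V are the exceptional exponents and Oseledets spaces of the cocycle.
   Indices being shifted, F is the complement of V 0 + ... + V j; thanks to the
   padding of lam its growth is bounded by lam j.+1 in all cases.  V j is
   unconstrained when j is not the index of an exceptional exponent. *)
Definition oseledets_splitting (R : realType) d (T : measurableType d)
    (P : probability T R) (sigma : T -> T) (X : normedModType R)
    (L : T -> {linear X -> X}) (lambda1 kappa : \bar R)
    (lam : nat -> \bar R) (V : nat -> T -> set X) : Prop :=
  exceptional_exponents lambda1 kappa lam /\
  forall j, (kappa < lam j)%E ->
    [/\ measurable_bundle P (V j),
        {ae P, forall w, L w @` V j w = V j (sigma w)},
        {ae P, forall w x, V j w x -> x != 0 ->
          (fun n => log_rate n `|cocycle sigma L n w x|) @ \oo --> lam j} &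
        exists F : T -> set X,
          [/\ {ae P, forall w, closed_subspace (F w)},
              {ae P, forall w, direct_decomposition j (V^~ w) (F w)},
              {ae P, forall w, L w @` F w `<=` F (sigma w)} &
              {ae P, forall w x, F w x ->
                (limn_esup (fun n => log_rate n `|cocycle sigma L n w x|)
                  <= lam j.+1)%E}]].

(* X', with its own norm, seen as a dense subspace of X through iota. *)
Definition dense_subspace_finer_norm (R : realType) (X X' : normedModType R)
    (iota : {linear X' -> X}) : Prop :=
  [/\ injective iota, dense (range iota) & forall x, `|iota x| <= `|x|].

Definition restriction_of (R : realType) d (T : measurableType d)
    (P : probability T R) (X X' : normedModType R) (iota : {linear X' -> X})
    (L : T -> {linear X -> X}) (L' : T -> {linear X' -> X'}) : Prop :=
  {ae P, forall w x, iota (L' w x) = L w (iota x)}.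

(* Main.v *)
(* Write q for the X-norm along the orbit of the big cocycle and q' for the
   X'-norm along that of the restriction.  On the finite-dimensional bundle V'_j
   the two norms are equivalent, with a measurable constant, so by recurrence a
   vector of V'_j grows at rate lam'_j for q too, at least along a subsequence;
   density of X' makes every V_j visible from X'.  Decomposing vectors along the
   two splittings then gives lam_j = lam'_j and iota V'_j = V_j, once the bundle
   iota V'_j is known to lie in V_j.

   For that inclusion, each x in V'_j(w) splits as v + f with v in V_j and f of
   strictly smaller growth, so the distance from V'_j(sigma^n w) to V_j tends to
   0, and vanishes by stationarity, provided that the cocycle expands V'_j
   uniformly at the rate lam_j.  Uniformity does not follow pointwise; it is
   proved by induction on the length m of a flag in V'_j.  The volume of a flag is
   multiplicative along orbits.  If volumes of (m+1)-flags do not grow at the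
   maximal rate on a set of positive measure, then a covering argument and the
   maximal ergodic inequality make all of them grow slowly at almost every time.
   Over an m-flag growing at the maximal rate, the almost null combinations of a
   further vector with the flag then converge, to a vector that grows too slowly. *)

Require Import Defs.
From HB Require Import structures.
From mathcomp Require Import all_boot all_order all_algebra.
From mathcomp Require Import all_classical all_reals all_analysis.
From mathcomp Require Import measurable_realfun ring lra.

Set Implicit Arguments.
Unset Strict Implicit.
Unset Printing Implicit Defensive.

Import Order.TTheory GRing.Theory Num.Theory.
Import numFieldNormedType.Exports.

Local Open Scope classical_set_scope.
Local Open Scope ring_scope.

(** * Hahn-Banach and separability *)

(** The obstacle is that an Oseledets splitting gives growth rates vector by vector only. A unit
    vector of V'_j at time n is the image of a vector that changes with n, so its distance to V_j
    can be estimated only with a constant valid for the whole fiber. Such a constant is obtained on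
    a set of positive measure, which is enough: stationarity turns eventual closeness along orbits
    into closeness on a set of definite measure, and ergodicity finishes.

    For the uniform bound, V'_j is read in a measurable frame, as a family of norms on row vectors.
    If all vectors grow at rate at most lambda and an m-flag has volume of rate about m times
    lambda, then no vector of the flag can approach the span of its predecessors exponentially fast,
    so coefficients are controlled by the norm up to a subexponential loss. No limit of volume rates
    is ever taken: one works with a deficit beta and an error theta, chosen small against beta.

    Comparing the exponents, by strong induction on j, is deterministic: it takes place at a single
    well-chosen point. *)

Definition infr (R : realType) (I : Type) (f : I -> R) : R := inf (range f).

Section infr_theory.
Context (R : realType) (I : Type).
Implicit Types (f : I -> R) (c : R).

Lemma infr_le f c i : (forall j, c <= f j) -> infr f <= f i.
Proof. by move=> cf; apply: ge_inf; [exists c => _ [j _ <-]|exists i]. Qed.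

Lemma le_infr f c : I -> (forall j, c <= f j) -> c <= infr f.
Proof. by move=> i cf; apply: lb_le_inf; [exists (f i), i|move=> _ [j _ <-]]. Qed.

Lemma infr_lt f c : I -> infr f < c -> exists i, f i < c.
Proof. by move=> i /inf_lt[|_ [j _ <-] ?]; [exists (f i), i|exists j]. Qed.

End infr_theory.

Section hahn_banach.
Context (R : realType) (X : lmodType R).
Implicit Types (p q : X -> R).

Definition sublinear p :=
  (forall x y, p (x + y) <= p x + p y) /\
  (forall a x, 0 <= a -> p (a *: x) = a * p x).

Lemma sublinear0 p : sublinear p -> p 0 = 0.
Proof. by move=> [_ /(_ 0 0)]; rewrite scale0r mul0r; apply. Qed.

Lemma sublinear_ge p x y : sublinear p -> p x - p (- y) <= p (x + y).
Proof.
move=> [pD _]; rewrite lerBlDr; apply: le_trans (pD _ _).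
by rewrite addrK.
Qed.

(** The largest sublinear functional below [p] whose value at [- y] is at most [- p y]. A minimal
    [p] must coincide with it, which is additivity along [y]. *)
Definition lower_along p (y : X) (x : X) : R :=
  infr (fun t : {nonneg R} => p (x + t%:num *: y) - t%:num * p y).

Section lower_along.
Context p (y : X) (sp : sublinear p).

Let lower_lb x (t : {nonneg R}) :
  - p (- x) <= p (x + t%:num *: y) - t%:num * p y.
Proof.
have [pD pZ] := sp; rewrite -pZ//.
have := pD (x + t%:num *: y) (- x); rewrite addrAC subrr add0r; lra.
Qed.

Lemma lower_along_le x (t : R) : 0 <= t ->
  lower_along p y x <= p (x + t *: y) - t * p y.
Proof. by move=> t0; exact: (infr_le (NngNum t0) (lower_lb x)). Qed.

Lemma lower_along_sublinear : sublinear (lower_along p y).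
Proof.
have [pD pZ] := sp.
have scale_le a x : 0 < a -> lower_along p y (a *: x) <= a * lower_along p y x.
  move=> a0; rewrite mulrC -ler_pdivrMr//; apply: (le_infr 0%:nng) => t.
  rewrite ler_pdivrMr//; apply: (le_trans (lower_along_le _ (t := a * t%:num) _)).
    by rewrite mulr_ge0// ltW.
  by rewrite /= -scalerA -scalerDr pZ ?(ltW a0)//; lra.
split=> [u v|a x].
  rewrite -lerBlDr; apply: (le_infr 0%:nng) => t1.
  rewrite lerBlDr -lerBlDl; apply: (le_infr 0%:nng) => t2.
  rewrite lerBlDl; apply: (le_trans (lower_along_le _ (t := t1%:num + t2%:num) _)).
    exact: addr_ge0.
  rewrite scalerDl addrACA.
  by have := pD (u + t1%:num *: y) (v + t2%:num *: y); lra.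
rewrite le_eqVlt => /predU1P[<-|a0].
  rewrite scale0r mul0r; apply/eqP; rewrite eq_le; apply/andP; split.
    have := lower_along_le 0 (lexx 0).
    by rewrite scale0r addr0 mul0r subr0 (sublinear0 sp).
  apply: (le_infr 0%:nng) => t; have := lower_lb 0 t.
  by rewrite oppr0 (sublinear0 sp) oppr0.
apply/eqP; rewrite eq_le scale_le//=.
have := scale_le a^-1 (a *: x); rewrite invr_gt0 a0 => /(_ isT).
by rewrite scalerK ?gt_eqF// -ler_pdivlMl.
Qed.

Lemma lower_along_le_self x : lower_along p y x <= p x.
Proof. by have := lower_along_le x (lexx 0); rewrite scale0r addr0 mul0r subr0. Qed.

End lower_along.

(* A minimal sublinear functional is linear, which avoids partial extensions. *)
Lemma hahn_banach p x0 : sublinear p ->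
  exists f : X -> R, [/\ forall a x y, f (a *: x + y) = a * f x + f y,
    forall x, f x <= p x & f x0 = p x0].
Proof.
(* Minimizing below [lower_along p x0] instead of [p] forces [f (- x0) <= - p x0], hence equality at
   [x0]. *)
move=> sp; pose p' := lower_along p x0.
have sp' : sublinear p' by exact: lower_along_sublinear.
pose T := {q : X -> R | sublinear q /\ forall x, q x <= p' x}.
pose le (q1 q2 : T) := `[< forall x, sval q2 x <= sval q1 x >].
have [||A Atot|[q [sq qp]] qmin] := @ZL_preorder T (exist _ p' (conj sp' (fun=> lexx _))) le.
- by move=> t; exact/asboolP.
- by move=> r s t /asboolP rs /asboolP st; apply/asboolP => x; exact: le_trans (rs x).
- have [[q0 Aq0]|A0] := pselect (exists q : T, A q); last first.
    by exists (exist _ p' (conj sp' (fun=> lexx _))) => s As; case: A0; exists s.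
  pose I := {q : T | A q}; pose i0 : I := exist _ q0 Aq0.
  (* The infimum of a chain stays subadditive: of two members, the smaller serves for both
     arguments. *)
  pose m x := infr (fun i : I => sval (sval i) x).
  have lb x (i : I) : - p' (- x) <= sval (sval i) x.
    case: i => -[q [sq qp]] /= _; have := sublinear_ge 0 (- x) sq.
    by rewrite (sublinear0 sq) opprK !add0r; have := qp (- x); lra.
  have mle x (i : I) : m x <= sval (sval i) x by exact: infr_le (lb x).
  have sm : sublinear m.
    split=> [x y|a x a0].
      rewrite -lerBlDr; apply: (le_infr i0) => i1; rewrite lerBlDr -lerBlDl.
      apply: (le_infr i0) => i2; rewrite lerBlDl.
      have [|] := Atot _ _ (svalP i1) (svalP i2) => /asboolP le12.
        apply: (le_trans (mle _ i2)); have [D _] := (svalP (sval i2)).1.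
        by apply: (le_trans (D _ _)); rewrite lerD2r.
      apply: (le_trans (mle _ i1)); have [D _] := (svalP (sval i1)).1.
      by apply: (le_trans (D _ _)); rewrite lerD2l.
    move: a0; rewrite le_eqVlt => /predU1P[<-|a0].
      rewrite scale0r mul0r; apply/eqP; rewrite eq_le; apply/andP; split.
        by rewrite (le_trans (mle _ i0))// (sublinear0 (svalP (sval i0)).1).
      by apply: (le_infr i0) => i; rewrite (sublinear0 (svalP (sval i)).1).
    apply/eqP; rewrite eq_le; apply/andP; split.
      rewrite -ler_pdivrMl//; apply: (le_infr i0) => i; rewrite ler_pdivrMl//.
      by rewrite (le_trans (mle _ i))// (svalP (sval i)).1.2 ?(ltW a0).
    apply: (le_infr i0) => i; rewrite (svalP (sval i)).1.2 ?(ltW a0)// ler_pM2l//.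
  have mp x : m x <= p' x by apply: (le_trans (mle x i0)); exact: (svalP q0).2.
  exists (exist _ m (conj sm mp)) => s As; apply/asboolP => x /=.
  exact: (mle x (exist _ s As)).
have [qD qZ] := sq.
have qadd x y : q (x + y) = q x + q y.
  apply/eqP; rewrite eq_le qD/=.
  have sqy := lower_along_sublinear y sq.
  have qyp u : lower_along q y u <= p' u.
    by apply: le_trans (qp u); exact: lower_along_le_self.
  have /asboolP/(_ x)/= qx := qmin (exist _ _ (conj sqy qyp))
    (asboolT (fun u => lower_along_le_self y sq u)).
  have := lower_along_le y sq x ler01; rewrite scale1r mul1r; lra.
have q0 : q 0 = 0 by exact: sublinear0.
have qN x : q (- x) = - q x.
  by apply/eqP; rewrite -addr_eq0 -qadd addNr q0 eqxx.
have qlin a x : q (a *: x) = a * q x.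
  have [a0|/ltW a0] := leP 0 a; first exact: qZ.
  by rewrite -{1}[a]opprK scaleNr qN qZ ?oppr_ge0// mulNr opprK.
exists q; split=> [a x y|x|].
- by rewrite qadd qlin.
- by apply: le_trans (qp x) _; exact: lower_along_le_self.
apply/eqP; rewrite eq_le; apply/andP; split.
  by apply: le_trans (qp x0) _; exact: lower_along_le_self.
have := lower_along_le x0 sp (- x0) ler01; rewrite scale1r mul1r addNr (sublinear0 sp).
have := qp (- x0); rewrite qN /p'; lra.
Qed.

End hahn_banach.

Section finite_spans.
Context (R : realType) (V : lmodType R).
Implicit Types (x y : nat -> V).

Definition fspan x n : set V :=
  [set v | exists s : nat -> R, v = \sum_(j < n) s j *: x j].

Lemma fspanD x n u v : fspan x n u -> fspan x n v -> fspan x n (u + v).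
Proof.
move=> [s ->] [r ->]; exists (fun j => s j + r j); rewrite -big_split/=.
by apply: eq_bigr => j _; rewrite scalerDl.
Qed.

Lemma fspanZ x n a v : fspan x n v -> fspan x n (a *: v).
Proof.
move=> [s ->]; exists (fun j => a * s j); rewrite scaler_sumr.
by apply: eq_bigr => j _; rewrite scalerA.
Qed.

Lemma fspan0 x n : fspan x n 0.
Proof. by exists (fun=> 0); rewrite big1// => j _; rewrite scale0r. Qed.

Lemma fspan_mono x n m : (n <= m)%N -> fspan x n `<=` fspan x m.
Proof.
move=> nm _ [s ->]; exists (fun j => if (j < n)%N then s j else 0).
rewrite (big_ord_widen _ (fun j => s j *: x j) nm) big_mkcond/=.
by apply: eq_bigr => j _; case: ifP => // _; rewrite scale0r.
Qed.

Lemma fspan_gen x n j : (j < n)%N -> fspan x n (x j).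
Proof.
move=> jn; exists (fun i => (i == j)%:R).
rewrite (bigD1 (Ordinal jn))//= eqxx scale1r big1 ?addr0// => i.
by rewrite -val_eqE/= => /negbTE ->; rewrite scale0r.
Qed.

Lemma fspan_comb x n y k (s : nat -> R) : (forall j, (j < k)%N -> fspan x n (y j)) ->
  fspan x n (\sum_(j < k) s j *: y j).
Proof.
elim: k => [|k IHk] Hy; first by rewrite big_ord0; exact: fspan0.
rewrite big_ord_recr/=; apply: fspanD; last by apply: fspanZ; exact: Hy.
by apply: IHk => j jk; apply: Hy; exact: ltnW.
Qed.

End finite_spans.

Section opnorm_theory.
Context (R : realType) (X Y : normedModType R).

Lemma continuous_linear_bound (f : {linear X -> Y}) : continuous f ->
  exists2 M : R, 0 < M & forall x, `|f x| <= M * `|x|.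
Proof.
move=> /(_ 0)/(continuous_linear_bounded 0)/linear_boundedP => -[M0 [_ HM]].
exists (Num.max M0 0 + 1); last by apply: HM; rewrite ltr_pwDr// le_max lexx.
by rewrite ltr_pwDr// le_max lexx orbT.
Qed.

Lemma opnorm_bound (f : {linear X -> Y}) : continuous f ->
  forall x, `|f x| <= opnorm f * `|x|.
Proof.
move=> /continuous_linear_bound[M M0 fM] x.
have [->|x0] := eqVneq x 0; first by rewrite linear0 !normr0 mulr0.
have nx : 0 < `|x| by rewrite normr_gt0.
rewrite -ler_pdivrMr//; apply: ub_le_sup.
  exists M => _ [y /= y1 <-]; apply: (le_trans (fM y)).
  by rewrite -[leRHS]mulr1 ler_pM2l.
exists (`|x|^-1 *: x) => /=.
  by rewrite normrZ ger0_norm ?invr_ge0// mulVf// gt_eqF.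
by rewrite linearZ normrZ ger0_norm ?invr_ge0// mulrC.
Qed.

Lemma opnorm_le (f : {linear X -> Y}) (M : R) : 0 <= M ->
  (forall x, `|f x| <= M * `|x|) -> opnorm f <= M.
Proof.
move=> M0 fM; apply: ge_sup.
  by exists `|f 0|, 0 => //=; rewrite normr0.
by move=> _ [y /= y1 <-]; apply: (le_trans (fM y)); rewrite ler_piMr.
Qed.

Lemma opnorm_ge0 (f : {linear X -> Y}) : continuous f -> 0 <= opnorm f.
Proof.
move=> /continuous_linear_bound[M M0 fM]; apply: ub_le_sup.
  exists M => _ [y /= y1 <-]; apply: (le_trans (fM y)).
  by rewrite -[leRHS]mulr1 ler_pM2l.
by exists 0 => /=; rewrite ?linear0 normr0.
Qed.

End opnorm_theory.

Section separability.
Context (R : realType).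

Definition dense_seq (X : normedModType R) (d : nat -> X) :=
  forall x (e : R), 0 < e -> exists n, `|x - d n| < e.

Definition rat_comb (X : normedModType R) (x : nat -> X) (n : nat) : X :=
  let q := odflt [::] (unpickle n : option (seq rat)) in
  \sum_(i < size q) ratr (nth 0 q i) *: x i.

Lemma ratr_approx (a e : R) : 0 < e -> exists q : rat, `|a - ratr q| < e.
Proof.
move=> e0; have ae : a - e < a + e by lra.
have [q] := rat_in_itvoo ae; rewrite in_itv/= => /andP[aq qa].
by exists q; rewrite ltr_norml; lra.
Qed.

Lemma rat_comb_approx (X : normedModType R) (x : nat -> X) (c : nat -> R)
    (n : nat) (e : R) : 0 < e ->
  exists m, `|\sum_(i < n) c i *: x i - rat_comb x m| < e.
Proof.
move=> e0; pose e' i := e / (n.+1%:R * (`|x i| + 1)).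
have d0 i : 0 < n.+1%:R * (`|x i| + 1) :> R by rewrite mulr_gt0// ltr_wpDl.
have e'0 i : 0 < e' i by rewrite divr_gt0.
have /choice[q Hq] i : exists q : rat, `|c i - ratr q| < e' i by exact: ratr_approx.
exists (pickle (mkseq q n)); rewrite /rat_comb pickleK/= size_mkseq.
rewrite -sumrB; apply: (le_lt_trans (ler_norm_sum _ _ _)).
apply: (@le_lt_trans _ _ (\sum_(i < n) (e / n.+1%:R))).
  apply: ler_sum => i _; rewrite nth_mkseq// -scalerBl normrZ.
  apply: (@le_trans _ _ (e' i * (`|x i| + 1))).
    by apply: ler_pM => //; [exact: ltW|rewrite ler_wpDr].
  by rewrite /e' invfM mulrA mulfVK// gt_eqF// ltr_wpDl.
rewrite sumr_const card_ord -[_ *+ n]mulr_natr -mulrA.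
by rewrite -[ltRHS]mulr1 ltr_pM2l// mulrC ltr_pdivrMr// mul1r ltr_nat.
Qed.

(** Vectors almost norming a dense sequence of functionals span a dense subspace: a functional
    vanishing on the span is close to some [psi] of the sequence, which is then small at its own
    norming vector, so both have small norm. *)
Lemma separable_dual_dense (X : normedModType R) :
  separable_dual X -> exists d : nat -> X, dense_seq d.
Proof.
move=> [D [/countable_injP[h hinj] Dcts Ddense]].
(* The factor 2 is there because the operator norm need not be attained. *)
pose near_norming n x := forall psi, D psi -> h psi = n ->
  `|x| <= 1 /\ opnorm psi <= 2 * `|psi x|.
have /choice[x xP] n : exists x, near_norming n x.
  have [[psi [Dpsi <-]]|nD] := pselect (exists psi, D psi /\ h psi = n); last first.
    by exists 0 => psi Dpsi hpsi; case: nD; exists psi.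
  suff [x x1 xpsi] : exists2 x, `|x| <= 1 & opnorm psi <= 2 * `|psi x|.
    exists x => phi Dphi hphi.
    by have -> : phi = psi by apply: hinj; rewrite ?inE.
  have [p0|p0] := leP (opnorm psi) 0.
    by exists 0; rewrite ?normr0//; apply: (le_trans p0); rewrite mulr_ge0.
  have : has_sup [set `|psi x| | x in [set x : X | `|x| <= 1]].
    have [M M0 HM] := continuous_linear_bound (Dcts _ Dpsi); split.
      by exists `|psi 0|, 0 => //=; rewrite normr0.
    exists M => _ [y /= y1 <-]; apply: (le_trans (HM y)).
    by rewrite -[leRHS]mulr1 ler_pM2l.
  have hp0 : 0 < opnorm psi / 2 by rewrite divr_gt0.
  move=> /(sup_adherent hp0)[_ [x /= x1 <-]]; rewrite -/(opnorm psi) => xpsi.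
  by exists x => //; lra.
exists (rat_comb x).
pose S := [set s : X | exists n, fspan x n s].
have S0 : S 0 by exists 0%N; exact: fspan0.
have SD s t : S s -> S t -> S (s + t).
  move=> [n sn] [m tm]; exists (maxn n m); apply: fspanD.
    exact: fspan_mono (leq_maxl n m) _ sn.
  exact: fspan_mono (leq_maxr n m) _ tm.
have SZ a s : S s -> S (a *: s) by move=> [n sn]; exists n; exact: fspanZ.
pose s0 : {s | S s} := exist _ 0 S0.
(* The distance to the span is sublinear, and a linear functional below it vanishes on the span. *)
pose p y := infr (fun s : {s | S s} => `|y - sval s|).
have p_le y s : S s -> p y <= `|y - s|.
  by move=> Ss; exact: (infr_le (exist _ s Ss) (fun=> normr_ge0 _)).
have p_ge0 y : 0 <= p y by exact: (le_infr s0).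
have p_scale_le a y : 0 < a -> p (a *: y) <= a * p y.
  move=> a0; rewrite -ler_pdivrMl//; apply: (le_infr s0) => -[s Ss]/=.
  rewrite ler_pdivrMl//; apply: (le_trans (p_le _ _ (SZ a _ Ss))).
  by rewrite -scalerBr normrZ gtr0_norm.
have sp : sublinear p.
  split=> [y z|a y a0].
    rewrite -lerBlDr; apply: (le_infr s0) => -[s Ss]/=.
    rewrite lerBlDr -lerBlDl; apply: (le_infr s0) => -[t St]/=.
    rewrite lerBlDl; apply: (le_trans (p_le _ _ (SD _ _ Ss St))).
    by rewrite opprD addrACA; exact: ler_normD.
  move: a0; rewrite le_eqVlt => /predU1P[<-|a0].
    rewrite scale0r mul0r; apply/eqP; rewrite eq_le p_ge0 andbT.
    by apply: (le_trans (p_le _ _ S0)); rewrite subr0 normr0.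
  apply/eqP; rewrite eq_le p_scale_le//=.
  have := p_scale_le a^-1 (a *: y); rewrite invr_gt0 a0 => /(_ isT).
  by rewrite scalerK ?gt_eqF// -ler_pdivlMl.
have dist0 y : p y <= 0.
  rewrite leNgt; apply/negP => py.
  have [f [flin fp fy]] := hahn_banach y sp.
  pose F := HB.pack_for {linear X -> R^o} (f : X -> R^o)
    (GRing.isLinear.Build _ _ _ _ (f : X -> R^o) flin).
  have fnorm z : `|f z| <= `|z|.
    have fle u : f u <= `|u|.
      by apply: (le_trans (fp u)); apply: (le_trans (p_le _ _ S0)); rewrite subr0.
    rewrite ler_norml fle andbT -[- `|z|]opprK lerNl opprK.
    by rewrite -normrN -(linearN F) fle.
  have fS s : S s -> f s = 0.
    move=> Ss; have fle u : S u -> f u <= 0.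
      move=> Su; apply: (le_trans (fp u)).
      by apply: (le_trans (p_le _ _ Su)); rewrite subrr normr0.
    apply/eqP; rewrite eq_le fle//= -oppr_le0.
    by rewrite -(linearN F) fle// -scaleN1r; exact: SZ.
  have Fcts : continuous F.
    move=> z; apply: (@bounded_linear_continuous _ _ _ F).
    apply/linear_boundedP; exists 1; split => // r r1 u /=.
    by apply: (le_trans (fnorm u)); rewrite ler_peMl// ltW.
  (* Since [opnorm psi] will be at most [2 * eta], [p y = f y] will be at most [3 * eta] times the
     norm of [y]; this choice of [eta] puts that below half of [p y]. *)
  have y0 : 0 < 6 * (`|y| + 1) by rewrite mulr_gt0// ltr_wpDl.
  pose eta := p y / (6 * (`|y| + 1)).
  have eta0 : 0 < eta by rewrite divr_gt0.
  have [psi Dpsi psiF] := Ddense F Fcts eta eta0.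
  have subcts : continuous (F \- psi).
    by move=> z; apply: continuousB; [exact: Fcts|exact: Dcts].
  have bnd z : `|f z - psi z| <= eta * `|z|.
    apply: (le_trans (@opnorm_bound _ _ _ (F \- psi) subcts z)).
    by rewrite ler_wpM2r// ltW.
  have [x1 xn] := xP (h psi) psi Dpsi erefl.
  have Sx : S (x (h psi)) by exists (h psi).+1; exact: fspan_gen.
  have psix : `|psi (x (h psi))| <= eta.
    have := bnd (x (h psi)); rewrite fS// sub0r normrN => /le_trans; apply.
    by rewrite ler_piMr// ltW.
  have opsi : opnorm psi <= 2 * eta by apply: (le_trans xn); rewrite ler_pM2l.
  have psiy : `|psi y| <= 2 * eta * `|y|.
    apply: (le_trans (opnorm_bound (Dcts _ Dpsi) y)).
    by rewrite ler_wpM2r.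
  have : p y <= 3 * eta * `|y|.
    rewrite -fy; have := bnd y; move: psiy; rewrite !ler_norml; lra.
  have -> : p y = eta * (6 * (`|y| + 1)) by rewrite /eta mulfVK// gt_eqF.
  have := mulr_ge0 (ltW eta0) (normr_ge0 y); lra.
move=> y e e0; have e2 : 0 < e / 2 by rewrite divr_gt0.
have [[s [n [c sE]]]/=] := infr_lt s0 (le_lt_trans (dist0 y) e2).
move=> ys; have [m] := rat_comb_approx x c n e2; rewrite -sE => sm.
by exists m; have := ler_distD s y (rat_comb x m); lra.
Qed.

Lemma dense_range_seq (X X' : normedModType R) (iota : {linear X' -> X})
    (d : nat -> X') : dense (range iota) ->
  (forall x, `|iota x| <= `|x|) -> dense_seq d -> dense_seq (iota \o d).
Proof.
move=> iotad iotan dd x e e0; have e2 : 0 < e / 2 by rewrite divr_gt0.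
have [|z [xz [y _ yz]]] := iotad (ball x (e / 2)) _ (ball_open x _).
  by exists x; exact: ballxx.
have [n ny] := dd y _ e2; exists n => /=.
move: xz; rewrite -yz -ball_normE/= => xy.
have := iotan (y - d n); rewrite linearB => yd.
by have := ler_distD (iota y) x (iota (d n)); lra.
Qed.

End separability.

(** * Measurability of random vectors *)

Section countable_measurability.
Context d (T : measurableType d) (R : realType).

Lemma measurable_exists (I : countType) (A : I -> T -> Prop) :
  (forall i, measurable [set w | A i w]) -> measurable [set w | exists i, A i w].
Proof.
move=> mA; have -> : [set w | exists i, A i w] =
    \bigcup_(n in setT) (if unpickle n is Some i then [set w | A i w] else set0).
  apply/seteqP; split=> [w [i Aiw]|w [n _]].
    by exists (pickle i) => //=; rewrite pickleK.
  by case: unpickle => // i Aiw; exists i.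
by apply: bigcupT_measurable => n; case: unpickle.
Qed.

Lemma measurable_forall (I : countType) (A : I -> T -> Prop) :
  (forall i, measurable [set w | A i w]) -> measurable [set w | forall i, A i w].
Proof.
move=> mA; rewrite -[X in measurable X]setCK; apply: measurableC.
have -> : ~` [set w | forall i, A i w] = [set w | exists i, ~ A i w].
  by apply/seteqP; split=> w /= => [/existsNP//|[i nA] /(_ i)].
by apply: measurable_exists => i; exact: measurableC (mA i).
Qed.

Lemma measurable_impl (Q : Prop) (A : T -> Prop) :
  (Q -> measurable [set w | A w]) -> measurable [set w | Q -> A w].
Proof.
have [q|nq] := pselect Q => mA.
  have -> : [set w | Q -> A w] = [set w | A w] by apply/seteqP; split=> w /=; auto.
  exact: mA.
have -> : [set w | Q -> A w] = setT.
  by apply/seteqP; split=> w // _ /nq.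
exact: measurableT.
Qed.

Lemma measurable_le (f g : T -> R) : measurable_fun setT f ->
  measurable_fun setT g -> measurable [set w | f w <= g w].
Proof. by move=> mf mg; rewrite -[X in measurable X]setTI; exact: measurable_fun_le. Qed.

Lemma measurable_lt (f g : T -> R) : measurable_fun setT f ->
  measurable_fun setT g -> measurable [set w | f w < g w].
Proof.
move=> mf mg; have := measurableC (measurable_le mg mf).
congr measurable; apply/seteqP; split=> w /=; first by move/negP; rewrite -ltNge.
by rewrite ltNge => /negP.
Qed.

Lemma measurable_fun_ray (f : T -> R) :
  (forall r, measurable [set w | f w < r]) -> measurable_fun setT f.
Proof.
move=> mf _; apply: (measurability _ (RGenInftyO.measurableE R)) => //.
move=> _ [_ [r ->] <-]; rewrite setTI; have -> : f @^-1` `]-oo, r[%classic = [set w | f w < r].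
  by apply/seteqP; split=> w /=; rewrite in_itv.
exact: mf.
Qed.

Lemma measurable_fun_infr (I : countType) (i0 : I) (c : R) (f : I -> T -> R) :
  (forall i w, c <= f i w) -> (forall i, measurable_fun setT (f i)) ->
  measurable_fun setT (fun w => infr (f ^~ w)).
Proof.
move=> cf mf; apply: measurable_fun_ray => r.
have -> : [set w | infr (f^~ w) < r] = [set w | exists i, f i w < r].
  apply/seteqP; split=> w /= => [/(infr_lt i0)//|[i]].
  by apply: le_lt_trans; exact: (infr_le i (cf^~ w)).
by apply: measurable_exists => i; apply: measurable_lt.
Qed.

End countable_measurability.

(* In a separable space this amounts to Borel measurability. *)
Definition norm_measurable (R : realType) d (T : measurableType d)
    (X : normedModType R) (f : T -> X) : Prop :=
  forall z, measurable_fun setT (fun w => `|f w - z|).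

Section norm_measurable.
Context (R : realType) d (T : measurableType d).

Lemma norm_measurableP (X : normedModType R) (f : T -> X) :
  (forall z r, measurable [set w | `|f w - z| < r]) -> norm_measurable f.
Proof. by move=> mf z; apply: measurable_fun_ray. Qed.

Lemma norm_measurable_norm (X : normedModType R) (f : T -> X) :
  norm_measurable f -> measurable_fun setT (fun w => `|f w|).
Proof. by move=> /(_ 0); under eq_fun do rewrite subr0. Qed.

Lemma norm_measurable_borel (X : normedModType R) (f : T -> X) :
  borel_measurable f -> norm_measurable f.
Proof.
move=> mf; apply: norm_measurableP => z r.
have -> : [set w | `|f w - z| < r] = f @^-1` ball z r.
  by apply/seteqP; split=> w; rewrite /= -ball_normE /= distrC.
have := mf measurableT (ball z r); rewrite setTI; apply.
by apply: sub_sigma_algebra; exact: ball_open.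
Qed.

Lemma norm_measurable_cst (X : normedModType R) (x : X) :
  norm_measurable (fun _ : T => x).
Proof. by move=> z; exact: measurable_cst. Qed.

Lemma norm_measurable_comp (X : normedModType R) (f : T -> X) (sigma : T -> T) :
  measurable_fun setT sigma -> norm_measurable f -> norm_measurable (f \o sigma).
Proof. by move=> ms mf z; exact: (measurableT_comp (mf z) ms). Qed.

Lemma norm_measurableZ (X : normedModType R) (a : R) (f : T -> X) :
  norm_measurable f -> norm_measurable (fun w => a *: f w).
Proof.
move=> mf z; have [->|a0] := eqVneq a 0.
  by under eq_fun do rewrite scale0r; exact: measurable_cst.
have E w : `|a *: f w - z| = `|a| * `|f w - a^-1 *: z|.
  by rewrite -normrZ scalerBr scalerA divff// scale1r.
under eq_fun do rewrite E.
by apply: measurable_funM; [exact: measurable_cst|exact: mf].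
Qed.

Section separable.
Context (X : normedModType R) (dX : nat -> X) (dX_dense : dense_seq dX).

(** Separability makes a ball condition on the sum a countable union, over the possible approximate
    values [dX n] of [f], of conditions on [f] and [g] separately. *)
Lemma norm_measurableD (f g : T -> X) :
  norm_measurable f -> norm_measurable g -> norm_measurable (fun w => f w + g w).
Proof.
move=> mf mg; apply: norm_measurableP => z r.
have -> : [set w | `|f w + g w - z| < r] =
    [set w | exists n, `|f w - dX n| + `|g w - (z - dX n)| < r].
  apply/seteqP; split=> w /= => [fgr|[n]].
    have e0 : 0 < (r - `|f w + g w - z|) / 2 by rewrite divr_gt0// subr_gt0.
    have [n fn] := dX_dense (f w) e0; exists n.
    have := ler_normD (f w + g w - z) (dX n - f w).
    have -> : f w + g w - z + (dX n - f w) = g w - (z - dX n).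
      by rewrite opprB [LHS](AC (3*2)%AC ((1*5)*(2*(4*3)))%AC)/= subrr add0r.
    by rewrite (distrC (dX n)) => h; lra.
  apply: le_lt_trans; apply: le_trans (ler_normD _ _).
  by rewrite opprB [X in _ <= `|X|](AC (2*(1*2))%AC ((1*3*5)*(4*2))%AC)/= subrr addr0.
apply: measurable_exists => n; apply: measurable_lt => //.
by apply: measurable_funD; [exact: mf|exact: mg].
Qed.

Lemma norm_measurable_comb (I : Type) (s : seq I) (c : I -> R) (e : I -> T -> X) :
  (forall i, norm_measurable (e i)) ->
  norm_measurable (fun w => \sum_(i <- s) c i *: e i w).
Proof.
move=> me; elim: s => [|i s IHs].
  by under eq_fun do rewrite big_nil; exact: norm_measurable_cst.
under eq_fun do rewrite big_cons.
by apply: norm_measurableD => //; exact: norm_measurableZ.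
Qed.

Context (Y : normedModType R) (A : T -> {linear X -> Y}).
Hypotheses (A_cts : forall w, continuous (A w))
  (mA : forall x, norm_measurable (fun w => A w x)).

(** The bound is tested in homogeneous form because the dense sequence is not confined to the unit
    ball. *)
Lemma opnorm_le_dense w (M : R) : 0 <= M ->
  (opnorm (A w) <= M) <-> forall n, `|A w (dX n)| <= M * `|dX n|.
Proof.
move=> M0; split=> [AM n|AM].
  by apply: (le_trans (opnorm_bound (@A_cts w) _)); rewrite ler_wpM2r.
apply: opnorm_le => // x; apply/ler_addgt0Pr => e e0.
pose K := opnorm (A w) + M + 1.
have K0 : 0 < K by rewrite ltr_wpDl// addr_ge0// opnorm_ge0.
have [n xn] := dX_dense x (divr_gt0 e0 K0).
have := opnorm_bound (@A_cts w) (x - dX n); rewrite linearB => h1.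
have h2 := ler_distD (dX n) 0 x; rewrite !sub0r !normrN in h2.
have := ler_distD (A w (dX n)) (A w x) 0; rewrite !subr0 => h3.
have h4 := AM n.
have h5 : K * `|x - dX n| <= e by rewrite -ler_pdivlMl// mulrC ltW.
have h6 : `|dX n| <= `|x| + `|x - dX n|.
  by have := ler_distD x 0 (dX n); rewrite !sub0r !normrN.
have h7 : M * `|dX n| <= M * (`|x| + `|x - dX n|) by rewrite ler_wpM2l.
have h8 := normr_ge0 (x - dX n).
move: h5; rewrite /K; lra.
Qed.

Lemma measurable_opnorm : measurable_fun setT (fun w => opnorm (A w)).
Proof.
rewrite (_ : (fun w => _) = (fun w => - (- opnorm (A w)))); last first.
  by apply/funext => w; rewrite opprK.
apply: measurableT_comp => //; apply: measurable_fun_ray => r.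
have -> : [set w | - opnorm (A w) < r] =
    ~` [set w | 0 <= - r /\ forall n, `|A w (dX n)| <= - r * `|dX n|].
  apply/seteqP; split=> w /=.
    by move=> h [r0 /opnorm_le_dense-/(_ r0)]; lra.
  move=> h; rewrite ltNge; apply/negP => rA; apply: h.
  have r0 : 0 <= - r by have := opnorm_ge0 (@A_cts w); lra.
  by split=> //; apply/opnorm_le_dense => //; lra.
apply: measurableC; have [r0|r0] := leP 0 (- r); last first.
  by rewrite (_ : [set w | _] = set0)// -subset0 => w [].
rewrite (_ : [set w | _] = [set w | forall n, `|A w (dX n)| <= - r * `|dX n|]); last first.
  by apply/seteqP; split=> w //= [].
apply: measurable_forall => n; apply: measurable_le => //.
exact/norm_measurable_norm.
Qed.

(** Strong measurability concerns fixed vectors only. Replacing [f w] by a nearby [dX n] costs at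
    most [opnorm (A w)] times their distance, and there are countably many [n]. *)
Lemma norm_measurable_app (f : T -> X) :
  norm_measurable f -> norm_measurable (fun w => A w (f w)).
Proof.
move=> mf; apply: norm_measurableP => z r.
have -> : [set w | `|A w (f w) - z| < r] = [set w | exists n,
    opnorm (A w) * `|f w - dX n| + `|A w (dX n) - z| < r].
  apply/seteqP; split=> w /= => [fgr|[n]].
    (* The error occurs twice: in the condition itself and in passing from [A w (f w)] to
       [A w (dX n)]. *)
    have K0 : 0 < 2 * opnorm (A w) + 1 by rewrite ltr_wpDl// mulr_ge0// opnorm_ge0.
    have e0 : 0 < (r - `|A w (f w) - z|) by rewrite subr_gt0.
    have [n fn] := dX_dense (f w) (divr_gt0 e0 K0); exists n.
    have := ler_distD (A w (f w)) (A w (dX n)) z.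
    have := opnorm_bound (@A_cts w) (f w - dX n); rewrite linearB => h1 h2; rewrite distrC in h1.
    move: fn; rewrite ltr_pdivlMr// => h3.
    have h4 := normr_ge0 (f w - dX n); lra.
  apply: le_lt_trans; apply: le_trans (ler_distD (A w (dX n)) _ _) _.
  by rewrite lerD2r -linearB opnorm_bound.
apply: measurable_exists => n; apply: measurable_lt => //.
apply: measurable_funD; last exact: mA.
by apply: measurable_funM; [exact: measurable_opnorm|exact: mf].
Qed.

End separable.

End norm_measurable.

Lemma iterS_measurable d (T : measurableType d) (sigma : T -> T) n :
  measurable_fun setT sigma -> measurable_fun setT (iter n sigma).
Proof.
move=> ms; elim: n => [|n IHn]; first exact: measurable_id.
exact: (measurableT_comp ms IHn).
Qed.

Lemma norm_measurable_cocycle (R : realType) d (T : measurableType d)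
    (X : normedModType R) (dX : nat -> X) (sigma : T -> T)
    (L : T -> {linear X -> X}) (f : T -> X) n :
  dense_seq dX -> measurable_fun setT sigma -> (forall w, continuous (L w)) ->
  (forall x, borel_measurable (fun w => L w x)) -> norm_measurable f ->
  norm_measurable (fun w => cocycle sigma L n w (f w)).
Proof.
move=> dd ms Lcts mL mf; elim: n => [//|n IHn] /=.
apply: (norm_measurable_app dd (A := fun w => L (iter n sigma w))) => // x.
apply: (@norm_measurable_comp _ _ _ _ (fun w => L w x) (iter n sigma)).
  exact: iterS_measurable.
exact/norm_measurable_borel.
Qed.

(** * The maximal ergodic inequality *)

Section measure_preserving_theory.
Context (R : realType) d (T : measurableType d) (P : probability T R)
  (sigma : T -> T) (mp : measure_preserving P sigma).

Let ms : measurable_fun setT sigma := mp.1.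

Lemma iter_preserving n A : measurable A ->
  measurable (iter n sigma @^-1` A) /\ P (iter n sigma @^-1` A) = P A.
Proof.
elim: n A => [//|n IHn] A mA.
have mA' : measurable (sigma @^-1` A) by rewrite -[X in measurable X]setTI; exact: ms.
have [mn Pn] := IHn _ mA'; split=> //.
by rewrite -(mp.2 _ mA) -Pn.
Qed.

Lemma integral_preserving (f : T -> \bar R) : measurable_fun setT f ->
  (forall x, 0 <= f x)%E -> (\int[P]_x f (sigma x) = \int[P]_x f x)%E.
Proof.
move=> mf f0; have := ge0_integral_pushforward ms P measurableT mf (fun x _ => f0 x).
rewrite preimage_setT => <-.
by apply: eq_measure_integral => //= A mA _; exact: mp.2.
Qed.

Lemma integral_small (g : T -> R) (A : nat -> set T) (e : R) :
  measurable_fun setT g -> (forall w, 0 <= g w) ->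
  (\int[P]_w (g w)%:E < +oo)%E -> (forall n, measurable (A n)) ->
  (forall n, A n.+1 `<=` A n) -> P (\bigcap_n A n) = 0 -> 0 < e ->
  exists n, (\int[P]_w (g w * \1_(A n) w)%:E < e%:E)%E.
Proof.
move=> mg g0 ig mA decA PA e0.
have mgA n : measurable_fun setT (fun w => (g w * \1_(A n) w)%:E).
  apply/measurable_EFinP; apply: measurable_funM; first exact: mg.
  exact: (measurable_indic (mA n)).
have gA0 n w : 0 <= g w * \1_(A n) w by rewrite mulr_ge0// indicE.
have mI : measurable (\bigcap_n A n) by exact: bigcapT_measurable.
have [||||_ _] := @dominated_convergence _ _ _ P setT measurableT
    (fun n w => (g w * \1_(A n) w)%:E) (cst 0%E) (fun w => (g w)%:E) mgA.
- exact: measurable_cst.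
- exists (\bigcap_n A n); split=> //= w nw n _.
  apply: contrapT => nAw; apply: nw => _.
  have outA k : ~ A (n + k)%N w.
    by elim: k => [|k IHk]; rewrite ?addn0// addnS => /decA.
  apply: cvg_near_cst; near=> k.
  have /subnKC <- : (n <= k)%N by near: k; exact: nbhs_infty_ge.
  by rewrite indicE memNset ?mulr0//; exact: outA.
- apply/integrableP; split; first exact/measurable_EFinP.
  by under eq_integral do rewrite gee0_abs ?lee_fin//.
- apply: aeW => w n _; rewrite gee0_abs ?lee_fin// indicE.
  by case: (_ \in _); rewrite ?mulr1// mulr0.
rewrite integral0 => cv0.
have lt_e : nbhs (0%E : \bar R) [set y | (y < e%:E)%E].
  by apply: open_nbhs_nbhs; split; [exact: open_ereal_lt_ereal|rewrite /= lte_fin].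
have [n _ /(_ n (leqnn n))] := cv0 _ lt_e.
by exists n.
Unshelve. all: by end_near.
Qed.

(** The maximum over [k <= n] of the Birkhoff sums of [G - eta] of length [k], in the recursive form
    suited to Garsia's argument. *)
Fixpoint excess (G : T -> R) (eta : R) n w : R :=
  if n is m.+1 then Num.max 0 (G w - eta + excess G eta m (sigma w)) else 0.

Section maximal.
Context (G : T -> R) (eta : R) (mG : measurable_fun setT G)
  (G0 : forall w, 0 <= G w) (eta0 : 0 < eta)
  (iG : (\int[P]_w (G w)%:E < +oo)%E).

Let M := excess G eta.

Let M0 n w : 0 <= M n w.
Proof. by case: n => //= n; rewrite le_max lexx. Qed.

Let mM n : measurable_fun setT (M n).
Proof.
elim: n => [|n IHn]; first exact: measurable_cst.
apply: measurable_maxr; first exact: measurable_cst.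
apply: measurable_funD; first by apply: measurable_funB => //; exact: measurable_cst.
exact: (measurableT_comp IHn ms).
Qed.

Let Mincr n w : M n w <= M n.+1 w.
Proof.
elim: n w => [|n IHn] w; first exact: M0.
by rewrite /M /= ge_max !le_max lexx/= lerD2l IHn orbT.
Qed.

Let Msum n k w : (n <= k)%N -> \sum_(j < n) G (iter j sigma w) - eta * n%:R <= M k w.
Proof.
elim: n k w => [|n IHn] [//|k] w nk; rewrite ?big_ord0 ?mulr0 ?subr0//.
rewrite big_ord_recl/= /M/= le_max; apply/orP; right.
have := IHn k (sigma w) nk.
rewrite [X in _ -> _ + X - _ <= _](eq_bigr (fun j : 'I_n => G (iter j sigma (sigma w)))); last first.
  by move=> j _; rewrite -iterSr.
by rewrite -natr1 mulrDr mulr1; rewrite /M; lra.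
Qed.

Let E n := [set w | 0 < M n w].

Let mE n : measurable (E n).
Proof. by apply: measurable_lt => //; exact: measurable_cst. Qed.

Let step n w : M n.+1 w + eta * \1_(E n.+1) w <= G w + M n (sigma w).
Proof.
rewrite indicE; have [/set_mem|nE] := boolP (w \in E n.+1).
  rewrite /E /M /= lt_max ltxx/= => h; rewrite mulr1.
  by rewrite (max_idPr (ltW h)) addrAC subrK.
have : M n.+1 w <= 0 by rewrite leNgt; apply/negP => h; move/negP: nE; apply; exact: mem_set.
rewrite mulr0 addr0; move/le_trans; apply; exact: addr_ge0.
Qed.

Let mEF (f : T -> R) : measurable_fun setT f -> measurable_fun setT (EFin \o f).
Proof. by move=> mf; exact/measurable_EFinP. Qed.

Let intstep n : (\int[P]_w (M n.+1 w)%:E + eta%:E * P (E n.+1) <=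
  \int[P]_w (G w)%:E + \int[P]_w (M n w)%:E)%E.
Proof.
have mI : measurable_fun setT (fun w => eta * \1_(E n.+1) w).
  by apply: measurable_funM; [exact: measurable_cst|exact: (measurable_indic (mE _))].
have I0 w : 0 <= eta * \1_(E n.+1) w :> R by rewrite mulr_ge0 ?indicE// ltW.
have <- : (\int[P]_w (eta * \1_(E n.+1) w)%:E = eta%:E * P (E n.+1))%E.
  under eq_integral do rewrite EFinM.
  rewrite ge0_integralZl//; last by rewrite lee_fin ltW.
    by rewrite integral_indic// setIT.
  by apply/measurable_EFinP; exact: (measurable_indic (mE _)).
have Mpos k w : setT w -> (0 <= (M k w)%:E)%E by rewrite lee_fin.
rewrite -[X in (_ <= _ + X)%E](@integral_preserving (EFin \o M n));
     [|exact: (mEF (mM n))|by move=> w; exact: Mpos].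
have e1 := ge0_integralD P measurableT (Mpos n.+1) (mEF (mM n.+1))
  (f2 := fun w => (eta * \1_(E n.+1) w)%:E) (fun w _ => I0 w) (mEF mI).
have Gpos w : setT w -> (0 <= (G w)%:E)%E by rewrite lee_fin.
have e2 := ge0_integralD P measurableT Gpos (mEF mG)
  (f2 := fun w => (M n (sigma w))%:E) (fun w h => Mpos n (sigma w) h)
  (mEF (measurableT_comp (mM n) ms)).
rewrite -e1 -e2; apply: ge0_le_integral => //.
- by move=> w _; rewrite -EFinD lee_fin addr_ge0.
- by apply: (mEF (f := fun w => M n.+1 w + eta * \1_(E n.+1) w)); exact: measurable_funD.
- apply: (mEF (f := fun w => G w + M n (sigma w))).
  by apply: measurable_funD => //; exact: (measurableT_comp (mM n) ms).
- by move=> w _; rewrite -!EFinD lee_fin.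
Qed.

Let Mfin n : (\int[P]_w (M n w)%:E)%E \is a fin_num.
Proof.
rewrite ge0_fin_numE; last by apply: integral_ge0 => w _; rewrite lee_fin.
elim: n => [|n IHn]; first by rewrite integral0_eq.
apply: le_lt_trans (lte_add_pinfty iG IHn); apply: le_trans (intstep n).
by apply: leeDl; rewrite mule_ge0// lee_fin ltW.
Qed.

Let PE n : (eta%:E * P (E n) <= \int[P]_w (G w)%:E)%E.
Proof.
case: n => [|n].
  rewrite (_ : E 0 = set0) ?measure0 ?mule0; first by apply: integral_ge0 => w _; rewrite lee_fin.
  by rewrite -subset0 => w; rewrite /E /M /= ltxx.
rewrite -(leeD2lE _ _ (Mfin n.+1)); apply: (le_trans (intstep n)).
rewrite addeC leeD2r//; apply: ge0_le_integral => //.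
- by move=> w _; rewrite lee_fin.
- exact: mEF.
- exact: mEF.
- by move=> w _; rewrite lee_fin.
Qed.

(** Integrating [step] and cancelling the finite integral of [M] bounds each [P (E n)], and [B] lies
    in the union of these sets. The use is outside [B], where the Birkhoff sums are at most
    [eta * n] at every time, with no exceptional initial segment. *)
Lemma maximal_ergodic :
  let B := [set w | exists n, eta * n%:R < \sum_(j < n) G (iter j sigma w)] in
  measurable B /\ (eta%:E * P B <= \int[P]_w (G w)%:E)%E.
Proof.
set B := [set w | _] => /=.
have mB : measurable B.
  apply: (measurable_exists (I := nat)) => n; apply: measurable_lt.
    exact: measurable_cst.
  apply: measurable_sum => j.
  exact: (measurableT_comp mG (iterS_measurable _ ms)).
split=> //.
have mU : measurable (\bigcup_n E n) by exact: bigcupT_measurable.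
have BE : B `<=` \bigcup_n E n.
  move=> w [n h]; exists n => //; rewrite /E /=.
  by have := Msum w (leqnn n); lra.
have cE : P (E n) @[n --> \oo] --> P (\bigcup_n E n).
  apply: nondecreasing_cvg_mu => //.
  apply/nondecreasing_seqP => n; apply/subsetPset => w; rewrite /E /=.
  by move=> h; apply: lt_le_trans (Mincr n w).
apply: (@le_trans _ _ (eta%:E * P (\bigcup_n E n))%E).
  by rewrite lee_pmul2l// le_measure ?inE.
have fe : eta%:E \is a fin_num by [].
have cP := @cvgeZl _ _ _ _ _ _ fe cE.
rewrite -(cvg_lim (@ereal_hausdorff R) cP).
apply: lime_le; first by apply/cvg_ex; eexists; exact: cP.
by apply: nearW => n; exact: PE.
Qed.

End maximal.
End measure_preserving_theory.

(** * Volumes of flags *)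

Section exponential_rates.
Context (R : realType).
Implicit Types (a b c : R) (l : nat).

Definition exp_rate a l : R := expR (a * l%:R).

Lemma exp_rate_gt0 a l : 0 < exp_rate a l. Proof. exact: expR_gt0. Qed.
Lemma exp_rate_ge0 a l : 0 <= exp_rate a l. Proof. exact/ltW/exp_rate_gt0. Qed.
Lemma exp_rateD a b l : exp_rate (a + b) l = exp_rate a l * exp_rate b l.
Proof. by rewrite /exp_rate mulrDl expRD. Qed.
Lemma exp_rateN a l : exp_rate (- a) l = (exp_rate a l)^-1.
Proof. by rewrite /exp_rate mulNr expRN. Qed.
Lemma exp_rateS a l : exp_rate a l.+1 = expR a * exp_rate a l.
Proof. by rewrite /exp_rate -natr1 mulrDr mulr1 expRD mulrC. Qed.
Lemma exp_rate0 a : exp_rate a 0 = 1. Proof. by rewrite /exp_rate mulr0 expR0. Qed.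
Lemma exp_rate0l l : exp_rate 0 l = 1. Proof. by rewrite /exp_rate mul0r expR0. Qed.
Lemma ler_exp_rate a b l : a <= b -> exp_rate a l <= exp_rate b l.
Proof. by move=> ab; rewrite /exp_rate ler_expR ler_wpM2r. Qed.
Lemma exp_rate_exp a m l : exp_rate a l ^+ m = exp_rate (a *+ m) l.
Proof. by elim: m => [|m IHm]; rewrite ?expr0 ?mulr0n ?exp_rate0l// exprS IHm -exp_rateD mulrS. Qed.
Lemma exp_rate_pow a l : exp_rate a l = expR a ^+ l.
Proof. by rewrite /exp_rate expRM_natr. Qed.

Lemma geometric_limit (u : nat -> R) C r : 0 <= r < 1 -> 0 <= C ->
  (forall l, `|u l.+1 - u l| <= C * r ^+ l) ->
  exists v, forall l, `|v - u l| <= C / (1 - r) * r ^+ l.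
Proof.
move=> /andP[r0 r1] C0 Hu; pose e l := C / (1 - r) * r ^+ l.
have eS l : e l - e l.+1 = C * r ^+ l.
  rewrite /e exprS; have : 1 - r != 0 by rewrite subr_eq0 gt_eqF.
  by move: (r ^+ l) => x h; field.
have e0 l : 0 <= e l by rewrite mulr_ge0 ?exprn_ge0// divr_ge0// subr_ge0 ltW.
have lo l k : u l - e l <= u (l + k)%N - e (l + k)%N.
  elim: k => [|k IHk]; rewrite ?addn0// addnS; apply: (le_trans IHk).
  by have := Hu (l + k)%N; rewrite -eS ler_norml; lra.
have hi l k : u (l + k)%N + e (l + k)%N <= u l + e l.
  elim: k => [|k IHk]; rewrite ?addn0// addnS; apply: le_trans IHk.
  by have := Hu (l + k)%N; rewrite -eS ler_norml; lra.
have lohi l k : u l - e l <= u k + e k.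
  apply: (le_trans (lo l k)); apply: le_trans (hi k l).
  by rewrite addnC; have := e0 (k + l)%N; lra.
pose A := range (fun l => u l - e l).
exists (sup A) => l; rewrite ler_distl; apply/andP; split.
  by apply: ub_le_sup; [exists (u 0%N + e 0%N) => _ [k _ <-]|exists l].
by apply: ge_sup; [exists (u 0%N - e 0%N), 0%N|move=> _ [k _ <-]].
Qed.

Lemma uniform_constant (m : nat) (Q : nat -> R -> Prop) :
  (forall i c c', Q i c -> c <= c' -> Q i c') ->
  (forall i, (i < m)%N -> exists c, Q i c) ->
  exists c, 1 <= c /\ forall i, (i < m)%N -> Q i c.
Proof.
move=> Qmon; elim: m => [|m IHm] HQ; first by exists 1.
have [i im|c [c1 Hc]] := IHm; first by apply: HQ; exact: ltnW.
have [c' Hc'] := HQ m (ltnSn m); exists (Num.max c c'); split.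
  by rewrite le_max c1.
move=> i; rewrite ltnS leq_eqVlt => /predU1P[->|im].
  by apply: Qmon Hc' _; rewrite le_max lexx orbT.
by apply: Qmon (Hc i im) _; rewrite le_max lexx.
Qed.

End exponential_rates.

Section flags.
Context (R : realType) (V : lmodType R).
Implicit Types (p : V -> R) (x : nat -> V).

Definition seminorm p :=
  (forall u v : V, p (u + v) <= p u + p v) /\ (forall a (u : V), p (a *: u) = `|a| * p u).

(** Distances to the span of the preceding vectors replace determinants: they make sense for any
    seminorm, without a Euclidean structure. *)
Definition fdist p x i := infr (fun s : nat -> R => p (x i - \sum_(j < i) s j *: x j)).

(* The volume of the flag spanned by the first [m] vectors. *)
Definition fvol p x m := \prod_(i < m) fdist p x i.

Lemma seminorm0 p : seminorm p -> p 0 = 0.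
Proof. by move=> [_ pZ]; rewrite -(scale0r 0) pZ normr0 mul0r. Qed.

Lemma seminormN p (u : V) : seminorm p -> p (- u) = p u.
Proof. by move=> [_ pZ]; rewrite -scaleN1r pZ normrN normr1 mul1r. Qed.

Lemma seminorm_ge0 p (u : V) : seminorm p -> 0 <= p u.
Proof.
move=> sp; have := sp.1 u (- u).
by rewrite subrr seminorm0// seminormN//; lra.
Qed.

Lemma seminormB p (u v : V) : seminorm p -> p (u - v) <= p u + p v.
Proof. by move=> sp; rewrite -(seminormN v sp); exact: sp.1. Qed.

Lemma seminorm_lower p (u v : V) : seminorm p -> p u - p v <= p (u + v).
Proof.
move=> sp; rewrite lerBlDr; have := seminormB (u + v) v sp.
by rewrite addrK.
Qed.

Lemma seminorm_sum p n (s : nat -> R) x : seminorm p ->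
  p (\sum_(j < n) s j *: x j) <= \sum_(j < n) `|s j| * p (x j).
Proof.
move=> sp; elim: n => [|n IHn]; first by rewrite !big_ord0 seminorm0.
rewrite !big_ord_recr/=; apply: (le_trans (sp.1 _ _)).
by rewrite sp.2 lerD2r.
Qed.

Section basic.
Context p (sp : seminorm p).

Lemma fdist_le x i (s : nat -> R) : fdist p x i <= p (x i - \sum_(j < i) s j *: x j).
Proof.
pose f (r : nat -> R) := p (x i - \sum_(j < i) r j *: x j).
by apply: (@infr_le _ _ f 0 s) => r; exact: seminorm_ge0.
Qed.

Lemma fdist_ge0 x i : 0 <= fdist p x i.
Proof. by apply: le_infr => [|s]; [exact: (fun=> 0)|exact: seminorm_ge0]. Qed.

Lemma fdist_le_self x i : fdist p x i <= p (x i).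
Proof.
have := fdist_le x i (fun=> 0); rewrite big1 ?subr0// => j _.
by rewrite scale0r.
Qed.

Lemma fdist_lt x i c : fdist p x i < c ->
  exists s : nat -> R, p (x i - \sum_(j < i) s j *: x j) < c.
Proof. by move=> h; exact: (infr_lt (fun=> 0) h). Qed.

Lemma fvol_ge0 x m : 0 <= fvol p x m.
Proof. by apply: prodr_ge0 => i _; exact: fdist_ge0. Qed.

Lemma fvolS x m : fvol p x m.+1 = fvol p x m * fdist p x m.
Proof. by rewrite /fvol big_ord_recr. Qed.

End basic.

Lemma fdist_scale p p' C x i : seminorm p -> seminorm p' -> 0 <= C ->
  (forall y, p y <= C * p' y) -> fdist p x i <= C * fdist p' x i.
Proof.
move=> sp sp'; rewrite le_eqVlt => /predU1P[<- pC|C0 pC].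
  by rewrite mul0r; have := fdist_le_self sp x i; have := pC (x i); rewrite mul0r; lra.
rewrite -ler_pdivrMl//; apply: le_infr => [|s]; first exact: (fun=> 0).
by rewrite ler_pdivrMl//; apply: le_trans (pC _); exact: fdist_le.
Qed.

Lemma fvol_scale p p' C x m : seminorm p -> seminorm p' -> 0 <= C ->
  (forall y, p y <= C * p' y) -> fvol p x m <= C ^+ m * fvol p' x m.
Proof.
move=> sp sp' C0 pC; elim: m => [|m IHm]; first by rewrite /fvol !big_ord0 expr0 mulr1.
rewrite !fvolS exprSr mulrACA; apply: ler_pM => //.
- exact: fvol_ge0.
- exact: fdist_ge0.
- exact: fdist_scale.
Qed.

Lemma eq_fdist p x y i : (forall j, (j <= i)%N -> x j = y j) -> fdist p x i = fdist p y i.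
Proof.
move=> xy; congr infr; apply/funext => s; rewrite xy//; congr (p (_ - _)).
by apply: eq_bigr => j _; rewrite xy// ltnW.
Qed.

Lemma eq_fvol p x y m : (forall j, (j < m)%N -> x j = y j) -> fvol p x m = fvol p y m.
Proof.
move=> xy; apply: eq_bigr => i _; apply: eq_fdist => j ji; apply: xy.
exact: leq_ltn_trans ji _.
Qed.

End flags.

Lemma fdist_map (R : realType) (V W : lmodType R) (f : {linear V -> W}) (p : V -> R)
    (q : W -> R) x i :
  (forall y, q (f y) = p y) -> fdist q (f \o x) i = fdist p x i.
Proof.
move=> qf; congr infr; apply/funext => s /=; rewrite -qf linearB (linear_sum f).
by congr (q (_ - _)); apply: eq_bigr => j _; rewrite linearZ.
Qed.

Lemma fvol_map (R : realType) (V W : lmodType R) (f : {linear V -> W}) (p : V -> R)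
    (q : W -> R) x m :
  (forall y, q (f y) = p y) -> fvol q (f \o x) m = fvol p x m.
Proof. by move=> qf; apply: eq_bigr => i _; exact: fdist_map. Qed.

(** * A slow vector over a fast flag *)

Section slow_vector.
Context (R : realType) (V : lmodType R) (p : nat -> V -> R) (x : nat -> V)
  (m : nat) (lambda theta : R).
Hypotheses (sp : forall l, seminorm (p l)) (theta0 : 0 <= theta)
  (upper : forall y, exists C, forall l, p l y <= C * exp_rate (lambda + theta) l)
  (fast : exists2 c, 0 < c & forall l, c * exp_rate (lambda *+ m - theta) l <= fvol (p l) x m).

Let upper_flag : exists C, 1 <= C /\ forall i, (i < m)%N ->
  forall l, p l (x i) <= C * exp_rate (lambda + theta) l.
Proof.
apply: (uniform_constant (Q := fun i C => forall l, p l (x i) <= C * exp_rate (lambda + theta) l)).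
  by move=> i c c' Hc cc' l; apply: (le_trans (Hc l)); rewrite ler_wpM2r// exp_rate_ge0.
by move=> i _; exact: upper.
Qed.

(** The other [m - 1] distances have rate at most [lambda + theta], and [m * lambda - theta - (m -
    1) * (lambda + theta) = lambda - m * theta]. *)
Lemma fdist_lower i : (i < m)%N ->
  exists2 c, 0 < c & forall l, c * exp_rate (lambda - theta *+ m) l <= fdist (p l) x i.
Proof.
move=> im; have [c c0 Hc] := fast; have [C [C1 HC]] := upper_flag.
have C0 : 0 < C by apply: lt_le_trans C1.
exists (c * C / C ^+ m) => [|l]; first by rewrite divr_gt0 ?mulr_gt0// exprn_gt0.
pose M := C * exp_rate (lambda + theta) l.
have M0 : 0 < M by rewrite mulr_gt0// exp_rate_gt0.
have prodle : fvol (p l) x m * M <= fdist (p l) x i * M ^+ m.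
  rewrite /fvol (bigD1 (Ordinal im))//= -mulrA; apply: ler_wpM2l; first exact: fdist_ge0.
  have -> : M ^+ m = M * \prod_(j < m | j != Ordinal im) M.
    by rewrite -[m in LHS]card_ord -prodr_const (bigD1 (Ordinal im)).
  rewrite mulrC ler_pM2l//; apply: ler_prod => j _; rewrite fdist_ge0//=.
  by apply: le_trans (HC j (ltn_ord j) l); exact: fdist_le_self.
have {prodle} := le_trans (ler_wpM2r (ltW M0) (Hc l)) prodle.
rewrite /M exprMn exp_rate_exp mulrACA -exp_rateD -ler_pdivrMr; last by rewrite mulr_gt0 ?exprn_gt0 ?exp_rate_gt0.
rewrite invfM -exp_rateN mulrACA -exp_rateD; congr (_ * exp_rate _ l <= _).
by rewrite mulrnDl; ring.
Qed.

(** The last coefficient is bounded through [fdist_lower], the others by induction after removing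
    the last vector. Each removal costs a rate [(m + 1) * theta]: [m * theta] from the distance,
    [theta] from the length of the vector. *)
Lemma flag_conorm i : (i <= m)%N -> exists2 C, 0 <= C & forall l (s : nat -> R),
  \sum_(j < i) `|s j| <=
  C * exp_rate (- (lambda - theta *+ (i * m.+1))) l * p l (\sum_(j < i) s j *: x j).
Proof.
elim: i => [|i IHi] im.
  exists 1 => // l s; rewrite !big_ord0 mul1r mulr_ge0//; first exact: exp_rate_ge0.
  exact: seminorm_ge0.
have [C C0 HC] := IHi (ltnW im); have [c c0 Hc] := fdist_lower im.
have [C' [C'1 HC']] := upper_flag.
have C'0 : 0 <= C' by apply: le_trans C'1.
exists (C * (1 + C' / c) + c^-1) => [|l s].
  by rewrite !(addr_ge0, mulr_ge0)// ?divr_ge0 ?invr_ge0 // ltW.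
rewrite !big_ord_recr/=; set z := \sum_(j < i) s j *: x j.
set P := p l (z + s i *: x i).
have P0 : 0 <= P by exact: seminorm_ge0.
have si : `|s i| <= c^-1 * exp_rate (- (lambda - theta *+ m)) l * P.
  rewrite exp_rateN -invfM ler_pdivlMl ?mulr_gt0 ?exp_rate_gt0//.
  have [->|s0] := eqVneq (s i) 0; first by rewrite normr0 mulr0.
  rewrite mulrC; apply: (@le_trans _ _ (`|s i| * fdist (p l) x i)).
    by rewrite ler_wpM2l.
  rewrite /P; have -> : z + s i *: x i = s i *: (x i - \sum_(j < i) (- (s j / s i)) *: x j).
    rewrite scalerBr addrC scaler_sumr -sumrN; congr (_ + _).
    apply: eq_bigr => j _; rewrite scalerA -scaleNr; congr (_ *: _).
    by rewrite mulrN opprK mulrC divfK.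
  by rewrite (sp l).2; apply: ler_wpM2l => //; exact: (fdist_le (sp l) x i (fun j => - (s j / s i))).
have zP : p l z <= P + `|s i| * (C' * exp_rate (lambda + theta) l).
  have := seminorm_lower z (s i *: x i) (sp l); rewrite -/P (sp l).2 => h.
  have : `|s i| * p l (x i) <= `|s i| * (C' * exp_rate (lambda + theta) l).
    by rewrite ler_wpM2l// HC'.
  lra.
set a := - (lambda - theta *+ (i * m.+1)); set b := - (lambda - theta *+ (i.+1 * m.+1)).
have th k n : (k <= n)%N -> theta *+ k <= theta *+ n by exact: ler_wpMn2l.
have ab : exp_rate a l <= exp_rate b l.
  by apply: ler_exp_rate; rewrite lerN2 lerD2l lerN2 th// leq_mul2r leqnSn orbT.
have mb : exp_rate (- (lambda - theta *+ m)) l <= exp_rate b l.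
  apply: ler_exp_rate; rewrite lerN2 lerD2l lerN2 th// mulSn.
  by apply: leq_trans (leqnSn m) _; exact: leq_addr.
have aab : exp_rate a l * exp_rate (- (lambda - theta *+ m)) l * exp_rate (lambda + theta) l = exp_rate b l.
  rewrite -!exp_rateD; congr (exp_rate _ l); rewrite /a /b mulSn mulrnDr mulrS; lra.
have h1 := HC l s; rewrite -/z -/a in h1.
have h2 : C * exp_rate a l * p l z <= C * exp_rate a l * (P + `|s i| * (C' * exp_rate (lambda + theta) l)).
  by rewrite ler_wpM2l// mulr_ge0// exp_rate_ge0.
have h3 : C * exp_rate a l * (`|s i| * (C' * exp_rate (lambda + theta) l)) <=
    C * (C' / c) * exp_rate b l * P.
  rewrite -aab.
  have -> : C * (C' / c) * (exp_rate a l * exp_rate (- (lambda - theta *+ m)) l * exp_rate (lambda + theta) l) * P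
    = C * exp_rate a l * ((c^-1 * exp_rate (- (lambda - theta *+ m)) l * P) * (C' * exp_rate (lambda + theta) l)).
    by ring.
  rewrite ler_wpM2l// ?mulr_ge0// ?exp_rate_ge0// ler_wpM2r// mulr_ge0// exp_rate_ge0//.
have h4 : C * exp_rate a l * P <= C * exp_rate b l * P by rewrite ler_wpM2r// ler_wpM2l.
have h5 : c^-1 * exp_rate (- (lambda - theta *+ m)) l * P <= c^-1 * exp_rate b l * P.
  by rewrite ler_wpM2r// ler_wpM2l// invr_ge0 ltW.
have -> : (C * (1 + C' / c) + c^-1) * exp_rate b l * P =
  C * exp_rate b l * P + C * (C' / c) * exp_rate b l * P + c^-1 * exp_rate b l * P by ring.
move: h2; rewrite mulrDr; lra.
Qed.

Lemma slow_vector (beta B : R) : 0 <= B ->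
  (forall l y, p l.+1 y <= B * exp_rate theta l * p l y) ->
  (exists C, forall l, fvol (p l) x m.+1 <= C * exp_rate (lambda *+ m.+1 - beta) l) ->
  theta *+ (m * m.+1 + 2) < beta ->
  exists (s : nat -> R) C, forall l, p l (x m - \sum_(j < m) s j *: x j) <=
    C * exp_rate (lambda - beta + theta *+ (m * m.+1 + 3)) l.
Proof.
move=> B0 step [C0 HC0] thb.
have [c c0 Hc] := fast; have [C' [C'1 HC']] := upper_flag.
have C'0 : 0 <= C' by apply: le_trans C'1.
have [K K0 HK] := flag_conorm (leqnn m).
pose C1 := Num.max C0 0 / c + 1.
have C10 : 0 < C1 by rewrite ltr_wpDl// divr_ge0 ?(ltW c0)// le_max lexx orbT.
(* The distance is a quotient of volumes, of rate at most [(lambda * (m + 1) - beta) - (lambda * m -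
   theta)]. The [+ 1] in [C1] gives the strict inequality needed to leave the infimum. *)
have near l : exists s : nat -> R, p l (x m - \sum_(j < m) s j *: x j) <=
    C1 * exp_rate (lambda - beta + theta) l.
  have [|s hs] := @fdist_lt _ _ (p l) x m (C1 * exp_rate (lambda - beta + theta) l); last first.
    by exists s; exact: ltW.
  apply: (@le_lt_trans _ _ (Num.max C0 0 / c * exp_rate (lambda - beta + theta) l)); last first.
    by rewrite ltr_pM2r ?exp_rate_gt0// ltrDl.
  have v0 : 0 < fvol (p l) x m by apply: lt_le_trans (Hc l); rewrite mulr_gt0// exp_rate_gt0.
  rewrite -(ler_pM2l v0) -fvolS; apply: (le_trans (HC0 l)).
  apply: (@le_trans _ _ (c * exp_rate (lambda *+ m - theta) l *
      (Num.max C0 0 / c * exp_rate (lambda - beta + theta) l))); last first.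
    rewrite ler_wpM2r// ?Hc// mulr_ge0 ?exp_rate_ge0// divr_ge0 ?(ltW c0)//.
    by rewrite le_max lexx orbT.
  rewrite [leRHS](_ : _ = Num.max C0 0 * exp_rate (lambda *+ m.+1 - beta) l).
    by rewrite ler_wpM2r ?exp_rate_ge0// le_max lexx.
  have -> : lambda *+ m.+1 - beta = (lambda *+ m - theta) + (lambda - beta + theta).
    by rewrite mulrS; ring.
  by rewrite [in RHS]exp_rateD; field; rewrite gt_eqF.
have /choice[s Hs] := near.
set kappa := theta *+ (m * m.+1).
(* The rate [kappa - lambda] of [flag_conorm] plus the rate [lambda - beta + 2 * theta] of the short
   vectors; the lower bound on [beta] makes [r < 1]. *)
set r := expR (- (beta - kappa - theta *+ 2)).
have kap2 : theta *+ (m * m.+1 + 2) = kappa + theta *+ 2 by rewrite mulrnDr.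
have kap3 : theta *+ (m * m.+1 + 3) = kappa + theta *+ 3 by rewrite mulrnDr.
have r01 : 0 <= r < 1.
  rewrite /r ltW ?expR_gt0//= expR_lt1 oppr_lt0; move: thb; rewrite kap2; lra.
have r1 : 0 < 1 - r by rewrite subr_gt0; case/andP: r01.
pose C2 := C1 * expR (lambda - beta + theta) + B * C1.
have C20 : 0 <= C2 by rewrite addr_ge0// mulr_ge0 ?expR_ge0// ltW.
have diff l : \sum_(j < m) `|s l.+1 j - s l j| <= K * expR `|lambda - kappa| * C2 * r ^+ l.
  have := HK l.+1 (fun j => s l j - s l.+1 j).
  rewrite -/kappa; under eq_bigr do rewrite distrC.
  move=> /le_trans; apply.
  rewrite -!mulrA ler_wpM2l// exp_rateS -mulrA.
  have -> : \sum_(j < m) (s l j - s l.+1 j) *: x j =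
     (x m - \sum_(j < m) s l.+1 j *: x j) - (x m - \sum_(j < m) s l j *: x j).
    rewrite opprB [RHS](AC (2*2)%AC ((1*4)*(3*2))%AC)/= subrr add0r -sumrB.
    by apply: eq_bigr => j _; rewrite scalerBl.
  apply: ler_pM; rewrite ?expR_ge0//.
  - by rewrite mulr_ge0 ?exp_rate_ge0//; exact: seminorm_ge0.
  - by rewrite ler_expR; apply: le_trans (ler_norm _) _; rewrite normrN.
  apply: (@le_trans _ _ (exp_rate (- (lambda - kappa)) l * (C2 * exp_rate (lambda - beta + theta *+ 2) l))).
    rewrite ler_wpM2l ?exp_rate_ge0//; apply: (le_trans (seminormB _ _ (sp _))).
    rewrite /C2 mulrDl; apply: lerD.
      apply: (le_trans (Hs l.+1)); rewrite exp_rateS mulrA ler_wpM2l//.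
        by rewrite mulr_ge0 ?expR_ge0// ltW.
      by apply: ler_exp_rate; rewrite lerD2l mulr2n lerDl.
    apply: (le_trans (step _ _)).
    have -> : lambda - beta + theta *+ 2 = theta + (lambda - beta + theta) by rewrite mulr2n; lra.
    rewrite exp_rateD; apply: (@le_trans _ _ (B * exp_rate theta l * (C1 * exp_rate (lambda - beta + theta) l))).
      by rewrite ler_wpM2l// mulr_ge0// exp_rate_ge0.
    by rewrite le_eqVlt; apply/orP; left; apply/eqP; ring.
  rewrite mulrCA -exp_rateD /r -exp_rate_pow.
  by rewrite le_eqVlt; apply/orP; left; apply/eqP; congr (_ * exp_rate _ l); ring.
have diff1 j l : (j < m)%N -> `|s l.+1 j - s l j| <= K * expR `|lambda - kappa| * C2 * r ^+ l.
  move=> jm; apply: le_trans (diff l).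
  by rewrite (bigD1 (Ordinal jm))//= lerDl sumr_ge0.
pose C3 := K * expR `|lambda - kappa| * C2.
have C30 : 0 <= C3 by rewrite !mulr_ge0 ?expR_ge0.
have /choice[v Hv] j : exists v, (j < m)%N -> forall l, `|v - s l j| <= C3 / (1 - r) * r ^+ l.
  have [jm|_] := boolP (j < m)%N; last by exists 0.
  by have [v Hv] := geometric_limit r01 C30 (diff1 j ^~ jm); exists v.
exists v, (C1 + (C3 / (1 - r) * C') *+ m) => l.
have -> : x m - \sum_(j < m) v j *: x j =
    (x m - \sum_(j < m) s l j *: x j) - \sum_(j < m) (v j - s l j) *: x j.
  rewrite -addrA -opprD -big_split/=; congr (_ - _).
  by apply: eq_bigr => j _; rewrite scalerBl addrC subrK.
apply: (le_trans (seminormB _ _ (sp l))); rewrite mulrDl; apply: lerD.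
  apply: (le_trans (Hs l)); rewrite ler_wpM2l ?(ltW C10)//; apply: ler_exp_rate.
  rewrite lerD2l -[theta in leLHS]mulr1n; apply: ler_wpMn2l => //.
  by rewrite addn3.
apply: (le_trans (seminorm_sum m (fun j => v j - s l j) x (sp l))).
have sumC (z : R) : z *+ m = \sum_(j < m) z by rewrite sumr_const card_ord.
rewrite mulrnAl sumC; apply: ler_sum => j _.
apply: (@le_trans _ _ (C3 / (1 - r) * r ^+ l * (C' * exp_rate (lambda + theta) l))).
  by apply: ler_pM => //; [exact: seminorm_ge0|exact: Hv|exact: HC'].
have -> : lambda - beta + theta *+ (m * m.+1 + 3) =
    - (beta - kappa - theta *+ 2) + (lambda + theta).
  by rewrite kap3; rewrite mulrS; ring.
rewrite [X in _ <= _ * X]exp_rateD (exp_rate_pow (- (beta - kappa - theta *+ 2))) -/r.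
by rewrite le_eqVlt; apply/orP; left; apply/eqP; ring.
Qed.

End slow_vector.

(** * Flags of row vectors: compactness, semicontinuity, perturbation *)

Section row_vectors.
Context (R : realType).

Lemma rV_coord_le k (t : 'rV[R]_k) i : `|t 0 i| <= `|t|.
Proof.
rewrite [leRHS]/Num.norm /= mx_normrE; apply/bigmax_geP; right => /=.
by exists (ord0, i).
Qed.

Lemma rV_norm_le k (t : 'rV[R]_k) M : 0 <= M -> (forall i, `|t 0 i| <= M) -> `|t| <= M.
Proof.
move=> M0 tM; rewrite [leLHS]/Num.norm /= mx_normrE; apply/bigmax_leP; split => //.
by move=> -[i j] _ /=; rewrite ord1.
Qed.

Lemma bolzano_weierstrass k (u : nat -> 'rV[R]_k) M : (forall n, `|u n| <= M) ->
  exists t, forall e N, 0 < e -> exists2 n, (N <= n)%N & `|u n - t| < e.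
Proof.
move=> uM; pose A := [set t : 'rV[R]_k | `|t| <= M].
have cA : compact A.
  apply: bounded_closed_compact.
    exists M; split; first exact: num_real.
    by move=> r Mr t /= tM; apply: le_trans tM (ltW Mr).
  rewrite (_ : A = (fun t : 'rV[R]_k => `|t|) @^-1` [set r | r <= M]) //.
  by apply: closed_comp; [move=> t _; exact: norm_continuous|exact: closed_le].
have [|t [_ clt]] := cA (u @ \oo) _; first by exists 0%N => //= n _; exact: uM.
exists t => e N e0.
have [|_ [[n Nn <-] tn]] := clt (u @` [set n | (N <= n)%N]) (ball t e) _ (nbhsx_ballx _ _ e0).
  by exists N => // n /= Nn; exists n.
by exists n => //; move: tn; rewrite -ball_normE /= distrC.
Qed.

Lemma seminorm_rV_bound k (q : 'rV[R]_k -> R) : seminorm q ->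
  exists2 C, 0 < C & forall t, q t <= C * `|t|.
Proof.
move=> sq; exists (1 + \sum_i q (delta_mx 0 i)) => [|t].
  by rewrite ltr_pwDl// sumr_ge0// => i _; exact: seminorm_ge0.
have qsum (s : seq 'I_k) : q (\sum_(i <- s) t 0 i *: delta_mx 0 i) <=
    \sum_(i <- s) `|t 0 i| * q (delta_mx 0 i).
  elim: s => [|i s IHs]; first by rewrite !big_nil seminorm0.
  rewrite !big_cons; apply: (le_trans (sq.1 _ _)).
  by rewrite sq.2 lerD2l.
rewrite [in leLHS](row_sum_delta t); apply: (le_trans (qsum _)).
rewrite mulrDl mul1r mulr_suml; apply: ler_wpDl => //.
apply: ler_sum => i _; rewrite mulrC ler_wpM2l ?rV_coord_le//.
exact: seminorm_ge0.
Qed.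

(** Otherwise unit vectors with [q] tending to 0 would accumulate at a nonzero zero of [q]. *)
Lemma norm_rV_lower k (q : 'rV[R]_k -> R) : seminorm q -> (forall t, q t = 0 -> t = 0) ->
  exists2 c, 0 < c & forall t, c * `|t| <= q t.
Proof.
move=> sq q0; apply: contrapT => nc.
have /choice[u Hu] n : exists t : 'rV[R]_k, `|t| = 1 /\ q t < n.+1%:R^-1.
  apply: contrapT => nt; apply: nc; exists n.+1%:R^-1 => [|t]; first by rewrite invr_gt0.
  have [->|t0] := eqVneq t 0; first by rewrite normr0 mulr0 seminorm0.
  have nt0 : 0 < `|t| by rewrite normr_gt0.
  rewrite -ler_pdivlMr// leNgt; apply/negP => qt; apply: nt.
  exists (`|t|^-1 *: t); split.
    by rewrite normrZ ger0_norm ?invr_ge0// mulVf// gt_eqF.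
  by rewrite sq.2 ger0_norm ?invr_ge0// mulrC.
have [|t Ht] := @bolzano_weierstrass _ u 1; first by move=> n; rewrite (Hu n).1.
have [C C0 HC] := seminorm_rV_bound sq.
have qt : q t = 0.
  apply/eqP; rewrite eq_le seminorm_ge0// andbT; apply/ler_addgt0Pr => e e0.
  have e2 : 0 < e / 2 by rewrite divr_gt0.
  have [N Ne] : exists N, N.+1%:R^-1 < e / 2 :> R.
    exists (Num.truncn (e / 2)^-1); rewrite -[ltRHS]invrK ltf_pV2 ?posrE ?invr_gt0//.
    by rewrite truncnS_gt.
  have [n Nn un] := Ht (e / 2 / C) N (divr_gt0 e2 C0).
  have h1 := HC (u n - t); have h2 := (Hu n).2.
  have h3 := sq.1 (u n) (- (u n - t)); rewrite subKr seminormN// in h3.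
  have h4 : C * `|u n - t| <= e / 2 by rewrite -ler_pdivlMl// mulrC ltW.
  have h5 : n.+1%:R^-1 <= N.+1%:R^-1 :> R by rewrite lef_pV2 ?posrE// ler_nat.
  have h6 : q (u n) < e / 2 by exact: lt_trans (lt_le_trans h2 h5) Ne.
  by apply: (le_trans h3); lra.
have [n _] := Ht 1 0%N ltr01.
by rewrite (q0 _ qt) subr0 (Hu n).1 ltxx.
Qed.

(** One choice of coefficients, almost optimal for [x], serves for all nearby [y]. Continuity fails,
    since the span of the preceding vectors may collapse in the limit. *)
Lemma fdist_usc k (q : 'rV[R]_k -> R) x i e : seminorm q -> 0 < e ->
  exists2 d, 0 < d & forall y, (forall j, (j <= i)%N -> `|y j - x j| < d) ->
    fdist q y i <= fdist q x i + e.
Proof.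
move=> sq e0; have [C C0 HC] := seminorm_rV_bound sq.
have e2 : 0 < e / 2 by rewrite divr_gt0.
have [|s Hs] := @fdist_lt _ _ q x i (fdist q x i + e / 2); first by rewrite ltrDl.
pose S := 1 + \sum_(j < i) `|s j|.
have S0 : 0 < S by rewrite ltr_pwDl// sumr_ge0.
exists (e / 2 / (C * S)) => [|y Hy]; first by rewrite divr_gt0// mulr_gt0.
set d := e / 2 / (C * S).
apply: (le_trans (fdist_le sq y i s)).
have -> : y i - \sum_(j < i) s j *: y j = (x i - \sum_(j < i) s j *: x j) +
    ((y i - x i) - \sum_(j < i) s j *: (y j - x j)).
  have -> : \sum_(j < i) s j *: (y j - x j) =
      \sum_(j < i) s j *: y j - \sum_(j < i) s j *: x j.
    by rewrite -sumrB; apply: eq_bigr => j _; rewrite scalerBr.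
  by rewrite opprB [RHS](AC (2*(2*2))%AC ((3*6)*((1*4)*(2*5)))%AC)/= subrr add0r addNr addr0.
apply: (le_trans (sq.1 _ _)).
have : q ((y i - x i) - \sum_(j < i) s j *: (y j - x j)) <= e / 2; last by lra.
apply: (le_trans (seminormB _ _ sq)).
have small j : (j <= i)%N -> q (y j - x j) <= C * d.
  by move=> ji; apply: (le_trans (HC _)); rewrite ler_wpM2l// ltW// Hy.
apply: (@le_trans _ _ (C * d * S)); last first.
  by rewrite /d mulrAC mulrC divfK// gt_eqF// mulr_gt0.
rewrite /S mulrDr mulr1 lerD ?small//.
apply: (le_trans (seminorm_sum i s (fun j => y j - x j) sq)).
rewrite mulr_sumr; apply: ler_sum => j _; rewrite mulrC ler_wpM2r// small//.
exact: ltnW.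
Qed.

Lemma fvol_usc k (q : 'rV[R]_k -> R) x m e : seminorm q -> 0 < e ->
  exists2 d, 0 < d & forall y, (forall j, (j < m)%N -> `|y j - x j| < d) ->
    fvol q y m <= fvol q x m + e.
Proof.
move=> sq; elim: m e => [|m IHm] e e0.
  by exists 1 => // y _; rewrite /fvol !big_ord0; lra.
have F0 := fvol_ge0 sq x m; have D0 := fdist_ge0 sq x m.
(* In the product of [fvol + e1] and [fdist + e2], the terms with [fvol * e2] and with [e1] each
   contribute at most [e / 2]. *)
have e20 : 0 < e / (2 * (fvol q x m + 1)) by rewrite divr_gt0// mulr_gt0// ltr_wpDl.
set e2 := e / _ in e20.
have e10 : 0 < e / (2 * (fdist q x m + e2 + 1)).
  by rewrite divr_gt0// mulr_gt0// ltr_wpDl// addr_ge0// ltW.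
set e1 := e / _ in e10.
have [d1 d10 H1] := IHm _ e10; have [d2 d20 H2] := fdist_usc x m sq e20.
exists (Num.min d1 d2) => [|y Hy]; first by rewrite lt_min d10.
rewrite !fvolS.
have h1 : fvol q y m <= fvol q x m + e1.
  apply: H1 => j jm; apply: (lt_le_trans (Hy j _)); first exact: ltnW.
  by rewrite ge_min lexx.
have h2 : fdist q y m <= fdist q x m + e2.
  by apply: H2 => j jm; apply: (lt_le_trans (Hy j _)); rewrite // ge_min lexx orbT.
apply: (@le_trans _ _ ((fvol q x m + e1) * (fdist q x m + e2))).
  by apply: ler_pM => //; [exact: fvol_ge0|exact: fdist_ge0].
have E2 : e2 * (2 * (fvol q x m + 1)) = e by rewrite divfK// gt_eqF// mulr_gt0// ltr_wpDl.
have E1 : e1 * (2 * (fdist q x m + e2 + 1)) = e.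
  by rewrite divfK// gt_eqF// mulr_gt0// ltr_wpDl// addr_ge0// ltW.
lra.
Qed.

Lemma fvol_gt0 (V : lmodType R) (q : V -> R) x m i : seminorm q -> 0 < fvol q x m ->
  (i < m)%N -> 0 < fdist q x i.
Proof.
move=> sq + im; rewrite /fvol (bigD1 (Ordinal im))//= => h.
rewrite lt_neqAle fdist_ge0// andbT; apply/negP => /eqP h0.
by move: h; rewrite -h0 mul0r ltxx.
Qed.

Lemma fvol_free (V : lmodType R) (q : V -> R) x m (s : nat -> R) : seminorm q ->
  0 < fvol q x m -> \sum_(j < m) s j *: x j = 0 -> forall j, (j < m)%N -> s j = 0.
Proof.
move=> sq v0 s0 j jm.
(* With a constant seminorm and both rates 0, [flag_conorm] bounds the coefficients by the seminorm
   of the combination. *)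
have [|||C C0 HC] := @flag_conorm R V (fun=> q) x m 0 0 (fun=> sq) _ _ _ m (leqnn m) => //.
- by move=> y; exists (q y) => l; rewrite addr0 exp_rate0l mulr1.
- by exists (fvol q x m) => // l; rewrite mul0rn subrr exp_rate0l mulr1.
have := HC 0%N s; rewrite s0 seminorm0// mulr0 => h.
apply/eqP; rewrite -normr_eq0 eq_le normr_ge0 andbT; apply: le_trans h.
by rewrite (bigD1 (Ordinal jm))//= lerDl sumr_ge0.
Qed.

Lemma fvol_row_free k (q : 'rV[R]_k -> R) x m : seminorm q -> 0 < fvol q x m ->
  row_free (\matrix_(i < m) x i).
Proof.
move=> sq v0; apply: inj_row_free => v; rewrite mulmx_sum_row => vX.
apply/rowP => i; rewrite mxE.
pose s j := if insub j is Some i' then v 0 i' else 0.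
have sE (j : 'I_m) : s j = v 0 j by rewrite /s valK.
rewrite -sE; apply: (fvol_free sq v0) => //; apply: etrans vX.
by apply: eq_bigr => j _; rewrite sE rowK.
Qed.

(* A free family moved slightly is its image under a linear map close to the
   identity, so all its flag volumes change by factors close to 1. *)
Lemma free_perturb k (q : 'rV[R]_k -> R) x m e : seminorm q -> 0 < fvol q x m ->
  0 < e -> exists2 d, 0 < d & forall y, (forall j, (j < m)%N -> `|y j - x j| < d) ->
  exists M : 'M[R]_k, (forall j, (j < m)%N -> y j = x j *m M) /\
    forall t : 'rV[R]_k, `|t *m M - t| <= e * `|t|.
Proof.
move=> sq v0 e0; pose X := \matrix_(i < m) x i.
have /row_freeP[B XB] := fvol_row_free sq v0.
rewrite -/X in XB.
have sB : seminorm (fun t : 'rV[R]_k => `|t *m B|).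
  by split=> [u v|a u]; rewrite ?mulmxDl ?ler_normD// -scalemxAl normrZ.
have [C C0 HC] := seminorm_rV_bound sB.
exists (e / (C * m.+1%:R)) => [|y Hy]; first by rewrite divr_gt0// mulr_gt0.
set d := e / _ in Hy; have d0 : 0 <= d by rewrite divr_ge0 ?mulr_ge0 ?(ltW C0) ?(ltW e0).
pose D := \matrix_(i < m) (y i - x i).
(* [B] is a right inverse of [X], so [X] times this matrix is [X + D], whose rows are the [y i]. *)
exists (1%:M + B *m D); split=> [j jm|t].
  have XM : X *m (1%:M + B *m D) = \matrix_(i < m) y i.
    rewrite mulmxDr mulmx1 mulmxA XB mul1mx; apply/matrixP => i c.
    by rewrite !mxE addrCA subrr addr0.
  have := congr1 (row (Ordinal jm)) XM.
  by rewrite row_mul !rowK.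
rewrite mulmxDr mulmx1 addrAC subrr add0r mulmxA mulmx_sum_row.
apply: (le_trans (ler_norm_sum _ _ _)).
apply: (@le_trans _ _ (\sum_(i < m) C * `|t| * d)).
  apply: ler_sum => i _; rewrite normrZ rowK ler_pM// ?(ltW (Hy _ _))//.
  exact: le_trans (rV_coord_le _ _) (HC t).
rewrite sumr_const card_ord -mulr_natr.
have -> : C * `|t| * d * m%:R = `|t| * (C * m%:R * d) by ring.
rewrite mulrC ler_wpM2r//.
apply: (@le_trans _ _ (C * m.+1%:R * d)).
  by rewrite ler_wpM2r// ler_wpM2l ?(ltW C0)// ler_nat.
by rewrite mulrC divfK// gt_eqF// mulr_gt0.
Qed.

(** Positive volume at time 0 makes the family free, so [free_perturb] gives one linear map for all
    times; its tolerance is divided by the constants comparing the finitely many norms [q l] with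
    the sup norm. *)
Lemma fvol_near k (q : nat -> 'rV[R]_k -> R) x m N e : (forall l, seminorm (q l)) ->
  (forall l t, q l t = 0 -> t = 0) -> 0 < fvol (q 0%N) x m -> 0 < e < 1 ->
  exists2 d, 0 < d & forall y, (forall j, (j < m)%N -> `|y j - x j| < d) ->
    forall l, (l <= N)%N -> (1 - e) ^+ m * fvol (q l) x m <= fvol (q l) y m /\
      fvol (q l) y m <= (1 + e) ^+ m * fvol (q l) x m.
Proof.
move=> sq q0 v0 /andP[e0 e1].
have lower l := norm_rV_lower (sq l) (@q0 l).
have upper l := seminorm_rV_bound (sq l).
have [K [K1 HK]] : exists K, 1 <= K /\ forall l, (l < N.+1)%N ->
    forall t, `|t| <= K * q l t.
  apply: (uniform_constant (Q := fun l K => forall t, `|t| <= K * q l t)).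
    move=> l c c' Hc cc' t; apply: (le_trans (Hc t)); rewrite ler_wpM2r//.
    exact: seminorm_ge0.
  by move=> l _; have [c c0 Hc] := lower l; exists c^-1 => t; rewrite ler_pdivlMl.
have [K' [K'1 HK']] : exists K, 1 <= K /\ forall l, (l < N.+1)%N ->
    forall t, q l t <= K * `|t|.
  apply: (uniform_constant (Q := fun l K => forall t, q l t <= K * `|t|)).
    by move=> l c c' Hc cc' t; apply: (le_trans (Hc t)); rewrite ler_wpM2r.
  by move=> l _; have [c c0 Hc] := upper l; exists c.
have K0 : 0 < K by apply: lt_le_trans K1.
have K'0 : 0 < K' by apply: lt_le_trans K'1.
have [d d0 Hd] := free_perturb (sq 0%N) v0 (divr_gt0 e0 (mulr_gt0 K'0 K0)).
exists d => // y Hy l lN; have [M [yM Mt]] := Hd y Hy.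
have close t : q l (t *m M - t) <= e * q l t.
  apply: (le_trans (HK' l lN _)); apply: (le_trans (ler_wpM2l (ltW K'0) (Mt t))).
  rewrite mulrA; apply: (le_trans (ler_wpM2l _ (HK l lN t))).
    by rewrite mulr_ge0 ?divr_ge0 ?mulr_ge0 ?(ltW K0) ?(ltW K'0) ?(ltW e0).
  by rewrite le_eqVlt; apply/orP; left; apply/eqP; field; rewrite !gt_eqF.
have sqM : seminorm (fun t => q l (t *m M)).
  by split=> [u v|a u]; rewrite ?mulmxDl ?(sq l).1// -scalemxAl (sq l).2.
have -> : fvol (q l) y m = fvol (fun t => q l (t *m M)) x m.
  rewrite (@eq_fvol _ _ _ y (fun j => x j *m M))//.
  exact: (fvol_map (f := mulmxr M)).
split.
  have e1' : 0 < 1 - e by rewrite subr_gt0.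
  rewrite mulrC -ler_pdivlMr ?exprn_gt0// mulrC -exprVn.
  apply: fvol_scale => //; first by rewrite invr_ge0 ltW.
  move=> t; rewrite ler_pdivlMl//.
  have := seminorm_lower (t *m M) (- (t *m M - t)) (sq l); rewrite subKr (seminormN _ (sq l)).
  have := close t; have := seminorm_lower t (t *m M - t) (sq l); rewrite subrKC; lra.
apply: fvol_scale => //; first by rewrite addr_ge0// ltW.
move=> t; have := close t; have := (sq l).1 t (t *m M - t); rewrite subrKC; lra.
Qed.

End row_vectors.

Section flag_normalization.
Context (R : realType) (V : lmodType R).
Implicit Types (q : V -> R) (x y : nat -> V).

Lemma fdist_le_span q x i v : seminorm q -> fspan x i v -> fdist q x i <= q (x i - v).
Proof. by move=> sq [s ->]; exact: fdist_le. Qed.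

(** An approximate Gram-Schmidt process: dividing by the distances [D i] divides out the initial
    volume. The factor 2 allows for distances that are not attained. *)
Lemma flag_normalize q0 x m : seminorm q0 -> 0 < fvol q0 x m -> exists y,
  (forall i, (i < m)%N -> q0 (y i) <= 2) /\
  forall q, seminorm q -> fvol q x m <= fvol q0 x m * fvol q y m.
Proof.
move=> sq0 v0; pose D i := fdist q0 x i.
have D0 i : (i < m)%N -> 0 < D i by exact: fvol_gt0.
have /choice[S HS] i : exists s : nat -> R, (i < m)%N ->
    q0 (x i - \sum_(j < i) s j *: x j) < 2 * D i.
  have [im|_] := boolP (i < m)%N; last by exists (fun=> 0).
  have [|s hs] := @fdist_lt _ _ q0 x i (2 * D i); last by exists s.
  by rewrite ltr_pMl ?D0// ltr1n.
pose y i := (D i)^-1 *: (x i - \sum_(j < i) S i j *: x j).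
exists y; split=> [i im|q sq].
  rewrite sq0.2 ger0_norm ?invr_ge0 ?(ltW (D0 i im))// ler_pdivrMl ?D0// mulrC ltW//.
  exact: HS.
have yspan i : fspan x i.+1 (y i).
  apply: fspanZ; apply: fspanD; first by apply: fspan_gen.
  rewrite -scaleN1r; apply: fspanZ; apply: (fspan_mono (leqnSn i)).
  by exists (S i).
have key i : (i < m)%N -> fdist q x i <= D i * fdist q y i.
  move=> im; rewrite -ler_pdivrMl ?D0//; apply: le_infr => [|r]; first exact: (fun=> 0).
  have Dn : D i = `|D i| by rewrite ger0_norm ?(ltW (D0 i im)).
  rewrite ler_pdivrMl ?D0// Dn -sq.2.
  rewrite scalerBr {1}/y scalerA divff ?gt_eqF ?D0// scale1r -addrA -opprD.
  apply: fdist_le_span => //; apply: fspanD; first by exists (S i).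
  apply: fspanZ; apply: fspan_comb => j ji.
  by apply: (fspan_mono ji); exact: yspan.
rewrite /fvol -big_split/=; apply: ler_prod => i _.
by rewrite fdist_ge0//= key.
Qed.

End flag_normalization.

(** Only ratios of volumes are controlled, so the flags are first normalized. They then lie in a
    compact set, and lower bounds on volumes pass to the limit by upper semicontinuity. *)
Lemma fast_flag_limit (R : realType) k (q : nat -> 'rV[R]_k -> R) m (s : R) :
  (forall l, seminorm (q l)) -> (forall t, q 0%N t = 0 -> t = 0) ->
  (forall N, exists x, 0 < fvol (q 0%N) x m /\
    forall l, (l <= N)%N -> exp_rate s l * fvol (q 0%N) x m <= fvol (q l) x m) ->
  exists x, forall l, exp_rate s l <= fvol (q l) x m.
Proof.
move=> sq q0 fast; have [c c0 Hc] := norm_rV_lower (sq 0%N) q0.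
have /choice[y Hy] N : exists y : nat -> 'rV[R]_k,
    (forall i, (i < m)%N -> q 0%N (y i) <= 2) /\
    forall l, (l <= N)%N -> exp_rate s l <= fvol (q l) y m.
  have [x [v0 Hx]] := fast N; have [y [y2 Hy]] := flag_normalize (sq 0%N) v0.
  exists y; split=> // l lN; rewrite -(ler_pM2r v0) [leRHS]mulrC.
  by apply: le_trans (Hy _ (sq l)); exact: Hx.
(* The [m] vectors are concatenated so that a single extraction serves for all of them. *)
pose u N := mxvec (\matrix_(i < m) y N i).
have uM N : `|u N| <= 2 / c.
  apply: rV_norm_le => [|ij]; first by rewrite divr_ge0// ltW.
  case/mxvec_indexP: ij => i j; rewrite mxvecE mxE.
  apply: (le_trans (rV_coord_le _ _)); rewrite ler_pdivlMr// mulrC.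
  by apply: (le_trans (Hc _)); exact: (Hy N).1.
have [t Ht] := bolzano_weierstrass uM.
pose x i := if insub i is Some i' then row (i' : 'I_m) (vec_mx t) else 0.
have xE (i : 'I_m) : x i = row i (vec_mx t) by rewrite /x valK.
exists x => l; rewrite leNgt; apply/negP => vl.
have e0 : 0 < (exp_rate s l - fvol (q l) x m) / 2 by rewrite divr_gt0// subr_gt0.
have [d d0 Hd] := fvol_usc x m (sq l) e0.
have [N lN uN] := Ht d l d0.
have := Hd (y N); have := (Hy N).2 l lN => h /(_ _)-h2.
have {}h2 := h2 _; suff : fvol (q l) (y N) m <= fvol (q l) x m +
  (exp_rate s l - fvol (q l) x m) / 2 by lra.
apply: h2 => i im; apply: le_lt_trans uN.
rewrite (xE (Ordinal im)); apply: rV_norm_le => // j.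
have -> : (y N i - row (Ordinal im) (vec_mx t)) 0 j =
    (u N - t) 0 (mxvec_index (Ordinal im) j).
  by rewrite !mxE mxvecE mxE.
exact: rV_coord_le.
Qed.

Section flag_measurability.
Context (R : realType) d (T : measurableType d).

Definition rat_seq (s : seq rat) (j : nat) : R := ratr (nth 0 s j).

(** A countable infimum is what makes volumes measurable. *)
Lemma fdist_rat (V : lmodType R) (q : V -> R) x i : seminorm q -> fdist q x i =
  infr (fun s : seq rat => q (x i - \sum_(j < i) rat_seq s j *: x j)).
Proof.
move=> sq; apply/eqP; rewrite eq_le; apply/andP; split.
  by apply: le_infr => [|s]; [exact: [::]|exact: (fdist_le sq x i (rat_seq s))].
apply: le_infr => [|s]; first exact: (fun=> 0).
apply/ler_addgt0Pr => e e0.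
pose S := 1 + \sum_(j < i) q (x j).
have S0 : 0 < S by rewrite ltr_pwDl// sumr_ge0// => j _; exact: seminorm_ge0.
have /choice[r Hr] j : exists r : rat, `|s j - ratr r| < e / S.
  by apply: ratr_approx; rewrite divr_gt0.
pose f (s' : seq rat) := q (x i - \sum_(j < i) rat_seq s' j *: x j).
have f0 s' : 0 <= f s' by exact: seminorm_ge0.
apply: (le_trans (infr_le (mkseq r i) f0)); rewrite /f.
have -> : x i - \sum_(j < i) rat_seq (mkseq r i) j *: x j =
    (x i - \sum_(j < i) s j *: x j) + \sum_(j < i) (s j - ratr (r j)) *: x j.
  rewrite -addrA; congr (_ + _); rewrite -sumrN -sumrN -big_split/=.
  by apply: eq_bigr => j _; rewrite /rat_seq nth_mkseq// scalerBl addKr.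
apply: (le_trans (sq.1 _ _)); rewrite lerD2l.
apply: (le_trans (seminorm_sum i (fun j => s j - ratr (r j)) x sq)).
apply: (@le_trans _ _ (\sum_(j < i) e / S * q (x j))).
  by apply: ler_sum => j _; rewrite ler_wpM2r ?(ltW (Hr j))//; exact: seminorm_ge0.
rewrite -mulr_sumr -mulrA; apply: ler_piMr; first exact: ltW.
by rewrite mulrC ler_pdivrMr// mul1r lerDr.
Qed.

Context (V : lmodType R) (p : T -> V -> R) (sp : forall w, seminorm (p w))
  (mp : forall t, measurable_fun setT (p^~ t)).

Lemma measurable_fdist x i : measurable_fun setT (fun w => fdist (p w) x i).
Proof.
under eq_fun do rewrite fdist_rat//.
apply: (@measurable_fun_infr _ _ _ _ ([::] : seq rat) 0) => [s w|s].
  exact: seminorm_ge0.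
exact: mp.
Qed.

Lemma measurable_fvol x m : measurable_fun setT (fun w => fvol (p w) x m).
Proof.
elim: m => [|m IHm].
  by under eq_fun do rewrite /fvol big_ord0; exact: measurable_cst.
under eq_fun do rewrite fvolS.
by apply: measurable_funM => //; exact: measurable_fdist.
Qed.

End flag_measurability.

(** * Existence of expanding flags *)

Lemma exp_rate_unbounded (R : realType) (a C : R) :
  0 < a -> exists N, forall n, (N <= n)%N -> C < exp_rate a n.
Proof.
move=> a0; exists (Num.truncn (Num.max C 0 / a)).+1 => n Nn.
apply: (@lt_le_trans _ _ (1 + a * n%:R)); last exact: expR_ge1Dx.
have : Num.max C 0 / a < n%:R.
  by apply: (lt_le_trans (truncnS_gt _)); rewrite ler_nat.
rewrite ltr_pdivrMr// mulrC => h; apply: (@le_lt_trans _ _ (Num.max C 0)).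
  by rewrite le_max lexx.
lra.
Qed.

Lemma eventually_bound (R : realType) (u : nat -> R) a N :
  (forall n, (N <= n)%N -> u n <= exp_rate a n) ->
  exists2 C, 1 <= C & forall l, u l <= C * exp_rate a l.
Proof.
move=> uN; have [C [C1 HC]] : exists C, 1 <= C /\ forall l, (l < N)%N -> u l <= C * exp_rate a l.
  apply: (uniform_constant (Q := fun l C => u l <= C * exp_rate a l)).
    by move=> l c c' Hc cc'; apply: (le_trans Hc); rewrite ler_wpM2r// exp_rate_ge0.
  by move=> l _; exists (u l / exp_rate a l); rewrite divfK// gt_eqF// exp_rate_gt0.
exists C => // l; have [lN|Nl] := ltnP l N; first exact: HC.
by apply: (le_trans (uN l Nl)); rewrite ler_peMl// exp_rate_ge0.
Qed.

Lemma exists_outside (R : realType) k (x : nat -> 'rV[R]_k) m : (m < k)%N ->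
  exists y, ~ fspan x m y.
Proof.
move=> mk; have : ~~ (1%:M <= \matrix_(i < m) x i)%MS.
  apply/negP => /mxrankS; rewrite mxrank1 leqNgt; move/negP; apply.
  by apply: leq_ltn_trans (rank_leq_row _) mk.
move=> /row_subPn[i /negP hi]; exists (row i 1%:M) => -[s sE]; apply: hi.
rewrite sE; apply: summx_sub => j _; apply: scalemx_sub.
by rewrite -(rowK x j) row_sub.
Qed.

(** * Fast flags; [p w l t] is the norm at time [l] of the vector with coordinates [t] over [w] *)

Section expanding_flags.
Context (R : realType) d (T : measurableType d) (P : probability T R)
  (sigma : T -> T) (mps : measure_preserving P sigma).
Context (k : nat) (p : T -> nat -> 'rV[R]_k -> R) (b : T -> R) (Om : set T)
  (lambda : R).
Hypotheses (mOm : measurable Om) (POm : P Om = 1%E)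
  (stable : forall w, Om w -> Om (sigma w))
  (sp : forall w l, seminorm (p w l))
  (p_def : forall w l t, Om w -> p w l t = 0 -> t = 0)
  (shift : forall w, Om w -> exists M : 'M[R]_k,
     forall l t, p (sigma w) l (t *m M) = p w l.+1 t)
  (step : forall w l t, p w l.+1 t <= expR (b (iter l sigma w)) * p w l t)
  (b0 : forall w, 0 <= b w) (mb : measurable_fun setT b)
  (ib : (\int[P]_w (b w)%:E < +oo)%E)
  (mp : forall l t, measurable_fun setT (fun w => p w l t))
  (growth : forall w t, Om w -> t != 0 -> forall e, 0 < e -> exists N,
     forall n, (N <= n)%N -> exp_rate (lambda - e) n <= p w n t <= exp_rate (lambda + e) n).

Definition rat_flag (Q : seq (seq rat)) (i : nat) : 'rV[R]_k :=
  \row_j rat_seq R (nth [::] Q i) j.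

Lemma rat_flag_approx (x : nat -> 'rV[R]_k) m e : 0 < e ->
  exists Q, forall i, (i < m)%N -> `|rat_flag Q i - x i| < e.
Proof.
move=> e0; have e2 : 0 < e / 2 by rewrite divr_gt0.
have /choice[q Hq] i : exists q : nat -> rat, forall j : 'I_k, `|x i 0 j - ratr (q j)| < e / 2.
  have /choice[q Hq] j : exists q : rat,
       forall j' : 'I_k, j' = j :> nat -> `|x i 0 j' - ratr q| < e / 2.
    case: (ltnP j k) => [jk|kj]; last first.
      by exists 0 => j' jj; have := ltn_ord j'; rewrite jj ltnNge kj.
    have [q Hq] := ratr_approx (x i 0 (Ordinal jk)) e2.
    by exists q => j' jj; have -> : j' = Ordinal jk by exact: val_inj.
  by exists q => j; exact: Hq.
exists (mkseq (fun i => mkseq (q i) k) m) => i im.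
apply: (@le_lt_trans _ _ (e / 2)); last by lra.
apply: rV_norm_le => [|j]; first exact: ltW.
rewrite !mxE /rat_seq nth_mkseq// nth_mkseq// distrC.
exact/ltW/Hq.
Qed.

(** Rational flags and a finite horizon make this set measurable. The strict inequality survives
    small perturbations of the flag and, for [N > 0], excludes flags of volume 0. *)
Definition fast_set m s N := [set w | exists Q, forall l, (0 < l <= N)%N ->
  exp_rate s l * fvol (p w 0%N) (rat_flag Q) m < fvol (p w l) (rat_flag Q) m].

(** The flag may depend on [N] here; [fast_flag] extracts a single one, with real entries. *)
Definition always_fast m s := \bigcap_N fast_set m s N.

Lemma measurable_fast_set m s N : measurable (fast_set m s N).
Proof.
apply: measurable_exists => Q; apply: measurable_forall => l.
apply: measurable_impl => _; apply: measurable_lt.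
  apply: measurable_funM; first exact: measurable_cst.
  by apply: measurable_fvol => // t; exact: mp.
by apply: measurable_fvol => // t; exact: mp.
Qed.

Lemma measurable_always_fast m s : measurable (always_fast m s).
Proof. by apply: bigcapT_measurable => N; exact: measurable_fast_set. Qed.

Lemma fast_set_decr m s N : fast_set m s N.+1 `<=` fast_set m s N.
Proof. by move=> w [Q HQ]; exists Q => l /andP[l0 lN]; apply: HQ; rewrite l0 leqW. Qed.

Lemma stable_iter n w : Om w -> Om (iter n sigma w).
Proof. by move=> Ow; elim: n => //= n; exact: stable. Qed.

Lemma shift_iter n w : Om w -> exists M : 'M[R]_k,
  forall l t, p (iter n sigma w) l (t *m M) = p w (n + l)%N t.
Proof.
move=> Ow; elim: n => [|n [M HM]]; first by exists 1%:M => l t; rewrite mulmx1.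
have [M' HM'] := shift (stable_iter n Ow).
by exists (M *m M') => l t; rewrite mulmxA HM' HM addnS.
Qed.

Lemma shift_flag n w x m : Om w -> exists y,
  forall l, fvol (p (iter n sigma w) l) y m = fvol (p w (n + l)%N) x m.
Proof.
move=> Ow; have [M HM] := shift_iter n Ow; exists (fun i => x i *m M) => l.
by apply: (fvol_map (f := mulmxr M)) => t; exact: HM.
Qed.

Lemma step_iter n w t : p w n t <= expR (\sum_(j < n) b (iter j sigma w)) * p w 0%N t.
Proof.
elim: n => [|n IHn]; first by rewrite big_ord0 expR0 mul1r.
apply: (le_trans (step _ _ _)); rewrite big_ord_recr/= addrC expRD -mulrA.
by rewrite ler_wpM2l ?expR_ge0.
Qed.

Lemma step_flag n w x m : fvol (p w n) x m <=
  expR (m%:R * \sum_(j < n) b (iter j sigma w)) * fvol (p w 0%N) x m.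
Proof.
rewrite [_ * \sum_(_ < _) _]mulrC expRM_natr;
    by apply: fvol_scale; [exact: sp|exact: sp|exact: expR_ge0|move=> t; exact: step_iter].
Qed.

Lemma bernoulli (e : R) n : 0 <= e <= 1 -> 1 - n%:R * e <= (1 - e) ^+ n.
Proof.
move=> /andP[e0 e1]; elim: n => [|n IHn]; first by rewrite expr0; lra.
rewrite exprS; apply: (@le_trans _ _ ((1 - e) * (1 - n%:R * e))); last first.
  by rewrite ler_wpM2l// subr_ge0.
have := mulr_ge0 (mulr_ge0 (ler0n R n) e0) e0.
by rewrite -natr1; lra.
Qed.

(** A strict inequality leaves room for the factors of [fvol_near]. The threshold has the form
    [e * c <= 1] so that finitely many of them combine into the largest [c]. *)
Lemma flag_gap (v a : R) m : 0 <= a -> a < v -> exists2 c, 1 <= c &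
  forall e, 0 < e -> e * c <= 1 -> (1 + e) ^+ m * a < (1 - e) ^+ m * v.
Proof.
move=> a0 av; have va0 : 0 < v - a by rewrite subr_gt0.
have v0 : 0 < v by apply: le_lt_trans av.
have D0 : 0 <= (m + m)%:R * v / (v - a) by rewrite divr_ge0 ?(ltW va0)// mulr_ge0// ltW.
exists (2 + (m + m)%:R * v / (v - a)) => [|e e0 ec]; first by lra.
have e1 : e < 1 by have := mulr_ge0 (ltW e0) D0; lra.
have e1' : 0 < 1 - e by rewrite subr_gt0.
(* After multiplication by [(1 - e) ^+ m] the left side is at most [a], and the power on the right
   is handled by [bernoulli]. *)
rewrite -(ltr_pM2l (exprn_gt0 m e1')) !mulrA -exprMn -exprD.
apply: (@le_lt_trans _ _ a).
  apply: ler_piMl => //; apply: exprn_ile1.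
    by rewrite mulr_ge0// ?(ltW e1')// addr_ge0// ltW.
  by have := mulr_ge0 (ltW e0) (ltW e0); lra.
apply: (@lt_le_trans _ _ ((1 - (m + m)%:R * e) * v)); last first.
  by rewrite ler_pM2r// bernoulli// (ltW e0) (ltW e1).
have h : e * ((m + m)%:R * v / (v - a)) < 1 by have := e0; lra.
have : e * ((m + m)%:R * v / (v - a)) * (v - a) < 1 * (v - a) by rewrite ltr_pM2r.
rewrite mulrA divfK ?gt_eqF//; lra.
Qed.

(** A real flag beating rate [s] over the whole horizon has positive initial volume, so a rational
    flag close to it would beat it too. *)
Lemma fast_setPn m s N w x : Om w -> (0 < N)%N -> ~ fast_set m s N w ->
  exists2 l, (0 < l <= N)%N & fvol (p w l) x m <= exp_rate s l * fvol (p w 0%N) x m.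
Proof.
move=> Ow N0 nF; apply: contrapT => nl; apply: nF.
have {}nl l : (0 < l <= N)%N -> exp_rate s l * fvol (p w 0%N) x m < fvol (p w l) x m.
  by move=> lN; rewrite ltNge; apply/negP => h; apply: nl; exists l.
have v0 : 0 < fvol (p w 0%N) x m.
  have := fvol_ge0 (sp w 0%N) x m; rewrite le_eqVlt => /predU1P[v0|//].
  have := nl 1%N N0; have := step_flag 1 w x m.
  by rewrite -v0 !mulr0; lra.
have [c [c1 Hc]] : exists c, 1 <= c /\ forall l, (l < N.+1)%N -> (0 < l)%N ->
    forall e, 0 < e -> e * c <= 1 ->
    (1 + e) ^+ m * (exp_rate s l * fvol (p w 0%N) x m) < (1 - e) ^+ m * fvol (p w l) x m.
  apply: (uniform_constant (Q := fun l c => (0 < l)%N -> forall e, 0 < e -> e * c <= 1 ->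
    (1 + e) ^+ m * (exp_rate s l * fvol (p w 0%N) x m) < (1 - e) ^+ m * fvol (p w l) x m)).
    move=> l c c' H cc' l0 e e0 ec; apply: H => //; apply: le_trans ec.
    by rewrite ler_pM2l.
  move=> [|l] lN; first by exists 1.
  have [||c c1 Hc] := @flag_gap (fvol (p w l.+1) x m) (exp_rate s l.+1 * fvol (p w 0%N) x m) m.
  - by rewrite mulr_ge0 ?exp_rate_ge0 ?ltW.
  - by apply: nl.
  by exists c => _.
have c0 : 0 < c by apply: lt_le_trans c1.
have e01 : 0 < (c + 1)^-1 < 1 by rewrite invr_gt0 invf_lt1; lra.
have ec : (c + 1)^-1 * c <= 1 by rewrite ler_pdivrMl; lra.
have [D D0 HD] := fvol_near N (sp w) (fun l t => @p_def w l t Ow) v0 e01.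
have [Q HQ] := rat_flag_approx x m D0.
exists Q => l /andP[l0 lN].
have [h1 h2] := HD _ HQ 0%N (leq0n N); have [h3 h4] := HD _ HQ l lN.
have := Hc l lN l0 _ (proj1 (andP e01)) ec.
move: h1 h2 h3 h4; set e := (c + 1)^-1 => h1 h2 h3 h4 h5.
apply: (@le_lt_trans _ _ (exp_rate s l * ((1 + e) ^+ m * fvol (p w 0%N) x m))).
  by rewrite ler_wpM2l// exp_rate_ge0.
by apply: lt_le_trans h3; rewrite mulrCA.
Qed.

(** A step in the fast set is paid in full, with [|s|] added since the estimate credits [s] to every
    step. The second term pays for large values of [b] in a block cut off by the end of the orbit
    segment. *)
Definition cost m s N C w : R :=
  (m%:R * b w + `|s|) * \1_(fast_set m s N) w + m%:R * b w * \1_[set u | C < b u] w.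

Lemma cost_ge0 m s N C w : 0 <= cost m s N C w.
Proof. by rewrite addr_ge0// mulr_ge0// ?addr_ge0// ?mulr_ge0// indicE. Qed.

Lemma cost_fast m s N C w : fast_set m s N w -> m%:R * b w + `|s| <= cost m s N C w.
Proof.
move=> Fw; rewrite /cost [\1_(fast_set _ _ _) w]indicE mem_set//= mulr1 lerDl.
by rewrite mulr_ge0 ?mulr_ge0// indicE.
Qed.

Lemma cost_tail m s N C w : 0 <= C -> m%:R * b w <= m%:R * C + cost m s N C w.
Proof.
move=> C0; have [bC|Cb] := leP (b w) C.
  by apply: ler_wpDr; [exact: cost_ge0|rewrite ler_wpM2l].
apply: ler_wpDl; first by rewrite mulr_ge0.
rewrite /cost [\1_[set u | _] w]indicE mem_set//= mulr1 lerDr.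
by rewrite mulr_ge0 ?addr_ge0 ?mulr_ge0// indicE.
Qed.

(* Away from [fast_set m s N], every flag gains volume at rate at most [s] over
   some block of length at most [N]; the other times are paid for by [cost]. *)
Lemma covering m s N C n w x : 0 <= C -> (0 < N)%N -> Om w ->
  fvol (p w n) x m <= expR (s * n%:R + \sum_(j < n) cost m s N C (iter j sigma w) +
    N%:R * (`|s| + m%:R * C)) * fvol (p w 0%N) x m.
Proof.
move=> C0 N0; have [n' nn'] := ubnP n; elim: n' n nn' w x => // n' IH n nn' w x Ow.
have K0 : 0 <= N%:R * (`|s| + m%:R * C) by rewrite !(mulr_ge0, addr_ge0).
set K := N%:R * _ in IH K0 *.
have v0 := fvol_ge0 (sp w 0%N) x m.
have sumS r l : \sum_(j < l + r) cost m s N C (iter j sigma w) =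
    \sum_(j < l) cost m s N C (iter j sigma w) +
    \sum_(j < r) cost m s N C (iter j sigma (iter l sigma w)).
  rewrite big_split_ord/=; congr (_ + _).
  by apply: eq_bigr => j _; rewrite addnC iterD.
have sum0 l : 0 <= \sum_(j < l) cost m s N C (iter j sigma w).
  by apply: sumr_ge0 => j _; exact: cost_ge0.
case: n => [|n] in nn' *.
  by rewrite big_ord0 mulr0 !add0r ler_peMl// -[1]expR0 ler_expR.
(* After a block of length [l], the induction hypothesis applies to the flag transported to
   [iter l sigma w]. *)
have jump l : (0 < l <= n.+1)%N ->
    fvol (p w l) x m <= expR (s * l%:R + \sum_(j < l) cost m s N C (iter j sigma w)) *
      fvol (p w 0%N) x m ->
    fvol (p w n.+1) x m <= expR (s * n.+1%:R +
      \sum_(j < n.+1) cost m s N C (iter j sigma w) + K) * fvol (p w 0%N) x m.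
  move=> /andP[l0 ln] vl; have [y Hy] := shift_flag l x m Ow.
  have nE : n.+1 = (l + (n.+1 - l))%N by rewrite subnKC.
  have rn : (n.+1 - l < n')%N.
    by rewrite -ltnS (leq_trans _ nn')// ltnS ltn_subrL l0.
  have := IH _ rn _ y (stable_iter l Ow).
  rewrite !Hy addn0 -nE => /le_trans; apply.
  set r := (n.+1 - l)%N in nE *.
  apply: (le_trans (ler_wpM2l (expR_ge0 _) vl)); rewrite mulrA -expRD.
  apply: ler_wpM2r => //; rewrite ler_expR [in leRHS]nE sumS natrD mulrDr.
  by rewrite le_eqVlt; apply/orP; left; apply/eqP; ring.
have [Fw|nFw] := pselect (fast_set m s N w).
  apply: (jump 1%N) => //; rewrite mulr1 big_ord1.
  apply: (le_trans (step_flag 1 w x m)); rewrite big_ord1 ler_wpM2r// ler_expR.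
  have := cost_fast C Fw; have := ler_norm (- s); rewrite normrN; lra.
have [l /andP[l0 lN] Hl] := fast_setPn x Ow N0 nFw.
have [ln|nl] := leqP l n.+1.
  apply: (jump l); first by rewrite l0.
  by apply: (le_trans Hl); rewrite ler_wpM2r// /exp_rate ler_expR lerDl.
(* The slow block would end too late: fewer than [N] steps remain, paid by the constant [K] and,
   where [b] exceeds [C], by the cost. *)
apply: (le_trans (step_flag n.+1 w x m)); rewrite ler_wpM2r// ler_expR.
apply: (@le_trans _ _ (\sum_(j < n.+1) (m%:R * C + cost m s N C (iter j sigma w)))).
  by rewrite mulr_sumr; apply: ler_sum => j _; exact: cost_tail.
rewrite big_split/= sumr_const card_ord -mulr_natr.
have nN : n.+1%:R <= N%:R :> R by rewrite ler_nat (leq_trans (ltnW nl)).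
have h1 : m%:R * C * n.+1%:R <= N%:R * (m%:R * C).
  by rewrite mulrC ler_wpM2r// mulr_ge0.
have h2 : - (s * n.+1%:R) <= N%:R * `|s|.
  apply: (@le_trans _ _ (`|s| * n.+1%:R)).
    by rewrite -mulNr ler_wpM2r//; have := ler_norm (- s); rewrite normrN.
  by rewrite mulrC ler_wpM2r.
by rewrite /K mulrDr; lra.
Qed.


Lemma upper_growth w y theta : Om w -> 0 < theta ->
  exists C, forall l, p w l y <= C * exp_rate (lambda + theta) l.
Proof.
move=> Ow th0; have [->|y0] := eqVneq y 0.
  by exists 0 => l; rewrite mul0r seminorm0.
have [N HN] := growth Ow y0 th0.
have [n Nn|C _ HC] := @eventually_bound _ (fun n => p w n y) (lambda + theta) N.
  by have /andP[] := HN n Nn.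
by exists C.
Qed.

Lemma fast_flag m s w : Om w -> always_fast m s w ->
  exists x, forall l, exp_rate s l <= fvol (p w l) x m.
Proof.
move=> Ow Fw; apply: fast_flag_limit => //; first by move=> t; exact: p_def.
(* The horizon [N.+1] contains time 1, where strictness shows that the initial volume is
   positive. *)
move=> N; have [Q HQ] := Fw N.+1 I; exists (rat_flag Q); split.
  have h := HQ 1%N isT; have h' := step_flag 1 w (rat_flag Q) m.
  have := fvol_ge0 (sp w 0%N) (rat_flag Q) m; rewrite le_eqVlt => /predU1P[v0|//].
  by move: h h'; rewrite -v0 !mulr0; lra.
move=> [|l] lN; first by rewrite exp_rate0 mul1r.
by apply/ltW/HQ => /=; exact: leqW.
Qed.

Lemma measurable_cost m s N C : measurable_fun setT (cost m s N C).
Proof.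
have mb' : measurable_fun setT (fun w => m%:R * b w).
  by apply: measurable_funM => //; exact: measurable_cst.
apply: measurable_funD; apply: measurable_funM.
- by apply: measurable_funD => //; exact: measurable_cst.
- exact: (measurable_indic (measurable_fast_set m s N)).
- exact: mb'.
- by apply: measurable_indic; apply: measurable_lt => //; exact: measurable_cst.
Qed.

(** The fast sets decrease to a null set, and the sets where [b] exceeds [C] to the empty set; as
    [b] is integrable, both terms of the cost have small integral. *)
Lemma cost_small m s e : 0 < e -> P (always_fast m s) = 0%E -> exists N C,
  [/\ (0 < N)%N, 0 <= C & (\int[P]_w (cost m s N C w)%:E < e%:E)%E].
Proof.
move=> e0 PF; have e2 : 0 < e / 2 by rewrite divr_gt0.
have mbr (c : R) : 0 <= c -> measurable_fun setT (fun w => m%:R * b w + c) /\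
    (\int[P]_w (m%:R * b w + c)%:E < +oo)%E.
  move=> c0; have mmb : measurable_fun setT (fun w => m%:R * b w).
    by apply: measurable_funM => //; exact: measurable_cst.
  split; first by apply: measurable_funD => //; exact: measurable_cst.
  have pos w : setT w -> (0 <= (m%:R * b w)%:E)%E by rewrite lee_fin mulr_ge0.
  have posc (w : T) : setT w -> (0 <= (c%:E : \bar R))%E by rewrite lee_fin.
  have mE : measurable_fun setT (fun w => (m%:R * b w)%:E) by exact/measurable_EFinP.
  rewrite (eq_integral (fun w => (m%:R * b w)%:E + c%:E)%E); last by move=> w _; rewrite EFinD.
  have mc : measurable_fun setT (fun _ : T => c%:E) by exact: measurable_cst.
  rewrite (ge0_integralD P measurableT pos mE (f2 := fun=> c%:E) posc mc).
  rewrite lte_add_pinfty//; last by rewrite integral_cst//= probability_setT mule1 ltry.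
  under eq_integral do rewrite EFinM.
  rewrite ge0_integralZl//.
  - by rewrite lte_mul_pinfty ?lee_fin.
  - exact/measurable_EFinP.
  - by move=> w _; rewrite lee_fin.
have [m1 i1] := mbr `|s| (normr_ge0 s); have [m2 i2] := mbr 0 (lexx 0).
have mb0 w : 0 <= m%:R * b w by rewrite mulr_ge0.
have [N HN] := integral_small m1 (fun w => addr_ge0 (mb0 w) (normr_ge0 s)) i1
  (measurable_fast_set m s) (@fast_set_decr m s) PF e2.
have mT n : measurable [set u | n%:R < b u].
  by apply: measurable_lt => //; exact: measurable_cst.
have decT n : [set u | n.+1%:R < b u] `<=` [set u | n%:R < b u].
  by move=> w /=; apply: le_lt_trans; rewrite ler_nat.
have PT0 : P (\bigcap_n [set u | n%:R < b u]) = 0%E.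
  rewrite (_ : \bigcap_n _ = set0) ?measure0// -subset0 => w /= h.
  have := h (Num.truncn (b w)).+1 I; rewrite /= => h'.
  by have := lt_trans h' (truncnS_gt (b w)); rewrite ltxx.
have [n Hn] := integral_small m2 (fun w => addr_ge0 (mb0 w) (lexx 0)) i2 mT decT PT0 e2.
exists N.+1, n%:R; split=> //.
have ind0 (A : set T) w : 0 <= \1_A w :> R by rewrite indicE.
have c1 w : 0 <= (m%:R * b w + `|s|) * \1_(fast_set m s N) w by rewrite mulr_ge0// addr_ge0.
have c2 w : 0 <= (m%:R * b w + 0) * \1_[set u | n%:R < b u] w by rewrite mulr_ge0// addr0.
have mc1 : measurable_fun setT (fun w => ((m%:R * b w + `|s|) * \1_(fast_set m s N) w)%:E).
  apply/measurable_EFinP; apply: measurable_funM => //.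
  exact: (measurable_indic (measurable_fast_set m s N)).
have mc2 : measurable_fun setT (fun w => ((m%:R * b w + 0) * \1_[set u | n%:R < b u] w)%:E).
  by apply/measurable_EFinP; apply: measurable_funM => //; exact: (measurable_indic (mT n)).
apply: (@le_lt_trans _ _ (\int[P]_w (((m%:R * b w + `|s|) * \1_(fast_set m s N) w)%:E +
    ((m%:R * b w + 0) * \1_[set u | n%:R < b u] w)%:E)%E)%E).
  apply: ge0_le_integral => //.
  - by move=> w _; rewrite lee_fin cost_ge0.
  - by apply/measurable_EFinP; exact: measurable_cost.
  - exact: emeasurable_funD.
  move=> w _; rewrite -EFinD lee_fin /cost addr0 lerD2r ler_wpM2l ?addr_ge0//.
  rewrite !indicE ler_nat; case: (boolP (w \in fast_set m s N.+1)) => //.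
  by move=> /set_mem/fast_set_decr/mem_set ->.
have p1 w : setT w -> (0 <= ((m%:R * b w + `|s|) * \1_(fast_set m s N) w)%:E)%E by rewrite lee_fin.
have p2 w : setT w -> (0 <= ((m%:R * b w + 0) * \1_[set u | (n%:R < b u)%R] w)%:E)%E by rewrite lee_fin.
rewrite (ge0_integralD P measurableT p1 mc1 p2 mc2).
by rewrite [e in ltRHS]splitr EFinD lteD.
Qed.

(** If longer flags were almost never fast, the maximal inequality would leave a point of [A] at
    which an [m]-flag is fast while all flags of length [m.+1] are slow at every time; [slow_vector]
    then contradicts [growth]. *)
Lemma always_fast_step m : (m < k)%N ->
  (forall e, 0 < e -> (0 < P (always_fast m (lambda *+ m - e)))%E) ->
  forall e, 0 < e -> (0 < P (always_fast m.+1 (lambda *+ m.+1 - e)))%E.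
Proof.
move=> mk fastm e e0; rewrite lt0e measure_ge0 andbT; apply/eqP => P0.
(* Half of the deficit [e] leaves room for the averaged cost [theta]; the other half is the gap
   [beta]. With this [theta] the total loss in [slow_vector] is [beta / 4]. *)
pose beta := e / 2; have beta0 : 0 < beta by rewrite divr_gt0.
pose theta := beta / (4 * (m * m.+1 + 3)%:R).
have th0 : 0 < theta by rewrite divr_gt0// mulr_gt0// ltr0n addn3.
have thE : theta *+ (m * m.+1 + 3) = beta / 4.
  have : (m * m.+1 + 3)%:R != 0 :> R by rewrite pnatr_eq0 addn3.
  by move=> D0; rewrite -[LHS]mulr_natr /theta invfM mulrA divfK.
have th_small : theta <= beta / 4.
  by rewrite -thE -[leLHS]mulr1n ler_wpMn2l ?(ltW th0)// addn3.
have {}fastm := fastm _ th0; set A := always_fast m _ in fastm.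
have mA : measurable A by exact: measurable_always_fast.
have Afin : P A \is a fin_num by exact: fin_num_measure.
have dA : 0 < fine (P A) by rewrite fine_gt0// fastm ltey_eq Afin.
(* Divided by the threshold [theta], this integral bound makes the bad set smaller than [A]. *)
have eps0 : 0 < theta * fine (P A) by rewrite mulr_gt0.
have [N [C [N0 C0 costN]]] := cost_small eps0 P0.
set s := lambda *+ m.+1 - e in P0 costN.
have [mB PB] := maximal_ergodic mps (measurable_cost m.+1 s N C)
  (cost_ge0 m.+1 s N C) th0 (lt_trans costN (ltry _)).
set B := [set w | exists n, _] in mB PB.
have PBA : (P B < P A)%E.
  rewrite -(@lte_pmul2l _ theta%:E)// ?lte_fin//.
  by apply: (le_lt_trans PB); apply: (lt_le_trans costN); rewrite EFinM fineK.
have [w [Aw Ow nBw]] : exists w, [/\ A w, Om w & ~ B w].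
  apply: contrapT => nw; move: PBA; rewrite ltNge => /negP; apply.
  have nOm : P (~` Om) = 0%E by rewrite probability_setC// POm subee.
  have AB : A `<=` B `|` ~` Om.
    move=> w Aw; have [Bw|nBw] := pselect (B w); [by left|right => Ow].
    by apply: nw; exists w.
  have mOmC := measurableC mOm.
  apply: (le_trans (le_measure _ _ _ AB)); rewrite ?inE//; first exact: measurableU.
  by apply: (le_trans (measureU2 _ mB mOmC)); rewrite [X in (_ + X)%E]nOm adde0.
have sumle n : \sum_(j < n) cost m.+1 s N C (iter j sigma w) <= theta * n%:R.
  by rewrite leNgt; apply/negP => h; apply: nBw; exists n.
have [x fx] := fast_flag Ow Aw.
(* A vector outside the span keeps [z] below from vanishing, whatever the limit coefficients. *)
have [y ny] := exists_outside x mk.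
pose x' i := if (i < m)%N then x i else y.
have x'E i : (i < m)%N -> x' i = x i by rewrite /x' => ->.
have x'm : x' m = y by rewrite /x' ltnn.
(* A value of [b] above [C] is part of the cost, whose sums are at most [theta] times the elapsed
   time. This gives the one-step bound of [slow_vector]. *)
have bl l : b (iter l sigma w) <= C + theta * l.+1%:R.
  have := sumle l.+1; rewrite big_ord_recr/=.
  have h1 : 0 <= \sum_(j < l) cost m.+1 s N C (iter j sigma w).
    by apply: sumr_ge0 => j _; exact: cost_ge0.
  have [bC|Cb] := leP (b (iter l sigma w)) C.
    by move=> _; apply: ler_wpDr => //; rewrite mulr_ge0 ?(ltW th0).
  have : b (iter l sigma w) <= cost m.+1 s N C (iter l sigma w).
    rewrite /cost [\1_[set u | _] _]indicE mem_set//= mulr1.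
    apply: ler_wpDl; first by rewrite mulr_ge0 ?addr_ge0 ?mulr_ge0// indicE.
    by rewrite ler_peMl// ler1n.
  lra.
have [||||||sl [K HK]] := @slow_vector R _ (p w) x' m lambda theta (sp w) (ltW th0)
    _ _ beta (expR (C + theta)).
- by move=> z; exact: upper_growth.
- exists 1 => // l; rewrite mul1r (eq_fvol _ (y := x))//; exact: fx.
- exact: expR_ge0.
- move=> l z; apply: (le_trans (step _ _ _)); apply: ler_wpM2r; first exact: seminorm_ge0.
  rewrite /exp_rate -expRD ler_expR; have := bl l; rewrite -natr1; lra.
- exists (expR (N%:R * (`|s| + m.+1%:R * C)) * fvol (p w 0%N) x' m.+1) => l.
  apply: (le_trans (covering m.+1 s l x' C0 N0 Ow)).
  rewrite expRD -mulrA [leLHS]mulrC ler_wpM2l//.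
    by rewrite mulr_ge0 ?expR_ge0//; exact: fvol_ge0.
  rewrite /exp_rate ler_expR; have := sumle l.
  have : s + theta <= lambda *+ m.+1 - beta by rewrite /s /beta; move: th_small beta0; rewrite /beta; lra.
  by move=> /(ler_wpM2r (ler0n R l)); lra.
- apply: (@lt_le_trans _ _ (theta *+ (m * m.+1 + 3))); last by rewrite thE; lra.
  by rewrite ltr_pMn2l// ltn_add2l.
pose z := x' m - \sum_(j < m) sl j *: x' j.
have z0 : z != 0.
  apply/eqP => /subr0_eq; rewrite x'm => yE; apply: ny; rewrite yE; exists sl.
  by apply: eq_bigr => j _; rewrite x'E.
have b4 : 0 < beta / 4 by rewrite divr_gt0.
have [N1 HN1] := growth Ow z0 b4.
have b2 : 0 < beta / 2 by rewrite divr_gt0.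
have [N2 HN2] := exp_rate_unbounded K b2.
pose n := maxn N1 N2.
have /andP[g1 _] := HN1 n (leq_maxl _ _).
have g2 := HK n; have g3 := HN2 n (leq_maxr _ _).
have := le_trans g1 g2; rewrite leNgt => /negP; apply.
(* [z] has rate at most [lambda - beta + beta / 4] by construction and at least [lambda - beta / 4]
   by [growth]. *)
have -> : lambda - beta / 4 = beta / 2 + (lambda - beta + theta *+ (m * m.+1 + 3)).
  by rewrite thE; lra.
by rewrite [ltRHS]exp_rateD ltr_pM2r// exp_rate_gt0.
Qed.

Lemma always_fast_gt0 m : (m <= k)%N ->
  forall e, 0 < e -> (0 < P (always_fast m (lambda *+ m - e)))%E.
Proof.
elim: m => [|m IHm] mk e e0; last by apply: always_fast_step => //; exact: IHm (ltnW mk).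
rewrite (_ : always_fast _ _ = setT) ?probability_setT//.
apply/seteqP; split=> // w _ N _; exists [::] => l /andP[l0 _].
rewrite /fvol !big_ord0 mulr1 mulr0n sub0r /exp_rate mulNr expR_lt1 oppr_lt0.
by rewrite mulr_gt0// ltr0n.
Qed.

(** A fast flag of full length is a basis, and [flag_conorm] bounds coordinates in it by the norm at
    time [l], with a constant independent of the vector. *)
Lemma uniform_expansion e : 0 < e -> exists Y, [/\ measurable Y, (0 < P Y)%E, Y `<=` Om &
  forall w, Y w -> exists2 c, 0 < c & forall l t, c * exp_rate (lambda - e) l * `|t| <= p w l t].
Proof.
(* The loss in [flag_conorm] is [theta *+ (k * k.+1)]; the successor keeps the denominator nonzero
   when [k = 0]. *)
move=> e0; pose theta := e / (k * k.+1).+1%:R.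
have th0 : 0 < theta by rewrite divr_gt0.
have thE : theta *+ (k * k.+1) <= e.
  apply: (@le_trans _ _ (theta *+ (k * k.+1).+1)); first by rewrite ler_wpMn2l ?(ltW th0).
  by rewrite -mulr_natr divfK// pnatr_eq0.
pose A := always_fast k (lambda *+ k - theta).
have mA : measurable A by exact: measurable_always_fast.
exists (A `&` Om); split.
- exact: measurableI.
- have := always_fast_gt0 (leqnn k) th0; rewrite -/A => /lt_le_trans; apply.
  have -> : P A = P (A `&` Om) => //.
  have nOm : P (~` Om) = 0%E by rewrite probability_setC// POm subee.
  rewrite -[in LHS](setIT A) -(setUv Om) setIUr measureU//; last 3 first.
  - exact: measurableI.
  - by apply: measurableI => //; exact: measurableC.
  - by rewrite setIACA setICr setI0.
  rewrite [X in (_ + X)%E](_ : _ = 0%E) ?adde0//.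
  apply: (subset_measure0 _ _ _ nOm) => //; last exact: measurableC.
  by apply: measurableI => //; exact: measurableC.
- by move=> w [].
move=> w [Aw Ow]; have [x fx] := fast_flag Ow Aw.
have [||C C0 HC] := @flag_conorm R _ (p w) x k lambda theta (sp w) (ltW th0) _ _ k (leqnn k).
- by move=> z; exact: upper_growth.
- by exists 1 => // l; rewrite mul1r.
have v0 : 0 < fvol (p w 0%N) x k by apply: lt_le_trans (fx 0%N); rewrite exp_rate_gt0.
have Xu : \matrix_(i < k) x i \in unitmx by rewrite -row_free_unit; exact: fvol_row_free v0.
set X := \matrix_(i < k) x i in Xu.
have [K [K1 HK]] : exists K, 1 <= K /\ forall i, (i < k)%N -> `|x i| <= K.
  apply: (uniform_constant (Q := fun i K => `|x i| <= K)).
    by move=> i c c' Hc; exact: le_trans.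
  by move=> i _; exists `|x i|.
have K0 : 0 < K by apply: lt_le_trans K1.
have CK : 0 < (C + 1) * K by rewrite mulr_gt0// ltr_wpDl.
exists ((C + 1) * K)^-1 => [|l t]; first by rewrite invr_gt0.
pose s j := if insub j is Some j' then (t *m invmx X) 0 (j' : 'I_k) else 0.
have tE : t = \sum_(j < k) s j *: x j.
  rewrite -[LHS](mulmxKV Xu) mulmx_sum_row; apply: eq_bigr => j _.
  by rewrite /s valK rowK.
have := HC l s; rewrite -tE => h.
have tK : `|t| <= K * \sum_(j < k) `|s j|.
  rewrite tE; apply: (le_trans (ler_norm_sum _ _ _)); rewrite mulr_sumr.
  by apply: ler_sum => j _; rewrite normrZ mulrC ler_wpM2r// HK.
have eE : exp_rate (- (lambda - theta *+ (k * k.+1))) l <= (exp_rate (lambda - e) l)^-1.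
  by rewrite -exp_rateN; apply: ler_exp_rate; rewrite lerN2 lerD2l lerN2.
rewrite -mulrA ler_pdivrMl// -ler_pdivlMl ?exp_rate_gt0//.
apply: (le_trans tK); rewrite [leRHS](_ : _ =
  K * ((C + 1) * (exp_rate (lambda - e) l)^-1 * p w l t)); last by ring.
rewrite ler_wpM2l ?(ltW K0)//; apply: (le_trans h).
apply: ler_wpM2r; first exact: seminorm_ge0.
by apply: ler_pM => //; [exact: exp_rate_ge0|rewrite lerDl].
Qed.

End expanding_flags.

(** * Growth rates and closed sums *)

Section rates.
Context (R : realType).
Implicit Types (u : nat -> R) (a : R) (x y lam : \bar R).

Lemma ereal_between x y : (x < y)%E -> exists r : R, (x < r%:E)%E /\ (r%:E < y)%E.
Proof.
case: x y => [r| |] [s| |]//=; rewrite ?lte_fin => rs.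
- by exists ((r + s) / 2); rewrite !lte_fin; lra.
- by exists (r + 1); rewrite lte_fin ltry; split=> //; lra.
- by exists (s - 1); rewrite lte_fin ltNyr; split=> //; lra.
- by exists 0; rewrite ltry ltNyr.
Qed.

Lemma log_rate_gt n r a : (0 < n)%N -> (a%:E < log_rate n r)%E -> exp_rate a n < r.
Proof.
move=> n0; have n0' : 0 < n%:R^-1 :> R by rewrite invr_gt0 ltr0n.
have [r0|r0] := leP r 0.
  by rewrite /log_rate /= r0 mulr_infty gtr0_sg// mul1e ltNge leNye.
rewrite /log_rate lne_EFin// -EFinM lte_fin mulrC ltr_pdivlMr ?ltr0n// => h.
by rewrite /exp_rate -[r in ltRHS]lnK ?posrE// ltr_expR.
Qed.

Lemma log_rate_lt n r a : (0 < n)%N -> (log_rate n r < a%:E)%E -> r < exp_rate a n.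
Proof.
move=> n0; have [r0 _|r0] := leP r 0; first by apply: le_lt_trans r0 (exp_rate_gt0 _ _).
rewrite /log_rate lne_EFin// -EFinM lte_fin mulrC ltr_pdivrMr ?ltr0n// => h.
by rewrite /exp_rate -[r in ltLHS]lnK ?posrE// ltr_expR.
Qed.

Lemma log_rate_cvg_gt u lam a : log_rate n (u n) @[n --> \oo] --> lam ->
  (a%:E < lam)%E -> exists N, forall n, (N <= n)%N -> exp_rate a n <= u n.
Proof.
move=> cv al; have nb : nbhs lam [set y | (a%:E < y)%E].
  by apply: open_nbhs_nbhs; split; [exact: open_ereal_gt_ereal|].
have [N _ HN] := cv _ nb; exists N.+1 => n Nn.
by apply/ltW/log_rate_gt; [exact: leq_ltn_trans Nn|exact: (HN n (ltnW Nn))].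
Qed.

Lemma log_rate_cvg_lt u lam a : log_rate n (u n) @[n --> \oo] --> lam ->
  (lam < a%:E)%E -> exists N, forall n, (N <= n)%N -> u n <= exp_rate a n.
Proof.
move=> cv al; have nb : nbhs lam [set y | (y < a%:E)%E].
  by apply: open_nbhs_nbhs; split; [exact: open_ereal_lt_ereal|].
have [N _ HN] := cv _ nb; exists N.+1 => n Nn.
by apply/ltW/log_rate_lt; [exact: leq_ltn_trans Nn|exact: (HN n (ltnW Nn))].
Qed.

Lemma log_rate_limsup_lt u lam a :
  (limn_esup (fun n => log_rate n (u n)) <= lam)%E -> (lam < a%:E)%E ->
  exists N, forall n, (N <= n)%N -> u n <= exp_rate a n.
Proof.
move=> ul la; have := le_lt_trans ul la; rewrite /limn_esup /limf_esup => h.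
have [_ [A [N _ HN] <-] hA] := ereal_inf_lt h.
exists N.+1 => n Nn; apply/ltW/log_rate_lt; first exact: leq_ltn_trans Nn.
apply: le_lt_trans hA; apply: ereal_sup_ubound; exists n => //.
exact: (HN n (ltnW Nn)).
Qed.

End rates.

Section growth.
Context (R : realType) (X : lmodType R) (q : nat -> X -> R)
  (sq : forall n, seminorm (q n)).
Implicit Types (x y : X) (a : R).

Definition slow a x := exists C, forall n, q n x <= C * exp_rate a n.

Lemma slow0 a : slow a 0.
Proof. by exists 0 => n; rewrite seminorm0// mul0r. Qed.

Lemma slowD a x y : slow a x -> slow a y -> slow a (x + y).
Proof.
move=> [C HC] [K HK]; exists (C + K) => n; apply: (le_trans ((sq n).1 _ _)).
by rewrite mulrDl lerD.
Qed.

Lemma slowZ a c x : slow a x -> slow a (c *: x).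
Proof.
by move=> [C HC]; exists (`|c| * C) => n; rewrite (sq n).2 -mulrA ler_wpM2l.
Qed.

Lemma slowB a x y : slow a x -> slow a y -> slow a (x - y).
Proof. by move=> sx sy; apply: slowD => //; rewrite -scaleN1r; exact: slowZ. Qed.

Lemma slow_sum a (I : Type) (s : seq I) (P : pred I) (v : I -> X) :
  (forall i, P i -> slow a (v i)) -> slow a (\sum_(i <- s | P i) v i).
Proof.
by move=> sv; elim/big_ind : _ => // [|x y]; [exact: slow0|exact: slowD].
Qed.

Lemma slow_le a b x : a <= b -> slow a x -> slow b x.
Proof.
move=> ab [C HC]; exists `|C| => n; apply: (le_trans (HC n)).
by apply: ler_pM (ler_norm _) (ler_exp_rate _ ab); rewrite ?exp_rate_ge0//; 
  have := seminorm_ge0 x (sq n); have := HC n; have := exp_rate_gt0 a n; nra.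
Qed.

Lemma slow_eventually a x N : (forall n, (N <= n)%N -> q n x <= exp_rate a n) -> slow a x.
Proof. by move=> /eventually_bound[C _ HC]; exists C. Qed.

Lemma not_slow a b x : a < b -> (forall N, exists2 n, (N <= n)%N & exp_rate b n <= q n x) ->
  ~ slow a x.
Proof.
move=> ab fx [C HC]; have ba : 0 < b - a by rewrite subr_gt0.
have [N HN] := exp_rate_unbounded C ba; have [n Nn bn] := fx N.
have := le_trans bn (HC n); rewrite leNgt => /negP; apply.
have -> : b = (b - a) + a by rewrite subrK.
by rewrite exp_rateD ltr_pM2r ?exp_rate_gt0// HN.
Qed.

Definition exact_rate (lam : \bar R) x :=
  x != 0 -> log_rate n (q n x) @[n --> \oo] --> lam.

(** Quantifying over the reals above [lam] treats [-oo] like the finite exponents. *)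
Definition rate_le (lam : \bar R) x := forall a, (lam < a%:E)%E -> slow a x.

Lemma exact_rate_le lam x : exact_rate lam x -> rate_le lam x.
Proof.
have [->|x0] := eqVneq x 0; first by move=> _ a _; exact: slow0.
move=> /(_ x0) cv a la; have [N HN] := log_rate_cvg_lt cv la.
exact: slow_eventually HN.
Qed.

Lemma exact_rate_not_slow lam x a : exact_rate lam x -> x != 0 -> (a%:E < lam)%E ->
  ~ slow a x.
Proof.
move=> + x0 => /(_ x0) cv al; have [b [ab bl]] := ereal_between al.
have [N HN] := log_rate_cvg_gt cv bl.
apply: (@not_slow a b) => [|M]; first by rewrite -lte_fin.
by exists (maxn N M); [exact: leq_maxr|apply: HN; exact: leq_maxl].
Qed.

Lemma limsup_rate_le lam x :
  (limn_esup (fun n => log_rate n (q n x)) <= lam)%E -> rate_le lam x.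
Proof.
by move=> lx a la; have [N HN] := log_rate_limsup_lt lx la; exact: slow_eventually HN.
Qed.

(** The first nonzero component dominates all later ones and [f], so it fixes the growth of the
    sum. *)
Lemma component_eq0 j (lam : nat -> \bar R) (v : 'I_j.+1 -> X) f a (i0 : nat) :
  (forall i, (i <= j)%N -> (lam i.+1 < lam i)%E) ->
  (forall i : 'I_j.+1, exact_rate (lam i) (v i)) -> rate_le (lam j.+1) f ->
  slow a (\sum_i v i + f) -> (i0 <= j)%N -> (a%:E < lam i0)%E ->
  forall i : 'I_j.+1, (i <= i0)%N -> v i = 0.
Proof.
move=> dec rv rf su i0j ai0 i; have [n] := ubnP (i : nat); elim: n i => // n IH i /ltnSE i_n ii0.
have anti k l : (k <= l)%N -> (l <= j.+1)%N -> (lam l <= lam k)%E.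
  elim: l => [|l IHl]; first by rewrite leqn0 => /eqP ->.
  rewrite leq_eqVlt => /predU1P[->//|]; rewrite ltnS => kl lj.
  by apply: (le_trans (ltW (dec l lj))); apply: IHl => //; exact: ltnW.
have ij : (i <= j)%N := leq_trans ii0 i0j.
apply/eqP; apply: contrapT => /negP vi0.
(* The sum, the later components and [f] are all slow at a rate [c] chosen in this gap, and the
   earlier components vanish by induction; [v i] would then be slow below its own exponent. *)
have : (maxe (lam i.+1) a%:E < lam i)%E.
  rewrite gt_max dec//=; apply: (lt_le_trans ai0); apply: anti => //.
  exact: leq_trans i0j (leqnSn j).
move=> /ereal_between[c []]; rewrite gt_max => /andP[ic ac] ci.
apply: (exact_rate_not_slow (rv i) vi0 ci).
have -> : v i = (\sum_i v i + f) - \sum_(l | l != i) v l - f.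
  by rewrite (bigD1 i)//= addrAC addrK addrK.
apply: slowB; last by apply: rf; apply: le_lt_trans ic; exact: anti.
apply: slowB; first by apply: slow_le su; rewrite -lee_fin ltW.
apply: slow_sum => l li; have [il|] := ltnP i l.
  by apply: (exact_rate_le (rv l)); apply: le_lt_trans ic; apply: anti => //; exact: ltnW.
rewrite leq_eqVlt val_eqE (negbTE li)/= => l_i.
have -> : v l = 0; last exact: slow0.
by apply: IH; [exact: leq_trans l_i i_n|exact: leq_trans (ltnW l_i) ii0].
Qed.

End growth.

(** * Sums of a closed subspace and finite-dimensional ones *)

Section closed_sums.
Context (R : realType) (X : normedModType R).
Implicit Types (F V : set X).

Definition finite_span V := exists k (e : 'I_k -> X),
  V = [set x | exists c : 'I_k -> R, x = \sum_i c i *: e i].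

Definition add_set F V := [set x | exists f v, [/\ F f, V v & x = f + v]].

Lemma closed_subspaceD F x y : closed_subspace F -> F x -> F y -> F (x + y).
Proof. by move=> [_ _ FD] Fx Fy; rewrite -(scale1r x); exact: FD. Qed.

Lemma closed_subspaceZ F a x : closed_subspace F -> F x -> F (a *: x).
Proof. by move=> [_ F0 FD] Fx; rewrite -[_ *: _]addr0; exact: FD. Qed.

Lemma closed_approx F x : closed F -> (forall e : R, 0 < e -> exists2 y, F y & `|x - y| < e) -> F x.
Proof.
move=> cF Fx; apply: cF => B /nbhs_ballP[e /= e0 Be].
have [y Fy xy] := Fx e e0; exists y; split=> //; apply: Be.
by rewrite -ball_normE.
Qed.

(** If [e] is not in [F], its positive distance to [F] bounds the coefficient of [e] along a
    convergent sequence, and a subsequence of coefficients converges. *)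
Lemma closed_add_line F e : closed_subspace F ->
  closed_subspace [set x | exists f (t : R), F f /\ x = f + t *: e].
Proof.
move=> sF; have [cF F0 FD] := sF; split; last first.
- move=> a x y [f [t [Ff ->]]] [g [s [Fg ->]]]; exists (a *: f + g), (a * t + s).
  by split; [exact: FD|rewrite scalerDr addrACA scalerA -scalerDl].
- by exists 0, 0; rewrite scale0r addr0.
have [Fe|nFe] := pselect (F e).
  rewrite (_ : [set x | _] = F)//; apply/seteqP; split=> x.
    by move=> [f [t [Ff ->]]]; apply: closed_subspaceD => //; exact: closed_subspaceZ.
  by move=> Fx; exists x, 0; rewrite scale0r addr0.
have [r r0 Hr] : exists2 r : R, 0 < r & forall f, F f -> r <= `|e - f|.
  apply: contrapT => nr; apply: nFe; apply: closed_approx => // r r0.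
  apply: contrapT => nf; apply: nr; exists r => // f Ff.
  by rewrite leNgt; apply/negP => h; apply: nf; exists f.
have low f t : F f -> `|t| * r <= `|f + t *: e|.
  move=> Ff; have [->|t0] := eqVneq t 0; first by rewrite normr0 mul0r.
  have -> : f + t *: e = t *: (e - (- t^-1) *: f).
    by rewrite scalerBr scalerA mulrN divff// scaleN1r opprK addrC.
  by rewrite normrZ ler_wpM2l// Hr//; exact: closed_subspaceZ.
move=> x clx.
have Hx (n : nat) : exists ft : X * R, F ft.1 /\ `|x - (ft.1 + ft.2 *: e)| < n.+1%:R^-1.
  have [|_ [[f [t [Ff ->]]] xb]] := clx (ball x n.+1%:R^-1).
    by apply: nbhsx_ballx; rewrite invr_gt0.
  by exists (f, t); split=> //; move: xb; rewrite -ball_normE.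
have {Hx}[ft Hft] := choice Hx.
pose u n : 'rV[R]_1 := const_mx (ft n).2.
have uM n : `|u n| <= (`|x| + 1) / r.
  apply: rV_norm_le => [|i]; first by rewrite divr_ge0 ?(ltW r0)// addr_ge0.
  rewrite mxE ler_pdivlMr//; have [Ff xf] := Hft n.
  apply: (le_trans (low _ _ Ff)).
  have := ler_normB x (x - ((ft n).1 + (ft n).2 *: e)); rewrite subKr => /le_trans; apply.
  rewrite lerD2l ltW//; apply: (lt_le_trans xf).
  by rewrite invf_le1// ler1n.
have [t Ht] := bolzano_weierstrass uM.
exists (x - t 0 0 *: e), (t 0 0); split; last by rewrite subrK.
apply: closed_approx => // eps eps0; have eps2 : 0 < eps / 2 by rewrite divr_gt0.
have e0 : 0 < `|e| + 1 by rewrite ltr_wpDl.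
have [n Nn utn] := Ht (eps / 2 / (`|e| + 1)) (Num.truncn (eps / 2)^-1) (divr_gt0 eps2 e0).
have [Ff xf] := Hft n; exists (ft n).1 => //.
have -> : x - t 0 0 *: e - (ft n).1 =
    (x - ((ft n).1 + (ft n).2 *: e)) + ((ft n).2 - t 0 0) *: e.
  by rewrite scalerBl opprD [RHS](AC ((1*2)*2)%AC (1*5*2*(3*4))%AC)/= addNr addr0.
apply: (le_lt_trans (ler_normD _ _)); rewrite normrZ.
have h1 : `|(ft n).2 - t 0 0| < eps / 2 / (`|e| + 1).
  by apply: le_lt_trans utn; have := rV_coord_le (u n - t) 0; rewrite !mxE.
have h2 : `|(ft n).2 - t 0 0| * `|e| <= eps / 2.
  apply: (@le_trans _ _ (eps / 2 / (`|e| + 1) * (`|e| + 1))); last by rewrite divfK// gt_eqF.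
  by apply: ler_pM => //; [exact: ltW|rewrite lerDl].
have h3 : n.+1%:R^-1 < eps / 2.
  rewrite -[ltRHS]invrK ltf_pV2 ?posrE ?invr_gt0//.
  by apply: (lt_le_trans (truncnS_gt _)); rewrite ler_nat.
by have := lt_trans xf h3; lra.
Qed.

Lemma closed_add_span F V : closed_subspace F -> finite_span V ->
  closed_subspace (add_set F V).
Proof.
move=> sF [k [e ->]].
pose e' i := if insub i is Some i' then e i' else 0.
have e'E (i : 'I_k) : e' i = e i by rewrite /e' valK.
have main n : closed_subspace [set x | exists f, F f /\
    exists c : nat -> R, x = f + \sum_(i < n) c i *: e' i].
  elim: n => [|n IHn].
    rewrite (_ : [set x | _] = F)//; apply/seteqP; split=> x.
      by move=> [f [Ff [c ->]]]; rewrite big_ord0 addr0.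
    by move=> Fx; exists x; split=> //; exists (fun=> 0); rewrite big_ord0 addr0.
  have := closed_add_line (e' n) IHn; congr closed_subspace; apply/seteqP; split=> x.
    move=> [_ [t [[f [Ff [c ->]]] ->]]]; exists f; split=> //.
    exists (fun i => if (i < n)%N then c i else t).
    rewrite big_ord_recr/= ltnn addrA; congr (_ + _ + _).
    by apply: eq_bigr => i _; rewrite ltn_ord.
  move=> [f [Ff [c ->]]]; exists (f + \sum_(i < n) c i *: e' i), (c n).
  split; first by exists f; split=> //; exists c.
  by rewrite big_ord_recr/= addrA.
have := main k; congr closed_subspace; apply/seteqP; split=> x.
  move=> [f [Ff [c ->]]]; exists f, (\sum_(i < k) c i *: e' i); split=> //.
  by exists (fun i : 'I_k => c i); apply: eq_bigr => i _; rewrite e'E.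
move=> [f [_ [Ff [c ->] ->]]]; exists f; split=> //.
exists (fun i => if insub i is Some i' then c i' else 0); congr (_ + _).
by apply: eq_bigr => i _; rewrite e'E valK.
Qed.

Lemma closed_add_spans n F (V : nat -> set X) : closed_subspace F ->
  (forall i, (i < n)%N -> finite_span (V i)) ->
  closed_subspace [set x | exists f (v : 'I_n -> X),
    [/\ F f, forall i : 'I_n, V i (v i) & x = f + \sum_i v i]].
Proof.
move=> sF; elim: n => [|n IHn] HV.
  rewrite (_ : [set x | _] = F)//; apply/seteqP; split=> x.
    by move=> [f [v [Ff _ ->]]]; rewrite big_ord0 addr0.
  by move=> Fx; exists x, (fun=> 0); split; [exact: Fx|by case|by rewrite big_ord0 addr0].
have IH : closed_subspace _ := IHn (fun i h => HV i (ltnW h)).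
have := closed_add_span IH (HV n (ltnSn n)); congr closed_subspace.
apply/seteqP; split=> x.
  move=> [_ [vn [[f [v [Ff Vv ->]]] Vn ->]]]; exists f.
  pose v' (i : nat) := if insub i is Some i' then v i' else vn.
  have v'E (i : 'I_n) : v' i = v i by rewrite /v' valK.
  have v'n : v' n = vn by rewrite /v' insubF ?ltnn.
  exists (fun i => v' i); split=> // [i|].
    have [iN|ni] := ltnP i n; first by rewrite (v'E (Ordinal iN)); exact: (Vv (Ordinal iN)).
    have -> : i = n :> nat by apply/eqP; rewrite eqn_leq ni -ltnS ltn_ord.
    by rewrite v'n.
  rewrite big_ord_recr/= v'n addrA; congr (_ + _ + _).
  by apply: eq_bigr => i _; rewrite v'E.
move=> [f [v [Ff Vv ->]]]; exists (f + \sum_(i < n) v (widen_ord (leqnSn n) i)), (v ord_max).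
split; [|exact: (Vv ord_max)|by rewrite big_ord_recr/= addrA].
by exists f, (fun i => v (widen_ord (leqnSn n) i)); split=> // i; exact: (Vv (widen_ord (leqnSn n) i)).
Qed.

Lemma dense_closed_subset (A F : set X) : dense A -> closed F -> A `<=` F -> forall x, F x.
Proof.
move=> dA cF AF x; apply: closed_approx => // e e0.
have [|y [xy Ay]] := dA (ball x e) _ (ball_open x _).
  by exists x; exact: ballxx.
by exists y; [exact: AF|move: xy; rewrite -ball_normE].
Qed.

End closed_sums.

(** * Uniqueness of equivariant bundles *)

Section cocycles.
Context (R : realType) d (T : measurableType d) (X : normedModType R)
  (sigma : T -> T) (L : T -> {linear X -> X}).

Lemma cocycle_linear n w a x y : cocycle sigma L n w (a *: x + y) =
  a *: cocycle sigma L n w x + cocycle sigma L n w y.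
Proof. by elim: n => //= n ->; rewrite linearP. Qed.

Lemma cocycle0 n w : cocycle sigma L n w 0 = 0.
Proof. by elim: n => //= n ->; rewrite linear0. Qed.

Lemma cocycleD n w x y :
  cocycle sigma L n w (x + y) = cocycle sigma L n w x + cocycle sigma L n w y.
Proof. by rewrite -[x in LHS]scale1r cocycle_linear scale1r. Qed.

Lemma cocycleZ n w a x : cocycle sigma L n w (a *: x) = a *: cocycle sigma L n w x.
Proof. by rewrite -[_ *: _]addr0 cocycle_linear cocycle0 addr0. Qed.

Lemma cocycle_sum n w k (c : 'I_k -> R) (e : 'I_k -> X) :
  cocycle sigma L n w (\sum_i c i *: e i) = \sum_i c i *: cocycle sigma L n w (e i).
Proof.
elim/big_rec2 : _ => [|i x y _ <-]; first exact: cocycle0.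
by rewrite cocycle_linear.
Qed.

Lemma cocycleSr n w x : cocycle sigma L n.+1 w x = cocycle sigma L n (sigma w) (L w x).
Proof. by elim: n => //= n <-; rewrite -iterSr. Qed.

Definition orbit_norm w n x : R := `|cocycle sigma L n w x|.

Lemma orbit_norm_seminorm w n : seminorm (orbit_norm w n).
Proof.
split=> [x y|a x]; first by rewrite /orbit_norm cocycleD ler_normD.
by rewrite /orbit_norm cocycleZ normrZ.
Qed.

End cocycles.

Section recurrence.
Context (R : realType) d (T : measurableType d) (P : probability T R)
  (sigma : T -> T) (mps : measure_preserving P sigma).

(** The preimages of the exceptional null set under all iterates are removed. *)
Lemma ae_stable (G : T -> Prop) : {ae P, forall w, G w} -> exists Om,
  [/\ measurable Om, P Om = 1%E, forall w, Om w -> Om (sigma w) & Om `<=` G].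
Proof.
move=> [N [mN PN GN]]; pose Om := [set w | forall n, ~ N (iter n sigma w)].
have mOm : measurable Om.
  apply: (measurable_forall (I := nat)) => n; apply: measurableC.
  exact: (iter_preserving mps n mN).1.
exists Om; split=> //.
- have -> : Om = ~` (\bigcup_n (iter n sigma @^-1` N)).
    by rewrite setC_bigcup; apply/seteqP; split=> w /= H n => [_|]; apply: H.
  have mU : measurable (\bigcup_n (iter n sigma @^-1` N)).
    by apply: bigcupT_measurable => n; exact: (iter_preserving mps n mN).1.
  rewrite probability_setC// [P (\bigcup_n _)](_ : _ = 0%E) ?sube0//.
  apply/negligibleP => //; apply: negligible_bigcup => n.
  have [mn Pn] := iter_preserving mps n mN.
  by apply/negligibleP => //; rewrite -PN -Pn.
- by move=> w Ow n; rewrite -iterSr; exact: Ow.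
- by move=> w Ow; apply: contrapT => nG; apply: (Ow 0%N); exact: GN.
Qed.

(** By invariance, the set of points whose orbit stays in [C] from time [N] on has measure at most
    [P C]; these sets increase with [N] to one containing [Y]. *)
Lemma eventually_measure_le Y C : measurable Y -> measurable C ->
  (forall w, Y w -> exists N, forall n, (N <= n)%N -> C (iter n sigma w)) ->
  (P Y <= P C)%E.
Proof.
move=> mY mC YC; pose D N := [set w | forall n, (N <= n)%N -> C (iter n sigma w)].
have mD N : measurable (D N).
  apply: (measurable_forall (I := nat)) => n; apply: measurable_impl => _.
  exact: (iter_preserving mps n mC).1.
have mU : measurable (\bigcup_N D N) by exact: bigcupT_measurable.
have PD N : (P (D N) <= P C)%E.
  have [mn Pn] := iter_preserving mps N mC.
  by rewrite -Pn; apply: le_measure; rewrite ?inE// => w; apply.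
apply: (@le_trans _ _ (P (\bigcup_N D N))).
  by apply: le_measure; rewrite ?inE// => w /YC[N HN]; exists N.
have cD : P (D N) @[N --> \oo] --> P (\bigcup_N D N).
  apply: nondecreasing_cvg_mu => //.
  apply/nondecreasing_seqP => n; apply/subsetPset => w Dw l nl.
  by apply: Dw; exact: ltnW.
rewrite -(cvg_lim (@ereal_hausdorff R) cD).
apply: lime_le; first by apply/cvg_ex; eexists; exact: cD.
exact: nearW.
Qed.

Lemma recurrence A Om : measurable A -> (0 < P A)%E -> measurable Om -> P Om = 1%E ->
  exists2 w, Om w & forall N, exists2 n, (N <= n)%N & A (iter n sigma w).
Proof.
move=> mA PA mOm POm; apply: contrapT => nrec.
have : (P Om <= P (~` A))%E.
  apply: eventually_measure_le => //; first exact: measurableC.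
  move=> w Ow; apply: contrapT => nN; apply: nrec; exists w => // N.
  apply: contrapT => nn; apply: nN; exists N => n Nn An.
  by apply: nn; exists n.
rewrite POm probability_setC// leNgt => /negP; apply.
have /fineK fA := fin_num_measure P A mA; rewrite -fA in PA *.
by rewrite -EFinB lte_fin; move: PA; rewrite lte_fin; lra.
Qed.

(** [ergodic] speaks of strictly invariant sets; the increasing union of the preimages of [A] is
    one, with the same measure as [A]. *)
Lemma invariant_zero_one A : ergodic P sigma -> measurable A ->
  (forall w, A w -> A (sigma w)) -> P A = 0%E \/ P A = 1%E.
Proof.
move=> erg mA sA; pose D n := iter n sigma @^-1` A.
have mD n : measurable (D n) := (iter_preserving mps n mA).1.
have PD n : P (D n) = P A := (iter_preserving mps n mA).2.
have mU : measurable (\bigcup_n D n) by exact: bigcupT_measurable.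
have DS n : D n `<=` D n.+1 by move=> w Dw; exact: sA.
have <- : P (\bigcup_n D n) = P A.
  have cD : P (D n) @[n --> \oo] --> P (\bigcup_n D n).
    apply: nondecreasing_cvg_mu => //.
    by apply/nondecreasing_seqP => n; apply/subsetPset; exact: DS.
  rewrite -(cvg_lim (@ereal_hausdorff R) cD) (_ : (fun n => P (D n)) = cst (P A)).
    exact: lim_cst.
  exact/funext.
apply: erg => //; apply/seteqP; split=> w.
  by move=> [n _ Dn]; exists n.+1 => //; rewrite /D /= -iterS iterSr.
move=> [n _ Dn]; exists n => //; rewrite /D /= -iterSr /=.
exact: DS Dn.
Qed.

End recurrence.

Definition frame_span (R : realType) (X : lmodType R) k (e : 'I_k -> X) : set X :=
  [set x | exists c : 'I_k -> R, x = \sum_i c i *: e i].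

Lemma sum_delta (R : realType) (X : lmodType R) k (e : 'I_k -> X) i :
  \sum_j (j == i)%:R *: e j = e i.
Proof.
rewrite (bigD1 i)//= eqxx scale1r big1 ?addr0// => j /negbTE ->.
by rewrite scale0r.
Qed.

Lemma frame_rat_approx (R : realType) (X : normedModType R) k (e : 'I_k -> X)
    (c : 'I_k -> R) (r : R) : 0 < r -> exists q : 'rV[rat]_k,
  `|\sum_i c i *: e i - \sum_i ratr (q 0 i) *: e i| <= r.
Proof.
move=> r0; pose S := 1 + \sum_i `|e i|.
have S0 : 0 < S by rewrite ltr_pwDl// sumr_ge0.
have /choice[q Hq] i : exists q : rat, `|c i - ratr q| < r / S.
  by apply: ratr_approx; rewrite divr_gt0.
exists (\row_i q i); rewrite -sumrB.
apply: (le_trans (ler_norm_sum _ _ _)).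
apply: (@le_trans _ _ (\sum_i r / S * `|e i|)).
  apply: ler_sum => i _; rewrite mxE -scalerBl normrZ ler_wpM2r//.
  exact/ltW/Hq.
rewrite -mulr_sumr -mulrA; apply: ler_piMr; first exact: ltW.
by rewrite mulrC ler_pdivrMr// mul1r lerDr.
Qed.

Lemma closed_frame_span (R : realType) (X : normedModType R) k (e : 'I_k -> X) :
  closed (frame_span e).
Proof.
have s0 : closed_subspace [set (0 : X)].
  split=> // [|a x y -> ->]; last by rewrite scaler0 addr0.
  exact/accessible_closed_set1/hausdorff_accessible/norm_hausdorff.
have fs : finite_span (frame_span e) by exists k, e.
have [+ _ _] := closed_add_span s0 fs; congr closed; apply/seteqP; split=> x.
  by move=> [_ [v [-> Vv ->]]]; rewrite add0r.
by move=> Vx; exists 0, x; rewrite add0r.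
Qed.

Section bundle_inclusion.
Context (R : realType) d (T : measurableType d) (P : probability T R)
  (sigma : T -> T) (X X' : normedModType R) (iota : {linear X' -> X})
  (L : T -> {linear X -> X}) (L' : T -> {linear X' -> X'})
  (dX : nat -> X) (dX' : nat -> X').
Context (k k' : nat) (e : 'I_k -> T -> X) (e' : 'I_k' -> T -> X') (Om : set T)
  (lambda mu : R).
Hypotheses (mps : measure_preserving P sigma) (erg : ergodic P sigma)
  (dX_dense : dense_seq dX) (dX'_dense : dense_seq dX')
  (iota_norm : forall x, `|iota x| <= `|x|)
  (L'_cts : forall w, continuous (L' w))
  (mL' : forall x, borel_measurable (fun w => L' w x))
  (iL' : (\int[P]_w ((fun u => lne (opnorm (L' u))%:E)^\+ w) < +oo)%E)
  (me : forall i, borel_measurable (e i)) (me' : forall i, borel_measurable (e' i))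
  (mOm : measurable Om) (POm : P Om = 1%E) (stable : forall w, Om w -> Om (sigma w)).
Let V w := frame_span (e ^~ w).
Let V' w := frame_span (e' ^~ w).
Hypotheses
  (e'_free : forall w, Om w -> forall c : 'I_k' -> R,
     \sum_i c i *: e' i w = 0 -> forall i, c i = 0)
  (LV : forall w, Om w -> L w @` V w `<=` V (sigma w))
  (LV' : forall w, Om w -> L' w @` V' w = V' (sigma w))
  (iotaL : forall w, Om w -> forall x, iota (L' w x) = L w (iota x))
  (rate : forall w, Om w -> forall x, V' w x -> exact_rate (orbit_norm sigma L' w) lambda%:E x)
  (mu_lambda : mu < lambda)
  (split : forall w, Om w -> forall x, V' w x -> exists v f,
     [/\ V w v, slow (orbit_norm sigma L w) mu f & iota x = v + f]).

Let Phi w (c : 'I_k' -> R) := \sum_i c i *: e' i w.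
Let Psi w (c : 'I_k -> R) := \sum_i c i *: e i w.
Let p w l (t : 'rV[R]_k') := orbit_norm sigma L' w l (Phi w (t 0)).
Let b w := ln (Num.max 1 (opnorm (L' w))).

Let mL'n x : norm_measurable (fun w => L' w x).
Proof. exact/norm_measurable_borel. Qed.

Let b0 w : 0 <= b w.
Proof. by rewrite ln_ge0// le_max lexx. Qed.

Let mb : measurable_fun setT b.
Proof.
apply: (measurableT_comp (@measurable_ln R)); apply: measurable_maxr.
  exact: measurable_cst.
exact: (measurable_opnorm dX'_dense).
Qed.

Let ib : (\int[P]_w (b w)%:E < +oo)%E.
Proof.
rewrite (eq_integral ((fun u => lne (opnorm (L' u))%:E)^\+%E))// => w _.
rewrite funeposE /b; case: (leP (opnorm (L' w)) 1) => op1.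
  rewrite ln1; apply/esym/max_idPr.
  by rewrite lne_le0 lee_fin.
have o0 : 0 < opnorm (L' w) by apply: lt_trans op1.
rewrite lne_EFin//; apply/esym/max_idPl.
by rewrite lee_fin ln_ge0// ltW.
Qed.

Let sp w l : seminorm (p w l).
Proof.
have [nD nZ] := orbit_norm_seminorm sigma L' w l; split=> [u v|a u]; rewrite /p.
  rewrite (_ : Phi w ((u + v) 0) = Phi w (u 0) + Phi w (v 0))//.
  by rewrite /Phi -big_split/=; apply: eq_bigr => i _; rewrite mxE scalerDl.
rewrite (_ : Phi w ((a *: u) 0) = a *: Phi w (u 0))//.
by rewrite /Phi scaler_sumr; apply: eq_bigr => i _; rewrite mxE scalerA.
Qed.

Let Phi_eq0 w t : Om w -> Phi w ((t : 'rV[R]_k') 0) = 0 -> t = 0.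
Proof. by move=> Ow /(e'_free Ow) h; apply/rowP => i; rewrite mxE h. Qed.

Let growth w (t : 'rV[R]_k') : Om w -> t != 0 -> forall r, 0 < r -> exists N,
  forall n, (N <= n)%N -> exp_rate (lambda - r) n <= p w n t <= exp_rate (lambda + r) n.
Proof.
move=> Ow t0 r r0; have x0 : Phi w (t 0) != 0.
  by apply: contra_neq t0; exact: Phi_eq0.
have cv := rate Ow (ex_intro _ (t 0) erefl) x0.
have [|N1 H1] := @log_rate_cvg_gt _ _ _ (lambda - r) cv; first by rewrite lte_fin; lra.
have [|N2 H2] := @log_rate_cvg_lt _ _ _ (lambda + r) cv; first by rewrite lte_fin; lra.
exists (maxn N1 N2) => n; rewrite geq_max => /andP[n1 n2].
by rewrite H1// H2.
Qed.

(** An orbit that reaches 0 stays there, which a finite exponent excludes. *)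
Let p_def w l (t : 'rV[R]_k') : Om w -> p w l t = 0 -> t = 0.
Proof.
move=> Ow pl; apply/eqP; apply: contrapT => /negP t0.
have [N HN] := growth Ow t0 ltr01.
have pz n : (l <= n)%N -> p w n t = 0.
  move=> /subnKC <-; elim: (n - l)%N => [|m IH]; first by rewrite addn0.
  rewrite addnS /p /orbit_norm /=; have := IH; rewrite /p /orbit_norm => /eqP.
  by rewrite normr_eq0 => /eqP ->; rewrite linear0 normr0.
have /andP[+ _] := HN (maxn N l) (leq_maxl _ _).
by rewrite pz ?leq_maxr// leNgt exp_rate_gt0.
Qed.

Let shift w : Om w -> exists M : 'M[R]_k',
  forall l t, p (sigma w) l (t *m M) = p w l.+1 t.
Proof.
move=> Ow; have /choice[m Hm] (i : 'I_k') : exists c : 'I_k' -> R, L' w (e' i w) = Phi (sigma w) c.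
  have : V' (sigma w) (L' w (e' i w)).
    rewrite -LV'//; exists (e' i w) => //; by exists (fun j => (j == i)%:R); rewrite sum_delta.
  by move=> [c ->]; exists c.
exists (\matrix_(i, j) m i j) => l t; rewrite /p /orbit_norm cocycleSr; congr (`|cocycle _ _ _ _ _|).
rewrite linear_sum [RHS](eq_bigr (fun i => t 0 i *: Phi (sigma w) (m i))); last first.
  by move=> i _; rewrite linearZ/= Hm.
rewrite /Phi; under [RHS]eq_bigr do rewrite scaler_sumr.
rewrite exchange_big; apply: eq_bigr => j _; rewrite mxE scaler_suml.
by apply: eq_bigr => i _; rewrite mxE scalerA.
Qed.

Let step w l t : p w l.+1 t <= expR (b (iter l sigma w)) * p w l t.
Proof.
rewrite /p /orbit_norm /=; apply: (le_trans (opnorm_bound (@L'_cts _) _)).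
rewrite ler_wpM2r// /b lnK ?posrE; last by rewrite lt_max ltr01.
by rewrite le_max lexx orbT.
Qed.

Let mPhi c : norm_measurable (fun w => Phi w c).
Proof. by apply: (norm_measurable_comb dX'_dense) => i; exact: norm_measurable_borel. Qed.

Let mPsi c : norm_measurable (fun w => Psi w c).
Proof. by apply: (norm_measurable_comb dX_dense) => i; exact: norm_measurable_borel. Qed.

Let mp l (t : 'rV[R]_k') : measurable_fun setT (fun w => p w l t).
Proof.
apply: norm_measurable_norm; apply: (norm_measurable_cocycle l dX'_dense mps.1) => //.
Qed.

Let iota_cts : continuous iota.
Proof.
move=> x; apply: bounded_linear_continuous; apply/linear_boundedP.
exists 1; split => // r r1 u; apply: (le_trans (iota_norm u)).
by rewrite ler_peMl// ltW.
Qed.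

Let ratc n (q : 'rV[rat]_n) (i : 'I_n) : R := ratr (q 0 i).

(** The relative distance from [iota] of the fiber [V' w] to [V w] is at most [1 / (n + 1)], phrased
    with rational coefficients to be a measurable condition. *)
Let close n := [set w | forall t : 'rV[rat]_k', exists s : 'rV[rat]_k,
  `|iota (Phi w (ratc t)) - Psi w (ratc s)| <= n.+1%:R^-1 * `|Phi w (ratc t)|].

Let measurable_close n : measurable (close n).
Proof.
apply: measurable_forall => t; apply: measurable_exists => s; apply: measurable_le.
  apply: norm_measurable_norm.
  have -> : (fun w => iota (Phi w (ratc t)) - Psi w (ratc s)) =
      (fun w => iota (Phi w (ratc t)) + (-1) *: Psi w (ratc s)).
    by apply/funext => w; rewrite scaleN1r.
  apply: (norm_measurableD dX_dense).
    apply: (norm_measurable_app dX'_dense (A := fun=> iota)) => [w|x|].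
    - exact: iota_cts.
    - exact: norm_measurable_cst.
    - exact: mPhi.
  by apply: norm_measurableZ; exact: mPsi.
apply: measurable_funM; first exact: measurable_cst.
by apply: norm_measurable_norm; exact: mPhi.
Qed.

Let included w := forall x, V' w x -> V w (iota x).

Let Phi_rat_gt0 w (t : 'rV[rat]_k') : Om w -> t != 0 -> 0 < `|Phi w (ratc t)|.
Proof.
move=> Ow t0; rewrite normr_gt0; apply: contra_neq t0 => h.
apply/rowP => i; have := e'_free Ow h i; rewrite mxE /ratc => /eqP.
by rewrite fmorph_eq0 => /eqP.
Qed.

(** Half of the tolerance is kept for rounding the coefficients of the approximant to rationals. *)
Let approx_close w n : Om w ->
  (forall t : 'rV[rat]_k', t != 0 -> exists c, `|iota (Phi w (ratc t)) - Psi w c| <=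
     n.+1%:R^-1 / 2 * `|Phi w (ratc t)|) -> close n w.
Proof.
move=> Ow H t; have [->|t0] := eqVneq t 0.
  exists 0; rewrite /Phi /Psi !big1 ?linear0 ?addr0 ?normr0 ?mulr0// => i _.
    by rewrite /ratc mxE rmorph0 scale0r.
  by rewrite /ratc mxE rmorph0 scale0r.
have [c Hc] := H t t0; set x := Phi w _ in Hc *.
have x0 : 0 < `|x| by exact: Phi_rat_gt0.
have n0 : 0 < n.+1%:R^-1 / 2 :> R by rewrite divr_gt0.
have [s Hs] := frame_rat_approx (e ^~ w) c (mulr_gt0 n0 x0).
exists s; have := ler_distD (Psi w c) (iota x) (Psi w (ratc s)).
move: Hs Hc; rewrite -/(Psi w c) -/(Psi w (ratc s)); move: (n.+1%:R^-1) => h; lra.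
Qed.

Let included_close w n : Om w -> included w -> close n w.
Proof.
move=> Ow inc; apply: approx_close => // t _.
have [c Hc] := inc (Phi w (ratc t)) (ex_intro _ _ erefl).
by exists c; rewrite Hc subrr normr0 !mulr_ge0// invr_ge0.
Qed.

Let close_included w : Om w -> (forall n, close n w) -> included w.
Proof.
move=> Ow cl; have basis i : V w (iota (e' i w)).
  apply: (closed_approx (@closed_frame_span _ _ _ (e ^~ w))) => r r0.
  have [n Hn] : exists n, n.+1%:R^-1 * `|e' i w| < r.
    exists (Num.truncn (`|e' i w| / r)); rewrite mulrC ltr_pdivrMr// mulrC.
    by rewrite -ltr_pdivrMr// truncnS_gt.
  have [s] := cl n (delta_mx 0 i); rewrite (_ : Phi w _ = e' i w); last first.
    rewrite /Phi (bigD1 i)//= /ratc mxE !eqxx rmorph1 scale1r big1 ?addr0// => j ji.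
    by rewrite mxE eqxx/= (negbTE ji) rmorph0 scale0r.
  by move=> h; exists (Psi w (ratc s)); [exists (ratc s)|apply: le_lt_trans Hn].
move=> _ [c ->]; have /choice[m Hm] := basis.
exists (fun j => \sum_i c i * m i j); rewrite linear_sum.
under [RHS]eq_bigr do rewrite scaler_suml.
rewrite exchange_big; apply: eq_bigr => i _; rewrite linearZ/= Hm scaler_sumr.
by apply: eq_bigr => j _; rewrite scalerA.
Qed.

Let iterOm n w : Om w -> Om (iter n sigma w).
Proof. by move=> Ow; elim: n => //= n; exact: stable. Qed.

Let iota_cocycle n w x : Om w ->
  iota (cocycle sigma L' n w x) = cocycle sigma L n w (iota x).
Proof. by move=> Ow; elim: n => //= n <-; rewrite iotaL//; exact: iterOm. Qed.

Let V_cocycle n w x : Om w -> V w x -> V (iter n sigma w) (cocycle sigma L n w x).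
Proof.
move=> Ow Vx; elim: n => //= n IHn; apply: LV; first exact: iterOm.
by exists (cocycle sigma L n w x).
Qed.

Let V'_cocycle n w y : Om w -> V' (iter n sigma w) y ->
  exists2 x, V' w x & cocycle sigma L' n w x = y.
Proof.
move=> Ow; elim: n y => [|n IHn] y /=; first by exists y.
rewrite -LV'; last exact: iterOm.
by move=> [z /IHn[x Vx xz] <-]; exists x => //=; rewrite xz.
Qed.

(** The set [A] where the inclusion holds is mapped into itself, so it has measure 0 or 1. If 0,
    some [close n] has smaller measure than a set [Y] of uniform expansion, although every orbit
    starting in [Y] eventually stays in [close n]. *)
Lemma bundle_inclusion : {ae P, forall w, forall x, V' w x -> V w (iota x)}.
Proof.
pose A := Om `&` \bigcap_n close n.
have mA : measurable A.
  by apply: measurableI => //; apply: bigcapT_measurable => n; exact: measurable_close.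
have AP w : A w <-> Om w /\ included w.
  split=> [[Ow cl]|[Ow inc]]; split=> //; first by apply: close_included => // n; exact: cl.
  by move=> n _; exact: included_close.
have sA w : A w -> A (sigma w).
  rewrite !AP => -[Ow inc]; split; first exact: stable.
  move=> x; rewrite -LV'// => -[y V'y <-]; rewrite iotaL//.
  by apply: LV => //; exists (iota y) => //; exact: inc.
have [PA|PA] := invariant_zero_one mps erg mA sA; last first.
  exists (~` A); split; first exact: measurableC.
    by rewrite probability_setC// PA subee.
  by move=> w nw Aw; apply: nw; exact: ((AP w).1 Aw).2.
pose r := (lambda - mu) / 2; have r0 : 0 < r by rewrite divr_gt0// subr_gt0.
have [Y [mY PY YOm HY]] := uniform_expansion mps mOm POm stable sp
    p_def shift step b0 mb ib mp growth r0.
have dec : {homo (fun n => Om `&` close n) : n m / (n <= m)%N >-> (m <= n)%O}.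
  apply/nonincreasing_seqP => n; apply/subsetPset; apply: setIS => w cl t.
  have [s Hs] := cl t; exists s; apply: (le_trans Hs); rewrite ler_wpM2r//.
  by rewrite lef_pV2 ?posrE// ler_nat.
have AE : A = \bigcap_n (Om `&` close n).
  apply/seteqP; split=> [w [Ow cl] n _|w cl]; first by split=> //; exact: cl.
  have Ow := (cl 0%N I).1.
  by split=> // n _; exact: (cl n I).2.
have cvP : P (Om `&` close n) @[n --> \oo] --> 0%E.
  rewrite -PA AE; apply: nonincreasing_cvg_mu => //.
  - exact: le_lt_trans (probability_le1 _ (measurableI _ _ mOm (measurable_close 0))) (ltry _).
  - by move=> n; apply: measurableI.
  - by rewrite -AE.
have nb : nbhs (0%E : \bar R) [set y | (y < P Y)%E].
  by apply: open_nbhs_nbhs; split; [exact: open_ereal_lt_ereal|].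
have [n _ /(_ n (leqnn n)) /= Hn] := cvP _ nb.
exfalso; move: Hn; rewrite ltNge => /negP; apply.
apply: (eventually_measure_le mps mY); first exact: measurableI.
move=> w Yw; have Ow := YOm w Yw; have [c c0 Hc] := HY w Yw.
have /choice[vf Hvf] i : exists vf : X * X, [/\ V w vf.1, slow (orbit_norm sigma L w) mu vf.2 &
    iota (e' i w) = vf.1 + vf.2].
  have [|v [f [Vv sf E]]] := split Ow (x := e' i w); last by exists (v, f).
  by exists (fun j => (j == i)%:R); rewrite sum_delta.
have [K [K1 HK]] : exists K, 1 <= K /\ forall i : 'I_k', forall l,
    orbit_norm sigma L w l (vf i).2 <= K * exp_rate mu l.
  have /choice[K HK] i : exists K, forall l, orbit_norm sigma L w l (vf i).2 <= K * exp_rate mu l.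
    by have [_ [K HK] _] := Hvf i; exists K.
  exists (1 + \sum_i `|K i|); split; first by rewrite lerDl sumr_ge0.
  move=> i l; apply: (le_trans (HK i l)); rewrite ler_wpM2r ?exp_rate_ge0//.
  apply: (le_trans (ler_norm _)); rewrite (bigD1 i)//= addrCA lerDl addr_ge0// sumr_ge0//.
have K0 : 0 < K by apply: lt_le_trans K1.
have [N HN] := exp_rate_unbounded (k'%:R * K / c / (n.+1%:R^-1 / 2)) r0.
exists N => l Nl; split; first exact: iterOm.
apply: approx_close; first exact: iterOm.
move=> q q0; set y := Phi _ _.
have [_ [t0 ->] xy] := @V'_cocycle l w y Ow (ex_intro _ _ erefl).
pose t : 'rV[R]_k' := \row_i t0 i.
have tE : Phi w t0 = Phi w (t 0) by apply: eq_bigr => i _; rewrite mxE.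
have yp : `|y| = p w l t by rewrite -xy /p /orbit_norm -tE.
pose v := \sum_i t 0 i *: (vf i).1; pose f := \sum_i t 0 i *: (vf i).2.
have vfE : iota (Phi w (t 0)) = v + f.
  rewrite linear_sum /v /f -big_split/=; apply: eq_bigr => i _.
  by rewrite linearZ/=; have [_ _ ->] := Hvf i; rewrite scalerDr.
have Vv : V w v.
  have /choice[m Hm] i : exists m : 'I_k -> R, (vf i).1 = Psi w m.
    by have [[m ->] _ _] := Hvf i; exists m.
  exists (fun j => \sum_i t 0 i * m i j); under [RHS]eq_bigr do rewrite scaler_suml.
  rewrite exchange_big; apply: eq_bigr => i _; rewrite Hm scaler_sumr.
  by apply: eq_bigr => j _; rewrite scalerA.
have [s Hs] := V_cocycle l Ow Vv; exists s.
have -> : iota y - Psi (iter l sigma w) s = cocycle sigma L l w f.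
  have -> : Psi (iter l sigma w) s = cocycle sigma L l w v by rewrite Hs.
  by rewrite -xy -/(Phi w t0) tE iota_cocycle// vfE cocycleD addrAC subrr add0r.
have fle : `|cocycle sigma L l w f| <= k'%:R * K * `|t| * exp_rate mu l.
  rewrite /f cocycle_sum; apply: (le_trans (ler_norm_sum _ _ _)).
  apply: (@le_trans _ _ (\sum_(i < k') `|t| * (K * exp_rate mu l))).
    apply: ler_sum => i _; rewrite normrZ; apply: ler_pM => //.
      exact: rV_coord_le.
    exact: HK.
  rewrite sumr_const card_ord -mulr_natr.
  by rewrite le_eqVlt; apply/orP; left; apply/eqP; ring.
apply: (le_trans fle); rewrite yp; apply: le_trans (ler_wpM2l _ (Hc l t)); last first.
  by rewrite mulr_ge0// invr_ge0.
have lE : lambda - r = mu + r by rewrite /r; lra.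
rewrite lE exp_rateD.
have n0 : 0 < n.+1%:R^-1 / 2 :> R by rewrite divr_gt0.
have h : k'%:R * K <= n.+1%:R^-1 / 2 * c * exp_rate r l.
  have := ltW (HN l Nl); rewrite ler_pdivrMr// ler_pdivrMr//.
  by move=> /le_trans; apply; rewrite le_eqVlt; apply/orP; left; apply/eqP; ring.
have h2 : 0 <= `|t| * exp_rate mu l by rewrite mulr_ge0// exp_rate_ge0.
have := ler_wpM2r h2 h; rewrite [leLHS]mulrA => /le_trans; apply.
by rewrite le_eqVlt; apply/orP; left; apply/eqP; ring.
Qed.

Let large n := [set w | forall t : 'rV[rat]_k',
  n.+1%:R^-1 * `|Phi w (ratc t)| <= `|iota (Phi w (ratc t))|].

Let measurable_large n : measurable (large n).
Proof.
apply: measurable_forall => t; apply: measurable_le.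
  apply: measurable_funM; first exact: measurable_cst.
  by apply: norm_measurable_norm; exact: mPhi.
apply: norm_measurable_norm.
apply: (norm_measurable_app dX'_dense (A := fun=> iota)) => [w|x|].
- exact: iota_cts.
- exact: norm_measurable_cst.
- exact: mPhi.
Qed.

Let large_exists w : injective iota -> Om w -> exists n, large n w.
Proof.
move=> inj Ow; pose Q (t : 'rV[R]_k') := `|iota (Phi w (t 0))|.
have PhiD (u v : 'rV[R]_k') : Phi w ((u + v) 0) = Phi w (u 0) + Phi w (v 0).
  by rewrite /Phi -big_split/=; apply: eq_bigr => i _; rewrite mxE scalerDl.
have PhiZ a (u : 'rV[R]_k') : Phi w ((a *: u) 0) = a *: Phi w (u 0).
  by rewrite /Phi scaler_sumr; apply: eq_bigr => i _; rewrite mxE scalerA.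
have sQ : seminorm Q.
  split=> [u v|a u]; rewrite /Q; first by rewrite PhiD linearD ler_normD.
  by rewrite PhiZ linearZ normrZ.
have Q0 t : Q t = 0 -> t = 0.
  move=> /eqP; rewrite normr_eq0 => /eqP h; apply: (Phi_eq0 Ow).
  by apply: inj; rewrite linear0.
have [c c0 Hc] := norm_rV_lower sQ Q0.
have [C C0 HC] := seminorm_rV_bound (sp w 0).
exists (Num.truncn (C / c)) => t; set n := Num.truncn _.
pose t' : 'rV[R]_k' := \row_i ratc t i.
have tE : Phi w (ratc t) = Phi w (t' 0) by apply: eq_bigr => i _; rewrite mxE.
rewrite tE -[leRHS]/(Q t') mulrC ler_pdivrMr//; apply: (le_trans (HC t')).
have Cn : C <= c * n.+1%:R by rewrite -ler_pdivrMl// mulrC ltW// truncnS_gt.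
apply: (le_trans (ler_wpM2r (normr_ge0 t') Cn)).
by rewrite mulrAC ler_wpM2r.
Qed.

Let large_real n w c : large n w -> n.+1%:R^-1 * `|Phi w c| <= `|iota (Phi w c)|.
Proof.
move=> ln; apply/ler_addgt0Pr => r r0.
have r2 : 0 < r / 2 by rewrite divr_gt0.
have [t Ht] := frame_rat_approx (e' ^~ w) c r2.
rewrite -/(Phi w c) -/(Phi w (ratc t)) in Ht.
have h1 := ln t; have h2 := iota_norm (Phi w c - Phi w (ratc t)).
rewrite linearB in h2.
have h3 := ler_distD (iota (Phi w c)) 0 (iota (Phi w (ratc t))).
rewrite !sub0r !normrN in h3.
have h4 := ler_distD (Phi w (ratc t)) 0 (Phi w c).
rewrite !sub0r !normrN distrC in h4.
have n1 : n.+1%:R^-1 <= 1 :> R by rewrite invf_le1// ler1n.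
have n0 : 0 <= n.+1%:R^-1 :> R by rewrite invr_ge0.
have h5 := ler_wpM2l n0 h4; rewrite mulrDr in h5.
have h6 : n.+1%:R^-1 * `|Phi w c - Phi w (ratc t)| <= `|Phi w c - Phi w (ratc t)|.
  by rewrite ler_piMl.
move: h1 h5 h6; move: (n.+1%:R^-1) => z; lra.
Qed.

(* Recurrence to a set where the two norms are uniformly equivalent on the
   bundle: growth in the weaker norm is at least [lambda] along a subsequence. *)
Lemma bundle_not_slow : injective iota -> (0 < k')%N -> exists w x, [/\ Om w, V' w x &
  forall a, a < lambda -> ~ slow (orbit_norm sigma L w) a (iota x)].
Proof.
move=> inj k0; have [n Pn] : exists n, (0 < P (large n))%E.
  apply: contrapT => nP; have PL n : P (large n) = 0%E.
    apply/eqP; rewrite eq_le measure_ge0 andbT leNgt; apply/negP => h.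
    by apply: nP; exists n.
  have mU : measurable (\bigcup_n large n) by exact: bigcupT_measurable.
  have PU : P (\bigcup_n large n) = 0%E.
    apply/negligibleP => //; apply: negligible_bigcup => n.
    exact: (negligibleP P (measurable_large n)).2 (PL n).
  have : (P Om <= P (\bigcup_n large n))%E.
    apply: le_measure; rewrite ?inE// => w Ow.
    by have [n ln] := large_exists inj Ow; exists n.
  by rewrite POm PU leNgt lte01.
have [w Ow rec] := recurrence mps (measurable_large n) Pn mOm POm.
pose i0 := Ordinal k0; pose c (i : 'I_k') : R := (i == i0)%:R.
have x0 : Phi w c != 0.
  apply/eqP => /(e'_free Ow)/(_ i0)/eqP; by rewrite /c eqxx oner_eq0.
exists w, (Phi w c); split=> //; first by exists c.
move=> a al; have [c1 [ac1 c1l]] : exists c1, a < c1 /\ c1 < lambda.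
  by exists ((a + lambda) / 2); lra.
have [c2 [c12 c2l]] : exists c2, c1 < c2 /\ c2 < lambda.
  by exists ((c1 + lambda) / 2); lra.
have [|N1 H1] := @log_rate_cvg_gt _ _ _ c2 (rate Ow (ex_intro _ c erefl) x0).
  by rewrite lte_fin.
have d0 : 0 < c2 - c1 by rewrite subr_gt0.
have [N2 H2] := exp_rate_unbounded n.+1%:R d0.
apply: (not_slow ac1) => N.
have [m] := rec (maxn N (maxn N1 N2)); rewrite !geq_max => /and3P[Nm N1m N2m] lm.
exists m => //; rewrite /orbit_norm -iota_cocycle//.
have : V' (iter m sigma w) (cocycle sigma L' m w (Phi w c)).
  elim: m {Nm N1m N2m lm} => [|m IHm] /=; first by exists c.
  by rewrite -LV'; [exists (cocycle sigma L' m w (Phi w c))|exact: iterOm].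
move=> [c' c'E]; have := large_real c' lm; rewrite -[Phi _ c']c'E => /(le_trans _); apply.
have n0 : 0 < n.+1%:R :> R by [].
rewrite ler_pdivlMl//; apply: le_trans (H1 m N1m).
have -> : c2 = (c2 - c1) + c1 by rewrite subrK.
by rewrite exp_rateD ler_wpM2r ?exp_rate_ge0// ltW// H2.
Qed.

End bundle_inclusion.

(** * Comparison of the exponents *)

Section exponents.
Context (R : realType) (lambda1 kappa : \bar R) (lam : nat -> \bar R)
  (lamE : exceptional_exponents lambda1 kappa lam) (kl : (kappa < lambda1)%E).

Lemma exponent_ge j : (kappa <= lam j)%E.
Proof.
have [lam0 _ dec pad] := lamE; elim: j => [|j]; first by rewrite lam0 ltW.
rewrite le_eqVlt => /predU1P[/esym/pad -> //|/dec/andP[]//].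
Qed.

Lemma exponent_lt j : (kappa < lam j)%E -> (lam j.+1 < lam j)%E.
Proof. by have [_ _ dec _] := lamE; move=> /dec/andP[]. Qed.

Lemma exponent_anti i j : (i <= j)%N -> (lam j <= lam i)%E.
Proof.
have [lam0 _ dec pad] := lamE; elim: j => [|j IHj]; first by rewrite leqn0 => /eqP ->.
rewrite leq_eqVlt => /predU1P[->//|]; rewrite ltnS => /IHj; apply: le_trans.
have := exponent_ge j; rewrite le_eqVlt => /predU1P[kj|/exponent_lt/ltW//].
by rewrite (pad _ (esym kj)) kj.
Qed.

Lemma exponent_strict i j : (i < j)%N -> (kappa < lam j)%E -> (lam j < lam i)%E.
Proof.
move=> ij kj; apply: le_lt_trans (exponent_anti ij) _.
by apply: exponent_lt; apply: lt_le_trans kj (exponent_anti (ltnW ij)).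
Qed.

Lemma exponent_real j : (kappa < lam j)%E -> exists r : R, lam j = r%:E.
Proof.
have [_ fin _ _] := lamE; have := fin j.
by case: (lam j) => [r _ _|//|_ ]; [exists r|rewrite ltNge leNye].
Qed.

End exponents.

Definition splitting_at (R : realType) (X : normedModType R) (q : nat -> X -> R)
    (kappa : \bar R) (lam : nat -> \bar R) (V : nat -> set X) := forall j, (kappa < lam j)%E ->
  [/\ finite_span (V j), exists2 x, V j x & x != 0,
      forall x, V j x -> exact_rate q (lam j) x &
      exists F, [/\ closed_subspace F, direct_decomposition j V F &
                    forall x, F x -> rate_le q (lam j.+1) x]].

Lemma finite_span_subspace (R : realType) (X : normedModType R) (V : set X) a x y :
  finite_span V -> V x -> V y -> V (a *: x + y).
Proof.
move=> [k [e ->]] [c ->] [b ->]; exists (fun i => a * c i + b i).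
rewrite scaler_sumr -big_split/=; apply: eq_bigr => i _.
by rewrite scalerA scalerDl.
Qed.

Lemma finite_span0 (R : realType) (X : normedModType R) (V : set X) :
  finite_span V -> V 0.
Proof. by move=> [k [e ->]]; exists (fun=> 0); rewrite big1// => i _; rewrite scale0r. Qed.

Lemma finite_span_image (R : realType) (X Y : normedModType R) (f : {linear X -> Y})
  (V : set X) : finite_span V -> finite_span (f @` V).
Proof.
move=> [k [e ->]]; exists k, (f \o e); apply/seteqP; split=> y.
  by move=> [_ [c ->] <-]; exists c; rewrite linear_sum; apply: eq_bigr => i _; rewrite linearZ.
move=> [c ->]; exists (\sum_i c i *: e i); first by exists c.
by rewrite linear_sum; apply: eq_bigr => i _; rewrite linearZ.
Qed.

Section comparison.
Context (R : realType) (X X' : normedModType R) (iota : {linear X' -> X})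
  (q : nat -> X -> R) (q' : nat -> X' -> R) (lambda1 lambda1' kappa kappa' : \bar R)
  (lam lam' : nat -> \bar R) (V : nat -> set X) (V' : nat -> set X').
Hypotheses (sq : forall n, seminorm (q n)) (sq' : forall n, seminorm (q' n))
  (iota_le : forall n x, q n (iota x) <= q' n x)
  (iota_dense : dense (range iota))
  (lamE : exceptional_exponents lambda1 kappa lam) (kl : (kappa < lambda1)%E)
  (lamE' : exceptional_exponents lambda1' kappa' lam') (kl' : (kappa' < lambda1')%E)
  (top : forall x, rate_le q (lam 0%N) x) (top' : forall x, rate_le q' (lam' 0%N) x)
  (HV : splitting_at q kappa lam V) (HV' : splitting_at q' kappa' lam' V').

Lemma slow_iota a x : slow q' a x -> slow q a (iota x).
Proof. by move=> [C HC]; exists C => n; exact: le_trans (HC n). Qed.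

Lemma vanishing_components j (v : 'I_j.+1 -> X) f a (i0 : nat) : (kappa < lam j)%E ->
  (forall i : 'I_j.+1, V i (v i)) -> rate_le q (lam j.+1) f ->
  slow q a (\sum_i v i + f) -> (i0 <= j)%N -> (a%:E < lam i0)%E ->
  forall i : 'I_j.+1, (i <= i0)%N -> v i = 0.
Proof.
move=> kj Vv rf; apply: component_eq0 => // [i ij|i].
  by apply: (exponent_lt lamE); apply: lt_le_trans (exponent_anti lamE kl ij).
have ij : (i <= j)%N by rewrite -ltnS.
have [_ _ + _] := HV (lt_le_trans kj (exponent_anti lamE kl ij)).
by apply; exact: Vv.
Qed.

Lemma tail_decomposition n x : (forall i, (i < n)%N -> (kappa' < lam' i)%E) ->
  exists (v' : 'I_n -> X') f', [/\ forall i : 'I_n, V' i (v' i),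
    rate_le q' (lam' n) f' & x = \sum_i v' i + f'].
Proof.
case: n => [_|n kn].
  by exists (fun=> 0), x; split; [case|exact: top'|rewrite big_ord0 add0r].
have [_ _ _ [F [_ [dec _] rF]]] := HV' (kn n (ltnSn n)).
by have [v [f [Vv Ff ->]]] := dec x; exists v, f; split=> //; exact: rF.
Qed.

Lemma exponent_le_of_fast j x : (forall i, (i < j)%N -> lam i = lam' i) ->
  (maxe kappa kappa' < lam' j)%E -> V' j x ->
  (forall a, (a%:E < lam' j)%E -> ~ slow q a (iota x)) -> (lam' j <= lam j)%E.
Proof.
move=> lamI; rewrite gt_max => /andP[kj k'j] Vx nslow; rewrite leNgt; apply/negP => lj.
have [a [la al]] := ereal_between lj; apply: (nslow a al).
have [_ _ rV _] := HV' k'j.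
have rx : rate_le q' (lam' j) x by apply: exact_rate_le => //; exact: rV.
case: j => [|j] in lamI kj k'j Vx nslow lj la al rV rx *; first exact: top.
have lj' := lamI j (ltnSn j).
have kj' : (kappa < lam j)%E by rewrite lj' (lt_le_trans kj)// (exponent_anti lamE').
have [_ _ _ [F [_ [dec _] rF]]] := HV kj'.
have [v [f [Vv Ff xE]]] := dec (iota x).
have [c [lc cl]] := ereal_between (exponent_strict lamE' kl' (ltnSn j) k'j).
have v0 : forall i : 'I_j.+1, (i <= j)%N -> v i = 0.
  apply: (@vanishing_components j v f c j) => //; first exact: rF.
    by rewrite -xE; apply: slow_iota; exact: rx.
  by rewrite lj'.
rewrite xE big1 ?add0r => [|i _]; last by rewrite v0// -ltnS.
exact: rF.
Qed.

Lemma dense_decomposition j n (U : nat -> set X) F : (kappa < lam j)%E -> (lam' n < lam j)%E ->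
  (forall i, (i < n)%N -> (kappa' < lam' i)%E) ->
  (forall i, (i < n)%N -> finite_span (U i)) ->
  (forall i, (i < n)%N -> forall x, V' i x -> U i (iota x)) ->
  closed_subspace F -> direct_decomposition j V F ->
  (forall x, F x -> rate_le q (lam j.+1) x) ->
  forall y, exists f (u : 'I_n -> X), [/\ F f, forall i : 'I_n, U i (u i) & y = f + \sum_i u i].
Proof.
move=> kj lnj kn sU VU sF [dec _] rF; have [cW _ _] := closed_add_spans sF sU.
apply: (dense_closed_subset iota_dense cW) => _ [x _ <-].
have [v' [f' [Vv' rf' ->]]] := tail_decomposition x kn.
have [a [la al]] := ereal_between lnj.
have [v [f [Vv Ff fE]]] := dec (iota f').
have v0 : forall i : 'I_j.+1, (i <= j)%N -> v i = 0.
  apply: (@vanishing_components j v f a j) => //; first exact: rF.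
  by rewrite -fE; apply: slow_iota; exact: rf'.
exists f, (fun i => iota (v' i)); split=> // [i|]; first by apply: VU.
rewrite linearD linear_sum addrC fE big1 ?add0r// => i _.
by rewrite v0// -ltnS.
Qed.

Lemma direct_unique j F y f (u : 'I_j.+1 -> X) : finite_span (V j) ->
  direct_decomposition j V F -> (forall i : 'I_j.+1, V i (u i)) -> F f -> V j y ->
  y = f + \sum_i u i -> y = u ord_max.
Proof.
move=> sV [_ uniq] Vu Ff Vy yE.
pose u' (i : 'I_j.+1) := if i == ord_max then - y + u i else u i.
have [|||u0 _] := uniq u' f.
- move=> i; rewrite /u'; case: eqP => [->|_]; last exact: Vu.
  rewrite -[- y]scaleN1r; exact: (finite_span_subspace _ sV Vy (Vu ord_max)).
- exact: Ff.
- rewrite (bigD1 ord_max)//= /u' eqxx (eq_bigr u); last by move=> i /negbTE ->.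
  have S : \sum_i u i = u ord_max + \sum_(i < j.+1 | i != ord_max) u i by rewrite (bigD1 ord_max).
  by rewrite -(addrA (- y)) -S -addrA [_ + f]addrC -yE addNr.
have := u0 ord_max; rewrite /u' eqxx => /eqP.
by rewrite addrC subr_eq0 => /eqP.
Qed.

Lemma exponent_ge_of_dense j : (forall i, (i < j)%N -> lam i = lam' i) ->
  (forall i, (i < j)%N -> V i = iota @` V' i) ->
  (maxe kappa kappa' < lam j)%E -> (lam j <= lam' j)%E.
Proof.
move=> lamI VI; rewrite gt_max => /andP[kj k'j]; rewrite leNgt; apply/negP => lj.
have [sV [y Vy y0] _ [F [sF dec rF]]] := HV kj.
have kn i : (i < j)%N -> (kappa' < lam' i)%E.
  move=> ij; rewrite -lamI//; apply: lt_le_trans k'j _.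
  by apply: (exponent_anti lamE kl); exact: ltnW.
have sVi i : (i < j)%N -> finite_span (V i).
  move=> ij; have [] := HV (lt_le_trans kj (exponent_anti lamE kl (ltnW ij))).
  by [].
have [|f [u [Ff Vu yE]]] := dense_decomposition kj lj kn sVi _ sF dec rF y.
  by move=> i ij x Vx; rewrite VI//; exists x.
pose u' (i : nat) := if insub i is Some i' then u i' else 0.
have u'E (i : 'I_j) : u' i = u i by rewrite /u' valK.
have u'j : u' j = 0 by rewrite /u' insubF ?ltnn.
have Vu' (i : 'I_j.+1) : V i (u' i).
  have [ij|ji] := ltnP i j; first by rewrite (u'E (Ordinal ij)); exact: (Vu (Ordinal ij)).
  have -> : i = j :> nat by apply/eqP; rewrite eqn_leq ji -ltnS ltn_ord.
  by rewrite u'j; exact: finite_span0.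
have yE' : y = f + \sum_(i < j.+1) u' i.
  rewrite big_ord_recr/= u'j addr0 yE; congr (_ + _).
  by apply: eq_bigr => i _; rewrite u'E.
have /eqP := direct_unique sV dec Vu' Ff Vy yE'.
by rewrite /= u'j (negbTE y0).
Qed.

Lemma bundle_ge_of_dense j : (forall i, (i <= j)%N -> lam i = lam' i) ->
  (forall i, (i < j)%N -> V i = iota @` V' i) ->
  (maxe kappa kappa' < lam j)%E -> iota @` V' j `<=` V j -> V j `<=` iota @` V' j.
Proof.
move=> lamI VI; rewrite gt_max => /andP[kj k'j] inc y Vy.
have [sV _ _ [F [sF dec rF]]] := HV kj.
have kn i : (i < j.+1)%N -> (kappa' < lam' i)%E.
  move=> ij; rewrite -lamI//; apply: lt_le_trans k'j _.
  exact: (exponent_anti lamE kl).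
have lj : (lam' j.+1 < lam j)%E.
  by rewrite lamI//; apply: (exponent_lt lamE'); exact: kn.
have VV' i : (i <= j)%N -> iota @` V' i `<=` V i.
  by rewrite leq_eqVlt => /predU1P[->//|ij]; rewrite VI.
have sU i : (i < j.+1)%N -> finite_span (iota @` V' i).
  by move=> ij; apply: finite_span_image; have [] := HV' (kn i ij).
have [|f [u [Ff Uu yE]]] := dense_decomposition kj lj kn sU _ sF dec rF y.
  by move=> i _ x Vx; exists x.
rewrite (direct_unique sV dec _ Ff Vy yE); first exact: (Uu ord_max).
by move=> i; apply: VV' (Uu i); rewrite -ltnS.
Qed.

Lemma image_component j x : (forall i, (i < j)%N -> lam i = lam' i) -> lam j = lam' j ->
  (maxe kappa kappa' < lam j)%E -> V' j x ->
  exists v f, [/\ V j v, rate_le q (lam j.+1) f & iota x = v + f].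
Proof.
move=> lamI lj; rewrite gt_max => /andP[kj k'j] Vx.
have [sV _ _ [F [sF [dec _] rF]]] := HV kj.
have [v [f [Vv Ff xE]]] := dec (iota x).
exists (v ord_max), f; split; [exact: (Vv ord_max)|exact: rF|].
rewrite xE big_ord_recr/= big1 ?add0r// => i _.
case: j => [|j] in lamI lj kj k'j Vx sV F sF dec rF v f Vv Ff xE i *; first by case: i.
have k'j' : (kappa' < lam' j.+1)%E by rewrite -lj.
have [c [lc cl]] := ereal_between (exponent_strict lamE kl (ltnSn j) kj).
apply: (@vanishing_components j.+1 v f c j) => //; first exact: rF.
  rewrite -xE; apply: slow_iota; have [_ _ rV _] := HV' k'j'.
  by apply: (exact_rate_le sq' (rV x Vx)); rewrite -lj.
by rewrite /= -ltnS.
Qed.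

End comparison.

Section cocycle_norm.
Context (R : realType) d (T : measurableType d) (X : normedModType R)
  (sigma : T -> T) (L : T -> {linear X -> X}) (L_cts : forall w, continuous (L w)).

Lemma cocycle_opnorm n w x :
  `|cocycle sigma L n w x| <= opnorm (cocycle sigma L n w) * `|x|.
Proof.
pose F := HB.pack_for {linear X -> X} (cocycle sigma L n w)
  (GRing.isLinear.Build _ _ _ _ (cocycle sigma L n w) (@cocycle_linear _ _ _ _ sigma L n w)).
apply: (@opnorm_bound _ _ _ F).
rewrite /F /=; elim: n {F} => [|n IHn] y /=; first exact: cvg_id.
exact: continuous_comp (IHn y) (@L_cts _ _).
Qed.

Lemma top_rate w lambda1 :
  log_rate n (opnorm (cocycle sigma L n w)) @[n --> \oo] --> lambda1 ->
  forall x, rate_le (orbit_norm sigma L w) lambda1 x.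
Proof.
move=> cv x a la; have [N HN] := log_rate_cvg_lt cv la.
have [C _ HC] := eventually_bound HN.
exists (C * `|x|) => n; apply: (le_trans (cocycle_opnorm n w x)).
by rewrite mulrAC ler_wpM2r.
Qed.

End cocycle_norm.

Lemma oseledets_splitting_at (R : realType) d (T : measurableType d)
    (P : probability T R) (sigma : T -> T) (X : normedModType R)
    (L : T -> {linear X -> X}) (lambda1 kappa : \bar R) lam (V : nat -> T -> set X) :
  oseledets_splitting P sigma L lambda1 kappa lam V ->
  {ae P, forall w, splitting_at (orbit_norm sigma L w) kappa lam (V^~ w)}.
Proof.
move=> [_ osel]; apply: ae_foralln => j.
have [kj|nkj] := pselect (kappa < lam j)%E; last by apply: aeW => w kj.
have [[k [e [k0 _ He]]] _ Hrate [F [H1 H2 _ H3]]] := osel j kj.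
apply: filterS2 (filterI He Hrate) (filterI H1 (filterI H2 H3)).
move=> w [[VE efree] rV] [cF [dF rF]] _; split.
- by exists k, (e ^~ w).
- exists (e (Ordinal k0) w).
    by rewrite VE; exists (fun i => (i == Ordinal k0)%:R); rewrite sum_delta.
  apply/eqP => e0; have s0 : \sum_i (i == Ordinal k0)%:R *: e i w = 0 by rewrite sum_delta.
  by have /eqP := efree _ s0 (Ordinal k0); rewrite eqxx oner_eq0.
- by move=> x Vx x0; exact: rV.
- by exists (F w); split=> // x Fx; apply: limsup_rate_le; exact: rF.
Qed.

Theorem theorem7 (R : realType) (d : measure_display) (Omega : measurableType d)
    (P : probability Omega R) (sigma : Omega -> Omega)
    (X X' : completeNormedModType R) (iota : {linear X' -> X})
    (L : Omega -> {linear X -> X}) (L' : Omega -> {linear X' -> X'})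
    (lambda1 lambda1' kappa kappa' : \bar R)
    (lam lam' : nat -> \bar R)
    (V : nat -> Omega -> set X) (V' : nat -> Omega -> set X')
    (X'_dense : dense_subspace_finer_norm iota)
    (L_preserves : {ae P, forall w, L w @` range iota `<=` range iota})
    (L'_restriction : restriction_of P iota L L')
    (hyp : met_hypotheses P sigma L lambda1 kappa)
    (hyp' : met_hypotheses P sigma L' lambda1' kappa')
    (osel : oseledets_splitting P sigma L lambda1 kappa lam V)
    (osel' : oseledets_splitting P sigma L' lambda1' kappa' lam' V') :
  forall j : nat,
    (maxe kappa kappa' < maxe (lam j) (lam' j))%E ->
    lam j = lam' j /\ {ae P, forall w, V j w = iota @` V' j w}.
Proof.
have [mps erg L_cts mL] := met_system hyp.
have [_ _ L'_cts mL'] := met_system hyp'.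
have kl := met_quasi_compact hyp; have kl' := met_quasi_compact hyp'.
have [lamE _] := osel; have [lamE' _] := osel'.
have [inj iota_dense iota_norm] := X'_dense.
have [dX' dX'_dense] := separable_dual_dense (met_separable_dual hyp').
have dX_dense := dense_range_seq iota_dense iota_norm dX'_dense.
elim/ltn_ind => j IH Kj.
have Kmax i : (i <= j)%N -> (maxe kappa kappa' < maxe (lam i) (lam' i))%E.
  move=> ij; apply: (lt_le_trans Kj); rewrite ge_max !le_max.
  by rewrite (exponent_anti lamE kl ij) (exponent_anti lamE' kl' ij) orbT.
have lamI i : (i < j)%N -> lam i = lam' i.
  by move=> ij; have [] := IH i ij (Kmax i (ltnW ij)).
pose good w := [/\ splitting_at (orbit_norm sigma L w) kappa lam (V^~ w),
  splitting_at (orbit_norm sigma L' w) kappa' lam' (V'^~ w),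
  forall i, (i < j)%N -> V i w = iota @` V' i w,
  forall x, iota (L' w x) = L w (iota x) &
  (forall x, rate_le (orbit_norm sigma L w) (lam 0%N) x) /\
  (forall x, rate_le (orbit_norm sigma L' w) (lam' 0%N) x)].
have good_ae : {ae P, forall w, good w}.
  have aeV : {ae P, forall w, forall i, (i < j)%N -> V i w = iota @` V' i w}.
    apply: ae_foralln => i; have [ij|_] := boolP (i < j)%N; last exact: aeW.
    by have [_] := IH i ij (Kmax i (ltnW ij)); apply: filterS => w ->.
  apply: filterS2 (filterI (oseledets_splitting_at osel) (oseledets_splitting_at osel'))
    (filterI (filterI aeV L'_restriction)
       (filterI (met_top_exponent hyp) (met_top_exponent hyp'))).
  move=> w [S S'] [[VI rest] [top top']]; split=> //.
  have [lam0 _ _ _] := lamE; have [lam0' _ _ _] := lamE'.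
  by rewrite lam0 lam0'; split=> x; exact: top_rate.
have iota_le Om w : (forall w, Om w -> Om (sigma w)) -> Om `<=` good -> Om w ->
    forall n x, orbit_norm sigma L w n (iota x) <= orbit_norm sigma L' w n x.
  move=> stab OmG Ow n x; rewrite /orbit_norm.
  suff -> : cocycle sigma L n w (iota x) = iota (cocycle sigma L' n w x) by exact: iota_norm.
  elim: n => //= n ->; have [_ _ _ -> _] // : good (iter n sigma w).
  by apply: OmG; elim: n => //= n; exact: stab.
have orb w := orbit_norm_seminorm sigma L w.
have orb' w := orbit_norm_seminorm sigma L' w.
have le' : (maxe kappa kappa' < lam' j)%E -> (lam' j <= lam j)%E.
  move=> Kl'; have k'j : (kappa' < lam' j)%E by move: Kl'; rewrite gt_max => /andP[].
  have [r rE] := exponent_real lamE' k'j.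
  have [[k' [e' [k0 me' He']]] LV' _ _] := osel'.2 j k'j.
  have [Om [mOm POm stab OmG]] := ae_stable mps (filterI good_ae (filterI He' LV')).
  have OmG' : Om `<=` good by move=> w /OmG[].
  have VE w : Om w -> V' j w = frame_span (e' ^~ w) by move=> /OmG[_ [[]]].
  have [||||w [x [Ow Vx nslow]]] := @bundle_not_slow R d Omega P sigma X X' iota L L' dX' k' e' Om r
    mps dX'_dense iota_norm me' mOm POm stab _ _ _ _ inj k0.
  - by move=> w /OmG[_ [[_ H]]].
  - by move=> w Ow; rewrite -!VE//; [have [_ []] := OmG w Ow|exact: stab].
  - by move=> w /OmG'[].
  - move=> w Ow x Vx; rewrite -rE; have [_ S' _ _ _] := OmG' w Ow.
    by have [_ _ + _] := S' j k'j; apply; rewrite /= VE.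
  have [S S' _ _ [top _]] := OmG' w Ow.
  apply: (@exponent_le_of_fast _ _ _ iota _ _ _ _ _ _ _ _ _ _ (orb w) (orb' w)
    (iota_le Om w stab OmG' Ow) lamE kl lamE' kl' top S S' j x lamI Kl').
    by rewrite VE.
  by move=> a; rewrite rE lte_fin => /nslow.
have le : (maxe kappa kappa' < lam j)%E -> (lam j <= lam' j)%E.
  move=> Kl; have [Om [mOm POm stab OmG]] := ae_stable mps good_ae.
  have [w Ow] : Om !=set0.
    by apply/set0P/eqP => Om0; move: POm; rewrite Om0 measure0 => /eqP; rewrite eq_sym onee_eq0.
  have [S S' VI _ [_ top']] := OmG w Ow.
  exact: (@exponent_ge_of_dense _ _ _ iota _ _ _ _ _ _ _ _ _ (orb w)
    (iota_le Om w stab OmG Ow) iota_dense lamE kl top' S S' j lamI VI Kl).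
have [Kl Kl'] : (maxe kappa kappa' < lam j)%E /\ (maxe kappa kappa' < lam' j)%E.
  by move: Kj; rewrite lt_max => /orP[K|K]; split=> //;
    [exact: lt_le_trans K (le K)|exact: lt_le_trans K (le' K)].
have lamj : lam j = lam' j by apply/eqP; rewrite eq_le le// le'.
split=> //.
have kj : (kappa < lam j)%E by move: Kl; rewrite gt_max => /andP[].
have k'j : (kappa' < lam' j)%E by move: Kl'; rewrite gt_max => /andP[].
have [r rE] := exponent_real lamE' k'j.
have [[k [e [k0 me He]]] LV _ _] := osel.2 j kj.
have [[k' [e' [k0' me' He']]] LV' _ _] := osel'.2 j k'j.
have [Om [mOm POm stab OmG]] := ae_stable mps
  (filterI good_ae (filterI (filterI He LV) (filterI He' LV'))).
have OmG' : Om `<=` good by move=> w /OmG[].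
have VE w : Om w -> V j w = frame_span (e ^~ w) by move=> /OmG[_ [[[]]]].
have VE' w : Om w -> V' j w = frame_span (e' ^~ w) by move=> /OmG[_ [_ [[]]]].
have [mu [lmu mul]] := ereal_between (exponent_lt lamE kj).
have inc : {ae P, forall w, forall x, frame_span (e' ^~ w) x -> frame_span (e ^~ w) (iota x)}.
  apply: (@bundle_inclusion R d Omega P sigma X X' iota L L' _ dX' k k' e e' Om r mu
    mps erg dX_dense dX'_dense iota_norm L'_cts mL' (met_integrable hyp') me me' mOm POm stab).
  - by move=> w /OmG[_ [_ [[_ H]]]].
  - by move=> w Ow; rewrite -!VE//; [have [_ [[_ ->] _]] := OmG w Ow|exact: stab].
  - by move=> w Ow; rewrite -!VE'//; [have [_ [_ [_ ->]]] := OmG w Ow|exact: stab].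
  - by move=> w /OmG'[].
  - move=> w Ow x Vx; rewrite -rE; have [_ S' _ _ _] := OmG' w Ow.
    by have [_ _ + _] := S' j k'j; apply; rewrite /= VE'.
  - by rewrite -lte_fin -rE -lamj.
  move=> w Ow x Vx; have [S S' _ _ _] := OmG' w Ow.
  have [|v [f [Vv rf xE]]] := @image_component _ _ _ iota _ _ _ _ _ _ _ _ _ (orb w) (orb' w)
    (iota_le Om w stab OmG' Ow) lamE kl S S' j x lamI lamj Kl.
    by rewrite /= VE'.
  by exists v, f; split; [rewrite -VE|exact: rf|exact: xE].
have OmAe : {ae P, forall w, Om w}.
  exists (~` Om); split=> //; first exact: measurableC.
  by rewrite probability_setC// POm subee.
apply: filterS2 inc OmAe => w incw Ow.
have [S S' VI _ [_ top']] := OmG' w Ow.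
have sub : iota @` V' j w `<=` V j w.
  by move=> _ [x + <-]; rewrite VE// VE'//; exact: incw.
apply/seteqP; split=> //.
apply: (@bundle_ge_of_dense _ _ _ iota _ _ _ _ _ _ _ _ _ _ (orb w)
  (iota_le Om w stab OmG' Ow) iota_dense lamE kl lamE' top' S S' j _ VI Kl sub).
by move=> i; rewrite leq_eqVlt => /predU1P[->//|]; exact: lamI.
Qed.
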